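(* Let $\alpha\in[1,2]$, let $r\ge\alpha$ be real, let $T>0$ be finite, and let $u_0\in H^r_{\mathrm{per}}(I)$ be real-valued. Then there exists a unique solution $u\in C^1([0,T];H^r_{\mathrm{per}}(I))$ of the fractional Benjamin-Bona-Mahony equation $$u_t+u_x+uu_x+\mathcal{D}^\alpha u_t=0,\quad x\in I,\ t\in(0,T],\qquad u(x,0)=u_0(x),\quad x\in I.$$
   Context: $I=[-\pi,\pi]$; functions are real-valued and $2\pi$-periodic in $x$. Fourier coefficients: $\hat u(k)=\frac1{2\pi}\int_I u(x)e^{-ikx}\,dx$, $k\in\mathbb{Z}$. For $r\ge0$, $H^r_{\mathrm{per}}(I)$ is the space of periodic functions with finite norm $\|u\|_r=\bigl(\sum_{k\in\mathbb{Z}}(1+|k|^2)^r|\hat u(k)|^2\bigr)^{1/2}$. The fractional Laplacian $\mathcal{D}^\alpha=(-\Delta)^{\alpha/2}$ is the Fourier multiplier $\widehat{\mathcal{D}^\alpha u}(k)=|k|^\alpha\hat u(k)$. The equation is understood as an identity in $L^2_{\mathrm{per}}(I)=H^0_{\mathrm{per}}(I)$. *)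

(* Defs.v *)
From HB Require Import structures.
From mathcomp Require Import all_boot all_order all_algebra.
From mathcomp Require Import all_classical all_reals all_analysis.
From mathcomp Require Import complex.

Set Implicit Arguments.
Unset Strict Implicit.
Unset Printing Implicit Defensive.

Import Order.TTheory GRing.Theory Num.Theory.
Import numFieldNormedType.Exports.

Local Open Scope classical_set_scope.
Local Open Scope ring_scope.

Section PeriodicSobolev.
Variable R : realType.
Implicit Types (u v w : R -> R) (k : int) (r alpha T : R).
Local Notation mu := (@lebesgue_measure R).

Definition I : set R := `[- pi, pi].

Definition periodic u := forall x : R, u (x + 2 * pi) = u x.

(* Elements of L2per and Hper are represented by functions; two functions stand
   for the same element when they are a.e. equal on I. *)
Definition eqI u v := ae_eq mu I u v.

Definition L2per u :=
  [/\ periodic u, measurable_fun [set: R] u &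
      mu.-integrable I (fun x => (u x ^+ 2)%:E)].

Definition cexpi (t : R) : R[i] := Complex (cos t) (sin t).

Definition cintegral (f : R -> R[i]) : R[i] :=
  Complex (\int[mu]_(x in I) complex.Re (f x))
          (\int[mu]_(x in I) complex.Im (f x)).

Definition fourier u k : R[i] :=
  real_complex R (2 * pi)^-1 *
  cintegral (fun x => real_complex R (u x) * cexpi (- (k%:~R * x))).

Definition Hnorm r u : \bar R :=
  ((\esum_(k in [set: int])
     ((1 + `|k%:~R : R| ^+ 2) `^ r * ComplexField.Normc.normc (fourier u k) ^+ 2)%:E)
   `^ (2^-1)%R)%E.

Definition Hper r u := L2per u /\ (Hnorm r u < +oo)%E.

(* [w] is the image of [u] under the fractional Laplacian of order [alpha]. *)
Definition is_fracD alpha u w :=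
  L2per w /\
  forall k, fourier w k = real_complex R (`|k%:~R : R| `^ alpha) * fourier u k.

(* Since I is a full period, the periodic test functions below produce no
   boundary term. *)
Definition is_weak_dx u w :=
  L2per w /\
  forall phi : R -> R, periodic phi -> (forall x : R, derivable phi x 1) ->
    continuous (derive1 phi) ->
    \int[mu]_(x in I) (u x * derive1 phi x) = - \int[mu]_(x in I) (w x * phi x).

(* The curve [u] is C^1 from [0, T] to H^r with derivative [ut], for the H^r
   norm; derivatives and continuity are one-sided at the endpoints. Curves are
   total in time, and their values outside [0, T] are irrelevant. *)
Definition C1_Hper r T (u ut : R -> R -> R) :=
  forall t : R, t \in `[0, T] ->
  [/\ Hper r (u t), Hper r (ut t),
      Hnorm r (fun x => (s - t)^-1 * (u s x - u t x) - ut t x)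
        @[s --> within `[0, T] t^'] --> 0%E &
      Hnorm r (fun x => ut s x - ut t x)
        @[s --> within `[0, T] (nbhs t)] --> 0%E].

Definition fBBM_equation alpha u ut := exists ux dut : R -> R,
  [/\ is_weak_dx u ux, is_fracD alpha ut dut &
      eqI (fun x => ut x + ux x + u x * ux x + dut x) (fun=> 0)].

Definition fBBM_solution alpha r T (u0 : R -> R) (u : R -> R -> R) :=
  exists ut : R -> R -> R,
  [/\ C1_Hper r T u ut,
      forall t : R, t \in `]0, T] -> fBBM_equation alpha (u t) (ut t) &
      eqI (u 0) u0].

End PeriodicSobolev.

(* Main.v *)
(** On Fourier coefficients the equation is the ODE a' = F(a) in the sequence space
    H^r, where F(a)_k is the k-th coefficient of u + u^2/2 multiplied by
    -ik / (1 + |k|^alpha). As alpha >= 1 this multiplier is bounded, and as r >= 1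
    the space H^r is an algebra, so that F is the sum of a bounded linear and a
    bounded bilinear map: Taylor series give local solutions whose lifespan depends
    on the norm of the datum only. Since the integral of u^2 u_x vanishes, the
    energy sum_k (1 + |k|^alpha) |a_k|^2 is conserved; as alpha >= 1 it controls
    the H^(1/2) norm, and the Brezis-Gallouet inequality then bounds the Wiener
    norm sum_k |a_k| logarithmically in the H^r norm. With the tame product
    estimate, y = |a|_r^2 satisfies y' <= K (1 + y) (1 + ln (1 + y)), which
    excludes blow-up. A function is determined a.e. by its Fourier coefficients,
    hence every solution yields a curve satisfying the same ODE, and uniqueness
    follows from Gronwall's inequality. *)
Require Import Defs.
From HB Require Import structures.
From mathcomp Require Import all_boot all_order all_algebra.
From mathcomp Require Import all_classical all_reals all_analysis.
From mathcomp Require Import complex ring lra zify measurable_realfun.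

Set Implicit Arguments.
Unset Strict Implicit.
Unset Printing Implicit Defensive.

Import Order.TTheory GRing.Theory Num.Theory.
Import numFieldNormedType.Exports.

Local Open Scope classical_set_scope.
Local Open Scope ring_scope.

(** * Symmetric sums over the integers *)

(** The borderline is alpha = 1: the energy then controls only the H^(1/2) norm, which just fails to
    control the supremum, so the growth of the H^r norm cannot be closed linearly; the logarithmic
    loss is what a Gronwall argument still tolerates, at the price of a double exponential bound.
    When r = 1 the derivative u_x is only square integrable and u is not an admissible test
    function, so identities involving u_x are proved for trigonometric polynomials and passed to the
    limit, one factor converging uniformly and the other in L^2. Injectivity of the Fourier
    coefficients on integrable functions comes from polynomials in a shifted cosine that converge
    boundedly to indicators of arcs, followed by Lebesgue differentiation. Sums over the integers
    are limits over symmetric windows, which suit the hermitian symmetry of real functions; the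
    unordered sum in [Hnorm] is compared with them only at the end. *)

HB.lock Definition zwin (N : nat) : seq int := [seq i%:Z - N%:Z | i <- iota 0 N.*2.+1].

Lemma mem_zwin N k : (k \in zwin N) = (`|k| <= N)%N.
Proof.
rewrite zwin.unlock; apply/mapP/idP => [[j]|kN].
  rewrite mem_iota add0n => /andP[_ jN] ->; lia.
by exists (absz (k + N%:Z)); [rewrite mem_iota add0n; lia|lia].
Qed.

Lemma zwin_uniq N : uniq (zwin N).
Proof. by rewrite zwin.unlock map_inj_uniq ?iota_uniq// => i j /addIr []. Qed.

Section Windows.
Context {V : nmodType}.
Implicit Types f : int -> V.

Lemma zwin0 f : \sum_(k <- zwin 0) f k = f 0.
Proof. by rewrite zwin.unlock /= big_seq1. Qed.

Lemma zwinS f N : \sum_(k <- zwin N.+1) f k =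
  \sum_(k <- zwin N) f k + (f N.+1 + f (- N.+1%:Z)).
Proof.
rewrite (perm_big (N.+1%:Z :: - N.+1%:Z :: zwin N)).
  by rewrite 2!big_cons [RHS]addrC -addrA.
apply: uniq_perm; rewrite ?zwin_uniq//=.
  by rewrite !in_cons !mem_zwin zwin_uniq; lia.
by move=> k; rewrite !in_cons !mem_zwin; lia.
Qed.

Lemma zwin_opp f N : \sum_(k <- zwin N) f (- k) = \sum_(k <- zwin N) f k.
Proof.
rewrite -(big_map -%R xpredT f); apply/perm_big.
have ninj : injective (-%R : int -> int) by exact: oppr_inj.
apply: uniq_perm; rewrite ?zwin_uniq ?map_inj_uniq ?zwin_uniq//.
by move=> k; rewrite -[k in LHS]opprK (mem_map ninj) !mem_zwin; lia.
Qed.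

End Windows.

Section RealWindows.
Context {R : realType}.
Implicit Types (f g : int -> R) (M : R).

Lemma ler_sum_zwin f (s : seq int) N : (forall k, 0 <= f k) -> uniq s ->
  (forall k, k \in s -> (`|k| <= N)%N) ->
  \sum_(k <- s) f k <= \sum_(k <- zwin N) f k.
Proof.
move=> f0 us sN; rewrite [leRHS](bigID (mem s))/= -[leLHS]addr0; apply: lerD; last first.
  exact: sumr_ge0.
rewrite -[leRHS]big_filter le_eqVlt; apply/orP; left; apply/eqP/perm_big.
apply: uniq_perm; rewrite ?filter_uniq ?zwin_uniq// => k.
by rewrite mem_filter mem_zwin; case: (boolP (k \in s)) => // /sN ->.
Qed.

Lemma zwin_homo f : (forall k, 0 <= f k) ->
  {homo (fun N => \sum_(k <- zwin N) f k) : n m / (n <= m)%N >-> n <= m}.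
Proof.
move=> f0 n m nm; apply: ler_sum_zwin => //; first exact: zwin_uniq.
by move=> k; rewrite mem_zwin => /leq_trans; apply.
Qed.

(** Finite-window substitute for translation invariance; it lets Young's inequality be proved on
    truncated sums. *)
Lemma zwin_shift_le f N (j : int) : (forall k, 0 <= f k) ->
  \sum_(k <- zwin N) f (k - j) <= \sum_(k <- zwin (N + absz j)) f k.
Proof.
move=> f0; rewrite -(big_map (fun k => k - j) xpredT f).
apply: ler_sum_zwin => //.
  by rewrite map_inj_uniq ?zwin_uniq//; exact: addIr.
by move=> k /mapP[j0]; rewrite mem_zwin => iN ->; lia.
Qed.

(** A total function: [limn] assigns a value to every series, and the value is meaningful for the
    [zsummable] ones, whose absolute partial sums are bounded. *)
Definition zsum f : R := limn (fun N => \sum_(k <- zwin N) f k).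

Definition zsummable f := exists M, forall N, \sum_(k <- zwin N) `|f k| <= M.

Lemma zsummable_ge0 f M : (forall k, 0 <= f k) ->
  (forall N, \sum_(k <- zwin N) f k <= M) -> zsummable f.
Proof.
move=> f0 fM; exists M => N; rewrite (eq_bigr f)// => k _.
by rewrite ger0_norm.
Qed.

Lemma is_cvg_zsum_ge0 f : (forall k, 0 <= f k) -> zsummable f ->
  cvgn (fun N => \sum_(k <- zwin N) f k).
Proof.
move=> f0 [M fM]; apply: nondecreasing_is_cvgn; first exact: zwin_homo.
exists M => _ [N _ <-]; apply: le_trans (fM N).
by apply: ler_sum => k _; exact: ler_norm.
Qed.

Lemma zsummable_norm f : zsummable f -> zsummable (fun k => `|f k|).
Proof. by move=> [M fM]; apply: (@zsummable_ge0 _ M). Qed.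

Lemma zsummable_le f g : (forall k, `|f k| <= g k) -> zsummable g -> zsummable f.
Proof.
move=> fg [M gM]; exists M => N; apply: le_trans (gM N).
by apply: ler_sum => k _; apply: le_trans (fg k) (ler_norm _).
Qed.

Lemma zsummableD f g : zsummable f -> zsummable g -> zsummable (fun k => f k + g k).
Proof.
move=> [M fM] [M' gM]; exists (M + M') => N; apply: le_trans (lerD (fM N) (gM N)).
by rewrite -big_split/=; apply: ler_sum => k _; exact: ler_normD.
Qed.

Lemma zsummableZ c f : zsummable f -> zsummable (fun k => c * f k).
Proof.
move=> [M fM]; exists (`|c| * M) => N; apply: le_trans (ler_wpM2l _ (fM N)) => //.
by rewrite mulr_sumr; apply: ler_sum => k _; rewrite normrM.
Qed.

(** [f] is the difference of the nonnegative summable sequences [f + |f|] and [|f|], whose partial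
    sums are monotone and bounded. *)
Lemma is_cvg_zsum f : zsummable f -> cvgn (fun N => \sum_(k <- zwin N) f k).
Proof.
move=> fs; rewrite (_ : (fun _ => _) = (fun N => \sum_(k <- zwin N) (f k + `|f k|)) \-
    (fun N => \sum_(k <- zwin N) `|f k|)); last first.
  by apply/funext => N/=; rewrite -sumrB; apply: eq_bigr => k _; rewrite addrK.
apply: is_cvgB; apply: is_cvg_zsum_ge0 => //.
- by move=> k; have := ler_norm (- f k); rewrite normrN; lra.
- by apply: zsummableD => //; exact: zsummable_norm.
- exact: zsummable_norm.
Qed.

Lemma cvg_zsum f : zsummable f -> (fun N => \sum_(k <- zwin N) f k) @ \oo --> zsum f.
Proof. exact: is_cvg_zsum. Qed.

Lemma zsum_cvg f l : (fun N => \sum_(k <- zwin N) f k) @ \oo --> l -> zsum f = l.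
Proof. by move/cvg_lim; apply. Qed.

Lemma zsumD f g : zsummable f -> zsummable g ->
  zsum (fun k => f k + g k) = zsum f + zsum g.
Proof.
move=> fs gs; apply: zsum_cvg; under eq_fun do rewrite big_split.
by apply: cvgD; exact: cvg_zsum.
Qed.

Lemma zsumZ c f : zsummable f -> zsum (fun k => c * f k) = c * zsum f.
Proof.
move=> fs; apply: zsum_cvg; under eq_fun do rewrite -mulr_sumr.
by apply: cvgMr; exact: cvg_zsum.
Qed.

Lemma zsum_le f M : zsummable f -> (forall N, \sum_(k <- zwin N) f k <= M) -> zsum f <= M.
Proof.
by move=> fs fM; apply: limr_le; [exact: is_cvg_zsum|exact: nearW].
Qed.

Lemma zwin_le_zsum f N : (forall k, 0 <= f k) -> zsummable f ->
  \sum_(k <- zwin N) f k <= zsum f.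
Proof.
move=> f0 fs; apply: nondecreasing_cvgn_le; last exact: is_cvg_zsum.
exact: zwin_homo.
Qed.

Lemma zsum_ge0 f : (forall k, 0 <= f k) -> zsummable f -> 0 <= zsum f.
Proof.
by move=> f0 fs; apply: le_trans (zwin_le_zsum 0 f0 fs); rewrite zwin0.
Qed.

Lemma ler_zsum f g : zsummable f -> zsummable g -> (forall k, f k <= g k) ->
  zsum f <= zsum g.
Proof.
move=> fs gs fg; apply: ler_lim; [exact: is_cvg_zsum|exact: is_cvg_zsum|].
by apply: nearW => N; apply: ler_sum.
Qed.

Lemma zterm_le_zsum f k : (forall k, 0 <= f k) -> zsummable f -> f k <= zsum f.
Proof.
move=> f0 fs; apply: le_trans (zwin_le_zsum (absz k) f0 fs).
by rewrite -(big_seq1 +%R k f); apply: ler_sum_zwin => // i; rewrite inE => /eqP ->.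
Qed.

Lemma ler_norm_zsum f : zsummable f -> `|zsum f| <= zsum (fun k => `|f k|).
Proof.
move=> fs; rewrite ler_norml; apply/andP; split; last first.
  by apply: ler_zsum => // [|k]; [exact: zsummable_norm|exact: ler_norm].
rewrite -mulN1r -zsumZ; last exact: zsummable_norm.
apply: ler_zsum => // [|k].
  by apply: zsummableZ; exact: zsummable_norm.
by rewrite mulN1r lerNl -normrN ler_norm.
Qed.

(** Both remainders are limits of sums over larger windows minus the window [N], where domination is
    termwise. Uniform convergence of Fourier series comes from here. *)
Lemma zsum_tail f g N : zsummable g -> (forall k, `|f k| <= g k) ->
  `|zsum f - \sum_(k <- zwin N) f k| <= zsum g - \sum_(k <- zwin N) g k.
Proof.
move=> gs fg; have fs := zsummable_le fg gs.
have cf : (fun n => `|\sum_(k <- zwin n) f k - \sum_(k <- zwin N) f k|) @ \oo -->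
    `|zsum f - \sum_(k <- zwin N) f k|.
  by apply: cvg_norm; apply: cvgB; [exact: cvg_zsum|exact: cvg_cst].
have cg : (fun n => \sum_(k <- zwin n) g k - \sum_(k <- zwin N) g k) @ \oo -->
    zsum g - \sum_(k <- zwin N) g k.
  by apply: cvgB; [exact: cvg_zsum|exact: cvg_cst].
rewrite -(cvg_lim _ cf)// -(cvg_lim _ cg)//.
apply: ler_lim; [by apply/cvg_ex; eexists; exact: cf
  |by apply/cvg_ex; eexists; exact: cg|].
exists N => // n /= Nn; rewrite -(subnK Nn); elim: (n - N)%N => [|m IH].
  by rewrite add0n !subrr normr0.
rewrite addSn !zwinS addrAC [leRHS]addrAC; apply: le_trans (ler_normD _ _) _.
rewrite lerD//; apply: le_trans (ler_normD _ _) _; exact: lerD.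
Qed.

Lemma zsum_tail_cvg g : zsummable g ->
  (fun N => zsum g - \sum_(k <- zwin N) g k) @ \oo --> (0 : R).
Proof.
move=> gs; rewrite -[X in _ --> X](subrr (zsum g)).
by apply: cvgB; [exact: cvg_cst|exact: cvg_zsum].
Qed.

Lemma CauchySchwarz_sum (I : Type) (s : seq I) (p q : I -> R) :
  (forall i, 0 <= p i) ->
  (\sum_(i <- s) p i * q i) ^+ 2 <=
  (\sum_(i <- s) p i) * (\sum_(i <- s) p i * q i ^+ 2).
Proof.
move=> p0; elim: s => [|i s IH]; first by rewrite !big_nil expr2 mul0r.
rewrite !big_cons; set P := \sum_(_ <- _) p _ in IH *.
set S := \sum_(j <- s) _ in IH *; set T := \sum_(j <- s) _ in IH *.
have P0 : 0 <= P by apply: sumr_ge0.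
have T0 : 0 <= T by apply: sumr_ge0 => j _; rewrite mulr_ge0 ?sqr_ge0.
(* After multiplication by [P] this is (P q_i - S)^2 >= 0 combined with the induction hypothesis;
   when [P] is zero, that hypothesis forces S = 0. *)
have : 2 * q i * S <= P * q i ^+ 2 + T.
  have [/eqP Pz|Pn] := boolP (P == 0).
    have : S ^+ 2 <= 0 by rewrite (le_trans IH)// Pz mul0r.
    rewrite real_exprn_even_le0 ?num_real//= => /eqP ->; rewrite mulr0 Pz mul0r add0r.
    exact: T0.
  have Pp : 0 < P by rewrite lt_neqAle eq_sym Pn.
  rewrite -(ler_pM2l Pp).
  have : 0 <= (P * q i - S) ^+ 2 by exact: sqr_ge0.
  move: IH; nra.
by move=> /(ler_wpM2l (p0 i)); move: IH; nra.
Qed.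

End RealWindows.

(** * The sequence space H^r *)

(** The quadratic is tested at its vertex x = -D / B; if B = 0 and D is nonzero, the remaining
    affine function takes the value -1 at the chosen point. *)
Lemma discriminant_le (R : realType) (A D B : R) : 0 <= A -> 0 <= B ->
  (forall x, 0 <= A + 2 * x * D + x ^+ 2 * B) -> D ^+ 2 <= A * B.
Proof.
move=> a0 b0 Q; have [b00|bn] := eqVneq B 0.
  have [->|n] := eqVneq D 0; first by rewrite expr0n/= mulr_ge0.
  have := Q (- (A + 1) / (2 * D)).
  rewrite b00 mulr0 addr0 [2 * (_ / _)]mulrC -!mulrA mulVf; last by rewrite mulf_neq0.
  by lra.
have bp : 0 < B by rewrite lt_neqAle eq_sym bn.
have := Q (- D / B).
rewrite (_ : A + _ + _ = (A * B - D ^+ 2) / B); last by field.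
by rewrite pmulr_lge0 ?invr_gt0// subr_ge0.
Qed.

Section ComplexDot.
Context {R : realType}.
Implicit Types (z : R[i]) (p : int -> R) (a b c : int -> R[i]).

Definition nsq z : R := complex.Re z ^+ 2 + complex.Im z ^+ 2.
(** Real part of conj(z) z', the inner product of the plane. *)
Definition dotc z z' : R :=
  complex.Re z * complex.Re z' + complex.Im z * complex.Im z'.

Lemma nsq_normc z : ComplexField.Normc.normc z ^+ 2 = nsq z.
Proof.
by case: z => x y; rewrite /= sqr_sqrtr// addr_ge0// sqr_ge0.
Qed.

Lemma dotcc z : dotc z z = nsq z. Proof. by rewrite /dotc /nsq !expr2. Qed.
Lemma nsq_ge0 z : 0 <= nsq z. Proof. by rewrite addr_ge0// sqr_ge0. Qed.
Lemma dotcC z z' : dotc z z' = dotc z' z. Proof. rewrite /dotc; ring. Qed.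
Lemma dotcDr z z1 z2 : dotc z (z1 + z2) = dotc z z1 + dotc z z2.
Proof. by case: z1 z2 => [x1 y1] [x2 y2]; rewrite /dotc /=; ring. Qed.
Lemma dotcZr x z z' : dotc z (real_complex R x * z') = x * dotc z z'.
Proof. by case: z z' => [x1 y1] [x2 y2]; rewrite /dotc /=; ring. Qed.
Lemma nsqD z z' : nsq (z + z') <= 2 * nsq z + 2 * nsq z'.
Proof.
case: z z' => [x y] [x' y']; rewrite /nsq /=.
have := sqr_ge0 (x - x'); have := sqr_ge0 (y - y'); nra.
Qed.
Lemma nsqM z z' : nsq (z * z') = nsq z * nsq z'.
Proof. by case: z z' => [x y] [x' y']; rewrite /nsq /=; ring. Qed.
Lemma nsqZ x z : nsq (real_complex R x * z) = x ^+ 2 * nsq z.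
Proof. by case: z => [u v]; rewrite /nsq /=; ring. Qed.
Lemma norm_dotc z z' : `|dotc z z'| <= nsq z + nsq z'.
Proof.
case: z z' => [x y] [x' y']; rewrite /nsq /dotc /= ler_norml.
have := sqr_ge0 (x - x'); have := sqr_ge0 (y - y').
have := sqr_ge0 (x + x'); have := sqr_ge0 (y + y').
by move=> ? ? ? ?; apply/andP; split; nra.
Qed.

Definition qsummable p a : Prop := zsummable (fun k => p k * nsq (a k)).
(** Weighted l^2 inner product: [p := wt r] gives the inner product of H^r and [p := disp alpha] the
    conserved energy. *)
Definition qform p a b : R := zsum (fun k => p k * dotc (a k) (b k)).

Variable p : int -> R.
Hypothesis p0 : forall k, 0 <= p k.

Lemma qsummableD a b : qsummable p a -> qsummable p b ->
  qsummable p (fun k => a k + b k).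
Proof.
move=> sa sb; apply: (@zsummable_le _ _ (fun k => 2 * (p k * nsq (a k)) + 2 * (p k * nsq (b k)))).
  move=> k; rewrite ger0_norm ?mulr_ge0 ?nsq_ge0//.
  by have := ler_wpM2l (p0 k) (nsqD (a k) (b k)); lra.
by apply: zsummableD; exact: zsummableZ.
Qed.

Lemma qsummableZ x a : qsummable p a -> qsummable p (fun k => real_complex R x * a k).
Proof.
move=> sa; rewrite /qsummable; under eq_fun do rewrite nsqZ mulrCA.
exact: zsummableZ.
Qed.

Lemma qdot_summable a b : qsummable p a -> qsummable p b ->
  zsummable (fun k => p k * dotc (a k) (b k)).
Proof.
move=> sa sb; apply: zsummable_le (zsummableD sa sb) => k.
by rewrite normrM ger0_norm// -mulrDr ler_wpM2l// norm_dotc.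
Qed.

Lemma qformC a b : qform p a b = qform p b a.
Proof. by congr zsum; apply/funext => k; rewrite dotcC. Qed.

Lemma qformDr a b c : qsummable p a -> qsummable p b -> qsummable p c ->
  qform p a (fun k => b k + c k) = qform p a b + qform p a c.
Proof.
move=> sa sb sc; rewrite -zsumD; [|exact: qdot_summable|exact: qdot_summable].
by congr zsum; apply/funext => k; rewrite dotcDr mulrDr.
Qed.

Lemma qformZr x a b : qsummable p a -> qsummable p b ->
  qform p a (fun k => real_complex R x * b k) = x * qform p a b.
Proof.
move=> sa sb; rewrite -zsumZ; last exact: qdot_summable.
by congr zsum; apply/funext => k; rewrite dotcZr mulrCA.
Qed.

Lemma qform_ge0 a : qsummable p a -> 0 <= qform p a a.
Proof.
move=> sa; apply: zsum_ge0; last exact: qdot_summable.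
by move=> k; rewrite dotcc mulr_ge0// nsq_ge0.
Qed.

Lemma qform_line a b x : qsummable p a -> qsummable p b ->
  qform p (fun k => a k + real_complex R x * b k)
    (fun k => a k + real_complex R x * b k) = qform p a a + 2 * x * qform p a b + x ^+ 2 * qform p b b.
Proof.
move=> sa sb; have sxb := qsummableZ x sb.
set c := (fun k => _ + _); have sc := qsummableD sa sxb.
have qc d : qsummable p d -> qform p d c = qform p d a + x * qform p d b.
  by move=> sd; rewrite /c qformDr// qformZr.
by rewrite (qc c sc) (qformC c a) (qformC c b) !qc// (qformC b a); ring.
Qed.

Lemma qform_CauchySchwarz a b : qsummable p a -> qsummable p b ->
  qform p a b ^+ 2 <= qform p a a * qform p b b.
Proof.
move=> sa sb.
have Q x : 0 <= qform p a a + 2 * x * qform p a b + x ^+ 2 * qform p b b.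
  rewrite -qform_line//; apply: qform_ge0; apply: qsummableD => //.
  exact: qsummableZ.
by apply: discriminant_le => //; exact: qform_ge0.
Qed.

Lemma qform_triangle a b : qsummable p a -> qsummable p b ->
  Num.sqrt (qform p (fun k => a k + b k) (fun k => a k + b k)) <=
    Num.sqrt (qform p a a) + Num.sqrt (qform p b b).
Proof.
move=> sa sb; have -> : (fun k => a k + b k) = fun k => a k + real_complex R 1 * b k.
  by apply/funext => k; rewrite rmorph1 mul1r.
rewrite qform_line//.
have := qform_CauchySchwarz sa sb; have := qform_ge0 sb; have := qform_ge0 sa.
set A := qform p a a; set B := qform p b b; set D := qform p a b => A0 B0 DAB.
rewrite -[leRHS]ger0_norm ?addr_ge0 ?sqrtr_ge0// -sqrtr_sqr ler_wsqrtr//.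
rewrite sqrrD !sqr_sqrtr// mulr1 expr1n mul1r.
suff : D <= Num.sqrt A * Num.sqrt B by lra.
rewrite -sqrtrM// (le_trans (ler_norm _))// -sqrtr_sqr ler_wsqrtr//.
Qed.

End ComplexDot.

Section Hseq.
Context {R : realType}.
Implicit Types (r : R) (k : int).

Definition wt r k : R := (1 + `|k%:~R : R| ^+ 2) `^ r.

Lemma wt_gt0 r k : 0 < wt r k.
Proof. by rewrite powR_gt0// ltr_wpDr// sqr_ge0. Qed.
Lemma wt_ge0 r k : 0 <= wt r k. Proof. exact/ltW/wt_gt0. Qed.

(** The symmetry expresses that the function with these coefficients is real, so that they form a
    real vector space. *)
Definition hcoef r (a : int -> R[i]) :=
  (forall k, a (- k) = conjc (a k)) /\ qsummable (wt r) a.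

End Hseq.

(* Fourier coefficients of the real-valued functions in H^r_per. *)
Record hseq (R : realType) (r : R) :=
  Hseq { coef :> int -> R[i]; hseqP : hcoef r coef }.

Section HseqSpace.
Variables (R : realType) (r : R).
Local Notation E := (hseq r).
Implicit Types a b c : E.

HB.instance Definition _ := gen_eqMixin E.
HB.instance Definition _ := gen_choiceMixin E.

Lemma hseq_ext a b : a =1 b -> a = b.
Proof.
case: a b => [a aP] [b bP] /= /funext ab; subst b; congr Hseq.
exact: Prop_irrelevance.
Qed.

Lemma hseq_sum a : qsummable (wt r) a. Proof. by have [] := hseqP a. Qed.
Lemma coefN a k : a (- k) = conjc (a k). Proof. by have [] := hseqP a. Qed.

Lemma hcoef0 : hcoef r (fun=> 0).
Proof.
split; first by move=> k; rewrite rmorph0.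
apply: (@zsummable_ge0 _ _ 0) => [k|N].
  by rewrite mulr_ge0 ?wt_ge0 ?nsq_ge0.
by rewrite big1// => k _; rewrite /nsq /= expr0n /= addr0 mulr0.
Qed.
Lemma hcoefD a b : hcoef r (fun k => a k + b k).
Proof.
split; first by move=> k; rewrite !coefN rmorphD.
by apply: qsummableD; [move=> k; exact: wt_ge0|exact: hseq_sum|exact: hseq_sum].
Qed.
Lemma hcoefZ x a : hcoef r (fun k => real_complex R x * a k).
Proof.
split; first by move=> k; rewrite !coefN rmorphM /= oppr0.
by apply: qsummableZ; exact: hseq_sum.
Qed.
Lemma hcoefN a : hcoef r (fun k => - a k).
Proof.
have [h s] := hcoefZ (-1) a; split; first by move=> k; rewrite !coefN rmorphN.
by move: s; congr qsummable; apply/funext => k; rewrite rmorphN1 mulN1r.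
Qed.

Definition hadd a b : E := Hseq (hcoefD a b).
Definition hopp a : E := Hseq (hcoefN a).
Definition hzero : E := Hseq hcoef0.
Definition hscale x a : E := Hseq (hcoefZ x a).

Lemma haddA : associative hadd.
Proof. by move=> a b c; apply: hseq_ext => k /=; rewrite addrA. Qed.
Lemma haddC : commutative hadd.
Proof. by move=> a b; apply: hseq_ext => k /=; rewrite addrC. Qed.
Lemma hadd0 : left_id hzero hadd.
Proof. by move=> a; apply: hseq_ext => k /=; rewrite add0r. Qed.
Lemma haddN : left_inverse hzero hopp hadd.
Proof. by move=> a; apply: hseq_ext => k /=; rewrite addNr. Qed.
HB.instance Definition _ := GRing.isZmodule.Build E haddA haddC hadd0 haddN.

Lemma hscaleA x y a : hscale x (hscale y a) = hscale (x * y) a.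
Proof. by apply: hseq_ext => k /=; rewrite rmorphM mulrA. Qed.
Lemma hscale1 : left_id 1 hscale.
Proof. by move=> a; apply: hseq_ext => k /=; rewrite rmorph1 mul1r. Qed.
Lemma hscaleDr : right_distributive hscale +%R.
Proof. by move=> x a b; apply: hseq_ext => k /=; rewrite mulrDr. Qed.
Lemma hscaleDl a : {morph hscale^~ a : x y / x + y}.
Proof. by move=> x y; apply: hseq_ext => k /=; rewrite rmorphD mulrDl. Qed.
HB.instance Definition _ :=
  GRing.Zmodule_isLmodule.Build R E hscaleA hscale1 hscaleDr hscaleDl.

Lemma coefDE a b k : (a + b) k = a k + b k. Proof. by []. Qed.
Lemma coefBE a b k : (a - b) k = a k - b k. Proof. by []. Qed.
Lemma coefZE x a k : (x *: a) k = real_complex R x * a k. Proof. by []. Qed.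
Definition hnorm a : R := Num.sqrt (qform (wt r) a a).

Lemma hnormD a b : hnorm (a + b) <= hnorm a + hnorm b.
Proof. by apply: qform_triangle; [move=> k; exact: wt_ge0|exact: hseq_sum|exact: hseq_sum]. Qed.

Lemma hnormZ x a : hnorm (x *: a) = `|x| * hnorm a.
Proof.
rewrite /hnorm.
have -> : qform (wt r) (x *: a) (x *: a) = x ^+ 2 * qform (wt r) a a.
  have sa := hseq_sum a; have sxa := hseq_sum (x *: a).
  have w0 := @wt_ge0 R r.
  by rewrite (qformZr w0)// qformC (qformZr w0)// mulrA -expr2.
by rewrite sqrtrM ?sqr_ge0// sqrtr_sqr.
Qed.

Lemma hcoef_nsq_le a k : wt r k * nsq (a k) <= qform (wt r) a a.
Proof.
rewrite -dotcc; apply: (@zterm_le_zsum _ (fun k => wt r k * dotc (a k) (a k))).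
  by move=> j; rewrite dotcc mulr_ge0 ?wt_ge0 ?nsq_ge0.
by apply: qdot_summable; [move=> j; exact: wt_ge0|exact: hseq_sum|exact: hseq_sum].
Qed.

Lemma nsq_eq0 (z : R[i]) : nsq z <= 0 -> z = 0.
Proof.
case: z => x y; rewrite /nsq/= => h.
have x0 : x ^+ 2 <= 0 by apply: le_trans h; rewrite lerDl sqr_ge0.
have y0 : y ^+ 2 <= 0 by apply: le_trans h; rewrite lerDr sqr_ge0.
move: x0 y0; rewrite !real_exprn_even_le0 ?num_real//= => /eqP -> /eqP ->.
by [].
Qed.

Lemma hnorm_eq0 a : hnorm a = 0 -> a = 0.
Proof.
move=> /eqP; rewrite sqrtr_eq0 => a0; apply: hseq_ext => k.
have := le_trans (hcoef_nsq_le a k) a0.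
by rewrite pmulr_rle0 ?wt_gt0// => /nsq_eq0 ->.
Qed.

HB.instance Definition _ := Lmodule_isNormed.Build R E hnormD hnormZ hnorm_eq0.

Lemma hnormE a : `|a| = Num.sqrt (qform (wt r) a a). Proof. by []. Qed.

Lemma sqr_hnorm a : `|a| ^+ 2 = qform (wt r) a a.
Proof.
rewrite hnormE sqr_sqrtr//; apply: qform_ge0; [exact: wt_ge0|exact: hseq_sum].
Qed.

End HseqSpace.

Lemma cvg_nsqB {R : realType} (T : Type) (F : set_system T) (f : T -> R[i]) (z z' : R[i]) :
  Filter F -> (fun t => complex.Re (f t)) @ F --> complex.Re z ->
  (fun t => complex.Im (f t)) @ F --> complex.Im z ->
  (fun t => nsq (f t - z')) @ F --> nsq (z - z').
Proof.
move=> FF cr ci; have nsqB w : nsq (w - z') =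
    (complex.Re w - complex.Re z') * (complex.Re w - complex.Re z') +
    (complex.Im w - complex.Im z') * (complex.Im w - complex.Im z').
  by rewrite /nsq !raddfB !expr2.
rewrite nsqB; under eq_fun do rewrite nsqB.
by apply: cvgD; apply: cvgM; apply: cvgB => //; exact: cvg_cst.
Qed.

Section HseqComplete.
Variables (R : realType) (r : R).
Local Notation E := (hseq r).
Implicit Types a b : E.

Lemma ler_hcoef a k : Num.sqrt (wt r k) * Num.sqrt (nsq (a k)) <= `|a|.
Proof.
by rewrite -sqrtrM ?wt_ge0// hnormE ler_wsqrtr// hcoef_nsq_le.
Qed.

Lemma ler_Re_coef a k : Num.sqrt (wt r k) * `|complex.Re (a k)| <= `|a|.
Proof.
apply: le_trans (ler_hcoef a k); rewrite ler_wpM2l ?sqrtr_ge0//.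
by rewrite -sqrtr_sqr ler_wsqrtr// lerDl sqr_ge0.
Qed.

Lemma ler_Im_coef a k : Num.sqrt (wt r k) * `|complex.Im (a k)| <= `|a|.
Proof.
apply: le_trans (ler_hcoef a k); rewrite ler_wpM2l ?sqrtr_ge0//.
by rewrite -sqrtr_sqr ler_wsqrtr// lerDr sqr_ge0.
Qed.

Lemma hseq_sum_le a N : \sum_(k <- zwin N) wt r k * nsq (a k) <= `|a| ^+ 2.
Proof.
rewrite sqr_hnorm /qform; under [in leRHS]eq_fun do rewrite dotcc.
apply: zwin_le_zsum; last exact: hseq_sum.
by move=> k; rewrite mulr_ge0 ?wt_ge0 ?nsq_ge0.
Qed.

Lemma hseq_norm_le a M : 0 <= M ->
  (forall N, \sum_(k <- zwin N) wt r k * nsq (a k) <= M ^+ 2) -> `|a| <= M.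
Proof.
move=> M0 aM; rewrite -(ler_pXn2r (ltn0Sn 1)) ?nnegrE// sqr_hnorm.
rewrite /qform; under [in leLHS]eq_fun do rewrite dotcc.
by apply: zsum_le => //; exact: hseq_sum.
Qed.

(** Meant for the real and imaginary parts of a single coefficient, which are Lipschitz functions
    for the norm. *)
Lemma coord_cauchy (F : set_system E) (g : E -> R) (c : R) :
  ProperFilter F -> cauchy F -> 0 < c ->
  (forall a b, c * `|g a - g b| <= `|a - b|) -> cvg (g @ F).
Proof.
move=> FF Fc c0 gab; apply/cauchy_cvgP/cauchy_exP => e e0.
have /cauchyP/(_ (e * c)) := Fc; case; first by rewrite mulr_gt0.
move=> a Fa; exists (g a); rewrite /fmap /=; move: Fa; apply: filterS => b ab.
rewrite -ball_normE /ball_ /= in ab; rewrite -ball_normE /ball_ /=.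
by rewrite -(ltr_pM2l c0) (le_lt_trans (gab _ _))// mulrC.
Qed.

Lemma hseq_complete (F : set_system E) : ProperFilter F -> cauchy F -> cvg F.
Proof.
move=> FF Fc.
have w0 k : 0 < Num.sqrt (wt r k) by rewrite sqrtr_gt0 wt_gt0.
pose lr k := lim ((fun a : E => complex.Re (a k)) @ F).
pose li k := lim ((fun a : E => complex.Im (a k)) @ F).
have cr k : (fun a : E => complex.Re (a k)) @ F --> lr k.
  apply: (coord_cauchy _ Fc (w0 k)) => a b; apply: le_trans (ler_Re_coef _ k).
  by rewrite coefBE raddfB.
have ci k : (fun a : E => complex.Im (a k)) @ F --> li k.
  apply: (coord_cauchy _ Fc (w0 k)) => a b; apply: le_trans (ler_Im_coef _ k).
  by rewrite coefBE raddfB.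
pose l k := Complex (lr k) (li k).
have lN k : l (- k) = conjc (l k).
  rewrite /l /=; congr Complex.
    rewrite /lr; congr (lim (_ @ F)); apply/funext => a.
    by rewrite coefN; case: (a k).
  rewrite -(cvg_lim _ (cvgN (ci k)))//; congr (lim (_ @ F)); apply/funext => a.
  by rewrite coefN opprfctE; case: (a k).
(* The bound concerns finite windows, so it survives the coordinatewise limit, and it is uniform in
   [N], so it becomes a norm bound. Two elements of a ball of radius e / 2 are within e of each
   other. *)
have key e : 0 < e -> F (fun a => forall N,
    \sum_(k <- zwin N) wt r k * nsq (l k - a k) <= e ^+ 2).
  move=> e0; have /cauchyP/(_ (e / 2)) := Fc; case; first by rewrite divr_gt0.
  move=> b Fb; move: (Fb); apply: filterS => a ba N.
  have cv : (fun c : E => \sum_(k <- zwin N) wt r k * nsq (c k - a k)) @ F -->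
      \sum_(k <- zwin N) wt r k * nsq (l k - a k).
    apply: cvg_big => [|k _]; [exact: add_continuous|apply: cvgMr].
    by apply: cvg_nsqB; [exact: cr|exact: ci].
  rewrite -(cvg_lim _ cv)//; apply: limr_le; first by apply/cvg_ex; eexists; exact: cv.
  near=> c; have := hseq_sum_le (c - a) N; move=> /le_trans; apply.
  have cb : ball b (e / 2) c by near: c.
  rewrite ler_pXn2r ?nnegrE// ?(ltW e0)//.
  have -> : c - a = (b - a) - (b - c) by rewrite opprB [RHS]addrC addrA subrK.
  apply: le_trans (ler_normB _ _) _.
  move: ba cb; rewrite -ball_normE /ball_ /= => h1 h2.
  by rewrite [leRHS]splitr lerD// ltW.
have [|a aN] := @filter_ex _ _ FF _ (key 1 _); first by [].
(* The limit inherits membership in H^r from one nearby [a], since l = (l - a) + a. *)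
have sl : qsummable (wt r) l.
  have -> : l = fun k => (l k - a k) + a k by apply/funext => k; rewrite subrK.
  apply: qsummableD; [exact: wt_ge0| |exact: hseq_sum].
  apply: zsummable_ge0 aN => k.
  by rewrite mulr_ge0 ?wt_ge0 ?nsq_ge0.
pose L : E := Hseq (conj lN sl).
apply/cvg_ex; exists L; apply/cvgrPdist_le => e e0.
move: (key e e0); apply: filterS => b bN.
by apply: hseq_norm_le; first exact: ltW.
Unshelve. all: by end_near. Qed.

HB.instance Definition _ := Uniform_isComplete.Build E hseq_complete.

End HseqComplete.

(** * Quadratic differential equations in Banach spaces *)

(** First order Taylor remainder R_n of s^n, multiplied by h^2 so that the natural bound n^2 h^(n-2)
    (s - t)^2 needs no negative power of h. The induction rests on R_(n+1) = s R_n + n (s - t)^2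
    t^(n-1) and n^2 + n <= (n + 1)^2. *)
Lemma taylor1_exp_bound (R : realType) (h s t : R) (n : nat) :
  `|s| <= h -> `|t| <= h ->
  `|s ^+ n - t ^+ n - n%:R * (s - t) * t ^+ n.-1| * h ^+ 2
    <= n%:R ^+ 2 * h ^+ n * (s - t) ^+ 2.
Proof.
move=> sh th; have h0 : 0 <= h := le_trans (normr_ge0 _) sh.
elim: n => [|n IH].
  rewrite !expr0 subrr mulr1 mul0r subrr normr0 mul0r; nra.
case: n IH => [_|n IH].
  by rewrite !expr1 expr0 mulr1 mul1r subrr normr0 mul0r expr1n mul1r mulr_ge0 ?sqr_ge0.
have -> : s ^+ n.+2 - t ^+ n.+2 - n.+2%:R * (s - t) * t ^+ n.+2.-1 =
  s * (s ^+ n.+1 - t ^+ n.+1 - n.+1%:R * (s - t) * t ^+ n.+1.-1)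
  + n.+1%:R * (s - t) ^+ 2 * t ^+ n.
  by rewrite /= !exprS -[n.+2]addn1 -[n.+1]addn1 !natrD; ring.
set D := (s ^+ n.+1 - _ - _) in IH *.
have e3 : `|s * D + n.+1%:R * (s - t) ^+ 2 * t ^+ n| <=
    `|s| * `|D| + n.+1%:R * (s - t) ^+ 2 * `|t| ^+ n.
  apply: le_trans (ler_normD _ _) _; rewrite normrM lerD2l normrM normrX.
  by rewrite (ger0_norm (mulr_ge0 (ler0n R n.+1) (sqr_ge0 (s - t)))).
apply: le_trans (ler_wpM2r (sqr_ge0 _) e3) _.
have tn : `|t| ^+ n <= h ^+ n by rewrite lerXn2r ?nnegrE.
have hn : 0 <= h ^+ n by rewrite exprn_ge0.
have d0 := sqr_ge0 (s - t); have D0 := normr_ge0 D.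
have m0 : 0 <= n.+1%:R :> R by exact: ler0n.
rewrite mulrDl.
have e1 : `|s| * `|D| * h ^+ 2 <= h * (n.+1%:R ^+ 2 * h ^+ n.+1 * (s - t) ^+ 2).
  by rewrite -mulrA ler_pM ?mulr_ge0 ?normr_ge0 ?sqr_ge0.
have e2 : n.+1%:R * (s - t) ^+ 2 * `|t| ^+ n * h ^+ 2 <=
    n.+1%:R * (s - t) ^+ 2 * h ^+ n * h ^+ 2.
  by rewrite ler_wpM2r ?sqr_ge0// ler_wpM2l// mulr_ge0.
apply: le_trans (lerD e1 e2) _; rewrite -[n.+2]addn1 natrD.
have -> : (n.+1%:R + 1) ^+ 2 * h ^+ (n.+1 + 1) * (s - t) ^+ 2 =
  h * (n.+1%:R ^+ 2 * h ^+ n.+1 * (s - t) ^+ 2) +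
  n.+1%:R * (s - t) ^+ 2 * h ^+ n * h ^+ 2 +
  (n.+1%:R + 1) * h ^+ n * h ^+ 2 * (s - t) ^+ 2.
  by rewrite addn1 !exprS; ring.
have h2 := sqr_ge0 h; have p1 : 0 <= n.+1%:R + 1 :> R by lra.
by rewrite lerDl mulr_ge0// mulr_ge0// mulr_ge0.
Qed.

Lemma sum_half_le2 (R : realType) N : \sum_(n < N) (2^-1 : R) ^+ n <= 2.
Proof.
suff -> : \sum_(n < N) (2^-1 : R) ^+ n = 2 - 2 * 2^-1 ^+ N.
  by rewrite gerBl mulr_ge0// exprn_ge0// invr_ge0.
elim: N => [|N IH]; first by rewrite big_ord0 expr0; lra.
by rewrite big_ord_recr /= IH exprS; field.
Qed.

Lemma norm_cvg_le (R : realType) (V : normedModType R) (u : nat -> V) (v : V) (M : R) :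
  u @ \oo --> v -> (forall n, `|u n| <= M) -> `|v| <= M.
Proof.
move=> /cvgrPdist_le uv uM; apply/ler_addgt0Pr => e e0.
have [N _ /(_ N (leqnn N)) vN] := uv e e0.
rewrite -[v](subrK (u N)) addrC; apply: le_trans (ler_normD _ _) _.
exact: lerD.
Qed.

Section QuadraticODE.
Variables (R : realType) (E : completeNormedModType R).
Variables (L : E -> E) (B : E -> E -> E) (l c : R).
Hypotheses (LD : forall x y, L (x + y) = L x + L y)
  (LZ : forall a x, L (a *: x) = a *: L x)
  (BDl : forall x y z, B (x + y) z = B x z + B y z)
  (BDr : forall x y z, B x (y + z) = B x y + B x z)
  (BZl : forall a x y, B (a *: x) y = a *: B x y)
  (BZr : forall a x y, B x (a *: y) = a *: B x y)
  (l0 : 0 < l) (c0 : 0 <= c)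
  (Ll : forall x, `|L x| <= l * `|x|)
  (Bc : forall x y, `|B x y| <= c * `|x| * `|y|).

Definition quadF x := L x + B x x.

(* The quadratic remainder makes C^1 regularity up to the endpoints explicit
   and is stable under gluing. *)
Definition solves (a b : R) (U : R -> E) := exists K, forall s t,
  a <= s <= b -> a <= t <= b ->
  `|U s - U t - (s - t) *: quadF (U t)| <= K * (s - t) ^+ 2.

Let LB x y : L (x - y) = L x - L y.
Proof. by rewrite LD -scaleN1r LZ scaleN1r. Qed.
Let BBl x y z : B (x - y) z = B x z - B y z.
Proof. by rewrite BDl -scaleN1r BZl scaleN1r. Qed.
Let BBr x y z : B x (y - z) = B x y - B x z.
Proof. by rewrite BDr -scaleN1r BZr scaleN1r. Qed.

(** B x x - B y y = B (x - y) x + B y (x - y). *)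
Lemma quadF_lip m x y : `|x| <= m -> `|y| <= m ->
  `|quadF x - quadF y| <= (l + 2 * c * m) * `|x - y|.
Proof.
move=> xm ym.
have -> : quadF x - quadF y = L (x - y) + (B (x - y) x + B y (x - y)).
  by rewrite /quadF LB BBl BBr opprD addrACA; congr (_ + _); rewrite addrA subrK.
apply: le_trans (ler_normD _ _) _; rewrite mulrDl lerD//.
apply: le_trans (ler_normD _ _) _.
have -> : 2 * c * m * `|x - y| = c * `|x - y| * m + c * m * `|x - y| by ring.
rewrite lerD//; apply: le_trans (Bc _ _) _.
  by rewrite ler_wpM2l// mulr_ge0.
by rewrite ler_wpM2r// ler_wpM2l.
Qed.

Lemma quadF_bound m x : `|x| <= m -> `|quadF x| <= l * m + c * m ^+ 2.
Proof.
move=> xm; have m0 := le_trans (normr_ge0 _) xm.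
apply: le_trans (ler_normD _ _) _; apply: lerD.
  by apply: le_trans (Ll _) _; rewrite ler_wpM2l// ltW.
apply: le_trans (Bc _ _) _; rewrite -mulrA ler_wpM2l// expr2.
exact: ler_pM.
Qed.

Section LocalSolution.
Variables (x0 : E) (M : R).
Hypothesis x0M : `|x0| <= M.

(** [rho] is the growth rate of the Taylor coefficients. The margin 8 makes the n-th term at most M
    8^-n on |t| <= h, which pays for the losses N <= 2^N in [product_defect] and n^2 <= 4^n in
    [local_solution] with a geometric factor to spare. On the datum, the radius depends through [M]
    only. *)
Let rho := l + c * M.
Let h := (8 * rho)^-1.
Let M0 : 0 <= M. Proof. exact: le_trans (normr_ge0 _) x0M. Qed.
Let rho0 : 0 < rho. Proof. by rewrite /rho ltr_wpDr// mulr_ge0. Qed.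
Let h0 : 0 < h. Proof. by rewrite /h invr_gt0 mulr_gt0. Qed.

(** Course-of-values recursion: all coefficients of index at most n are kept, because the Cauchy
    product in (n+1) x_(n+1) = L x_n + sum_j B x_j x_(n-j) involves each of them. *)
Fixpoint taylor_seq n : seq E :=
  if n is n'.+1 then let s := taylor_seq n' in
    rcons s (n'.+1%:R^-1 *: (L s`_n' + \sum_(j < n'.+1) B s`_j s`_(n' - j)))
  else [:: x0].
Definition taylor n : E := (taylor_seq n)`_n.

Let size_taylor n : size (taylor_seq n) = n.+1.
Proof. by elim: n => //= n IH; rewrite size_rcons IH. Qed.

Let nth_taylor n j : (j <= n)%N -> (taylor_seq n)`_j = taylor j.
Proof.
elim: n => [|n IH]; first by rewrite leqn0 => /eqP ->.
rewrite leq_eqVlt => /orP[/eqP -> //|jn].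
by rewrite /= nth_rcons size_taylor jn IH.
Qed.

Let taylorS n : n.+1%:R *: taylor n.+1 =
  L (taylor n) + \sum_(j < n.+1) B (taylor j) (taylor (n - j)).
Proof.
rewrite {1}/taylor /= nth_rcons size_taylor ltnn eqxx scalerA mulfV ?pnatr_eq0//.
rewrite scale1r; congr (_ + _); apply: eq_bigr => j _.
by rewrite !nth_taylor ?leq_subr// -ltnS.
Qed.

(** The n+1 bilinear terms are each at most c M^2 rho^n, so the factor n+1 on the left absorbs their
    number exactly; the choice rho = l + c M closes the induction. *)
Let taylor_bound n : `|taylor n| <= M * rho ^+ n.
Proof.
elim/ltn_ind: n => -[_|n IH]; first by rewrite expr0 mulr1.
have nn : 0 < n.+1%:R :> R by rewrite ltr0n.
rewrite -(ler_pM2l nn) -[X in X * `|_|]gtr0_norm// -normrZ taylorS.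
have -> : n.+1%:R * (M * rho ^+ n.+1) = n.+1%:R * (l * (M * rho ^+ n)) +
  n.+1%:R * (c * M ^+ 2 * rho ^+ n) by rewrite /rho exprS; ring.
apply: le_trans (ler_normD _ _) _; apply: lerD.
  apply: le_trans (Ll _) _; apply: (@le_trans _ _ (l * (M * rho ^+ n))).
    by rewrite ler_wpM2l ?IH// ltW.
  by rewrite ler_peMl ?mulr_ge0 ?exprn_ge0 ?(ltW rho0) ?(ltW l0)// ler1n.
apply: le_trans (ler_norm_sum _ _ _) _.
rewrite mulr_natl -[X in _ *+ X]card_ord -sumr_const; apply: ler_sum => j _.
apply: le_trans (Bc _ _) _; have jn : (j <= n)%N by rewrite -ltnS.
have -> : c * M ^+ 2 * rho ^+ n = c * (M * rho ^+ j) * (M * rho ^+ (n - j)).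
  by rewrite -[in LHS](subnKC jn) exprD expr2; ring.
apply: ler_pM; rewrite ?mulr_ge0// ?IH// ?ltnS ?leq_subr//.
by rewrite ler_wpM2l// IH.
Qed.

Let term_bound t n : `|t| <= h -> `|t ^+ n *: taylor n| <= M * 8^-1 ^+ n.
Proof.
move=> th; rewrite normrZ normrX.
apply: (@le_trans _ _ (h ^+ n * (M * rho ^+ n))).
  by apply: ler_pM => //; rewrite ?exprn_ge0// lerXn2r ?nnegrE// ltW.
rewrite mulrCA -exprMn (_ : h * rho = 8^-1)//.
by rewrite /h invfM -mulrA mulVf ?mulr1// gt_eqF.
Qed.

Let P N t : E := \sum_(n < N) t ^+ n *: taylor n.

Let P_tail N j t : `|t| <= h -> (j <= N)%N ->
  `|P N t - P (N - j) t| <= 2 * M * 8^-1 ^+ (N - j).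
Proof.
move=> th /subnKC <-; rewrite addKn; move: (N - j)%N => m; rewrite addnC.
suff H : `|P (m + j) t - P m t| <= M * 8^-1 ^+ m * \sum_(n < j) 2^-1 ^+ n.
  apply: le_trans H _; rewrite [2 * M]mulrC [leRHS]mulrAC ler_wpM2l ?sum_half_le2//.
  by rewrite mulr_ge0// exprn_ge0// invr_ge0.
elim: j => [|j IH]; first by rewrite addn0 subrr normr0 big_ord0 mulr0.
rewrite addnS /P big_ord_recr/= addrAC -/(P _ _) -/(P _ _).
apply: le_trans (ler_normD _ _) _; rewrite [in leRHS]big_ord_recr/= mulrDr lerD//.
apply: le_trans (term_bound _ th) _; rewrite exprD mulrA ler_wpM2l//.
  by rewrite mulr_ge0// exprn_ge0// invr_ge0.
by rewrite lerXn2r ?nnegrE ?invr_ge0// lef_pV2 ?posrE// ler_nat.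
Qed.

Let P_cvg t : `|t| <= h -> cvgn (P^~ t).
Proof.
move=> th; have -> : P^~ t = series (fun n => t ^+ n *: taylor n).
  by apply/funext => N; rewrite /series /= big_mkord.
apply: normed_cvg; apply: (@series_le_cvg _ _ (fun n => M * 8^-1 ^+ n)).
- by move=> n; exact: normr_ge0.
- by move=> n; rewrite mulr_ge0// exprn_ge0// invr_ge0.
- by move=> n; exact: term_bound.
- apply: is_cvg_geometric_series; rewrite ger0_norm ?invr_ge0//.
  by rewrite invf_lt1// ltr1n.
Qed.

Let U t := limn (P^~ t).

Let Ucvg t : `|t| <= h -> P^~ t @ \oo --> U t.
Proof. exact: P_cvg. Qed.

Let P_bound N t : `|t| <= h -> `|P N t| <= 2 * M.
Proof.
move=> th; have := P_tail th (leqnn N).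
by rewrite subnn /P big_ord0 subr0 expr0 mulr1.
Qed.

Let sumBl N (x : nat -> E) y : B (\sum_(n < N) x n) y = \sum_(n < N) B (x n) y.
Proof.
elim: N => [|N IH]; last by rewrite !big_ord_recr/= BDl IH.
by rewrite !big_ord0 -[X in B X _](scale0r 0) BZl scale0r.
Qed.

(** The same triangle of index pairs with sum below N, summed by diagonals on the left and by rows
    on the right. *)
Let cauchy_product N t :
  \sum_(n < N) \sum_(j < n.+1) B (t ^+ j *: taylor j) (t ^+ (n - j) *: taylor (n - j))
  = \sum_(j < N) B (t ^+ j *: taylor j) (P (N - j) t).
Proof.
have B0 x : B x 0 = 0 by move: (BZr 0 x 0); rewrite !scale0r.
elim: N => [|N IH]; first by rewrite !big_ord0.
rewrite big_ord_recr/= IH.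
have -> : \sum_(j < N.+1) B (t ^+ j *: taylor j) (P (N.+1 - j) t) =
  \sum_(j < N.+1) (B (t ^+ j *: taylor j) (P (N - j) t) +
    B (t ^+ j *: taylor j) (t ^+ (N - j) *: taylor (N - j))).
  apply: eq_bigr => j _; rewrite -BDr; congr (B _ _).
  have jN : (j <= N)%N by rewrite -ltnS.
  by rewrite (subSn jN) /P big_ord_recr.
rewrite big_split/=; congr (_ + _).
by rewrite big_ord_recr/= subnn /P big_ord0 B0 addr0.
Qed.

(** The derivative of the partial sum of length N+1 is the vector field at the partial sum of length
    N, except for the index pairs with sum at least N that the triangle leaves out. *)
Let dP N t : \sum_(n < N.+1) (n%:R * t ^+ n.-1) *: taylor n =
  L (P N t) + \sum_(j < N) B (t ^+ j *: taylor j) (P (N - j) t).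
Proof.
rewrite big_ord_recl/= mul0r scale0r add0r -cauchy_product.
have -> : L (P N t) = \sum_(n < N) L (t ^+ n *: taylor n).
  rewrite /P; elim: (N) => [|n IH]; last by rewrite !big_ord_recr/= LD IH.
  by rewrite !big_ord0 -[X in L X](scale0r 0) LZ scale0r.
rewrite -big_split/=; apply: eq_bigr => n _.
rewrite /bump /= add1n mulrC -scalerA taylorS scalerDr LZ scaler_sumr; congr (_ + _).
apply: eq_bigr => j _; rewrite BZl BZr scalerA -exprD subnKC//.
by rewrite -ltnS.
Qed.

(** These are the pairs left out by the triangle: each of the N rows costs a multiple of 8^-N, and N
    8^-N <= 4^-N. *)
Let product_defect N t : `|t| <= h ->
  `|\sum_(j < N) B (t ^+ j *: taylor j) (P N t - P (N - j) t)|
    <= 2 * c * M ^+ 2 * 4^-1 ^+ N.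
Proof.
move=> th; apply: le_trans (ler_norm_sum _ _ _) _.
have cM : 0 <= 2 * c * M ^+ 2 by rewrite !mulr_ge0// sqr_ge0.
apply: (@le_trans _ _ (\sum_(j < N) 2 * c * M ^+ 2 * 8^-1 ^+ N)).
  apply: ler_sum => j _; have jN := ltnW (ltn_ord j).
  apply: le_trans (Bc _ _) _.
  have -> : 2 * c * M ^+ 2 * 8^-1 ^+ N =
      c * (M * 8^-1 ^+ j) * (2 * M * 8^-1 ^+ (N - j)).
    by rewrite -[in LHS](subnKC jN) exprD expr2; ring.
  apply: ler_pM; rewrite ?mulr_ge0 ?normr_ge0// ?P_tail//.
  by rewrite ler_wpM2l// term_bound.
rewrite sumr_const card_ord -mulrnAr ler_wpM2l// -mulr_natl.
have -> : (8^-1 : R) = 2^-1 * 4^-1 by lra.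
rewrite exprMn mulrA ler_piMl ?exprn_ge0// exprVn.
by rewrite ler_pdivrMr ?exprn_gt0// mul1r -natrX ler_nat ltnW// ltn_expl.
Qed.

Let U_bound t : `|t| <= h -> `|U t| <= 2 * M.
Proof. by move=> th; apply: (norm_cvg_le (Ucvg th)) => N; exact: P_bound. Qed.

Let dP_cvg t : `|t| <= h ->
  (fun N => \sum_(n < N.+1) (n%:R * t ^+ n.-1) *: taylor n) @ \oo --> quadF (U t).
Proof.
move=> th; apply/cvgrPdist_le => e e0.
have D0 : 0 < l + 2 * c * (2 * M).
  by rewrite ltr_wpDr// !mulr_ge0.
have q1 : `|4^-1 : R| < 1 by rewrite ger0_norm// invf_lt1// ltr1n.
have e2 : 0 < e / 2 by rewrite divr_gt0.
have /cvgrPdist_le /(_ _ (divr_gt0 e2 D0)) H1 := Ucvg th.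
have /cvgrPdist_le /(_ _ e2) H2 := cvg_geometric (2 * c * M ^+ 2) q1.
near=> N.
have -> : quadF (U t) - \sum_(n < N.+1) (n%:R * t ^+ n.-1) *: taylor n =
  (quadF (U t) - quadF (P N t)) +
  \sum_(j < N) B (t ^+ j *: taylor j) (P N t - P (N - j) t).
  have -> : \sum_(j < N) B (t ^+ j *: taylor j) (P N t - P (N - j) t) =
      B (P N t) (P N t) - \sum_(j < N) B (t ^+ j *: taylor j) (P (N - j) t).
    have BP y : B (P N t) y = \sum_(j < N) B (t ^+ j *: taylor j) y.
      exact: (@sumBl N (fun j : nat => t ^+ j *: taylor j) y).
    rewrite BP -sumrB.
    by apply: eq_bigr => j _; rewrite BBr.
  have zE (x a b d : E) : x - (a + d) = (x - (a + b)) + (b - d).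
    by rewrite !opprD !addrA subrK.
  by rewrite dP; exact: zE.
apply: le_trans (ler_normD _ _) _; rewrite [leRHS]splitr; apply: lerD.
  apply: le_trans (quadF_lip (U_bound th) (P_bound N th)) _.
  by rewrite mulrC -ler_pdivlMr//; near: N.
apply: le_trans (product_defect N th) _.
have : `|0 - geometric (2 * c * M ^+ 2) 4^-1 N| <= e / 2 by near: N.
by rewrite sub0r normrN; apply: le_trans; exact: ler_norm.
Unshelve. all: by end_near. Qed.

Lemma local_solution : exists V, V 0 = x0 /\
  solves (- (8 * (l + c * M))^-1) (8 * (l + c * M))^-1 V.
Proof.
exists U; split.
  apply: (@cvg_lim _ (@norm_hausdorff _ E)); apply/cvgrPdist_le => e e0.
  near=> N; have : (0 < N)%N by near: N; exact: nbhs_infty_gt.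
  case: (N) => // n _; rewrite /P big_ord_recl/= expr0 scale1r big1 ?addr0.
    by rewrite subrr normr0 ltW.
  by move=> j _; rewrite /bump /= exprS mul0r scale0r.
(* The Taylor remainder is estimated term by term: term n is at most M h^-2 n^2 8^-n (s - t)^2,
   hence at most M h^-2 2^-n (s - t)^2, and the geometric series contributes the factor 2. *)
exists (2 * M / h ^+ 2) => s t; rewrite -!ler_norml -/rho -/h => sh th.
apply: (@norm_cvg_le _ _ (fun N => P N.+1 s - P N.+1 t -
    (s - t) *: \sum_(n < N.+1) (n%:R * t ^+ n.-1) *: taylor n)).
  apply: cvgB; last by apply: cvgZr; exact: dP_cvg.
  by apply: cvgB; [have := Ucvg sh|have := Ucvg th]; rewrite -(cvg_shiftS (P^~ _)).
move=> N; rewrite scaler_sumr -!sumrB.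
apply: le_trans (ler_norm_sum _ _ _) _.
apply: (@le_trans _ _ (\sum_(n < N.+1) (M / h ^+ 2 * (s - t) ^+ 2) * 2^-1 ^+ n)).
  apply: ler_sum => n _; rewrite scalerA -!scalerBl normrZ.
  have T := taylor1_exp_bound n sh th.
  have h2 : 0 < h ^+ 2 by rewrite exprn_gt0.
  rewrite -(ler_pM2r h2).
  have -> : M / h ^+ 2 * (s - t) ^+ 2 * 2^-1 ^+ n * h ^+ 2 =
     M * (s - t) ^+ 2 * 2^-1 ^+ n.
    by rewrite mulrAC [_ * h ^+ 2]mulrAC mulfVK ?gt_eqF.
  rewrite mulrAC [(s - t) * (_ * _)]mulrCA [n%:R * (_ * _)]mulrA.
  apply: le_trans (ler_wpM2r (normr_ge0 _) T) _.
  apply: (@le_trans _ _ (n%:R ^+ 2 * h ^+ n * (s - t) ^+ 2 * (M * rho ^+ n))).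
    have hn := exprn_ge0 n (ltW h0).
    by rewrite ler_wpM2l// mulr_ge0 ?sqr_ge0// mulr_ge0 ?sqr_ge0.
  have -> : n%:R ^+ 2 * h ^+ n * (s - t) ^+ 2 * (M * rho ^+ n) =
     M * (s - t) ^+ 2 * (n%:R ^+ 2 * (h * rho) ^+ n) by rewrite exprMn; ring.
  apply: ler_wpM2l; first by rewrite mulr_ge0// sqr_ge0.
  have -> : h * rho = 4^-1 * 2^-1.
    by rewrite /h invfM -mulrA mulVf ?gt_eqF//; lra.
  rewrite exprMn mulrA ler_piMl ?exprn_ge0// exprVn.
  rewrite ler_pdivrMr ?exprn_gt0// mul1r -!natrX ler_nat.
  by rewrite -[4%N]/(2 ^ 2)%N -expnM mulnC expnM leq_exp2r// ltnW// ltn_expl.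
rewrite -mulr_sumr.
apply: le_trans (ler_wpM2l _ (sum_half_le2 R N.+1)) _.
  by rewrite mulr_ge0 ?sqr_ge0// divr_ge0 ?sqr_ge0.
by rewrite le_eqVlt; apply/orP; left; apply/eqP; ring.
Unshelve. all: by end_near. Qed.

End LocalSolution.
(** The remainder bound based at [a] bounds [U] on the interval; the vector field is then bounded
    along [U], and the remainder bound based at t becomes a Lipschitz estimate. *)
Lemma solves_bounds a b U : solves a b U -> exists m, 0 <= m /\ forall s t,
  a <= s <= b -> a <= t <= b -> `|U s| <= m /\ `|U s - U t| <= m * `|s - t|.
Proof.
move=> [K HK]; have [ab|ab] := leP a b; last first.
  exists 0; split=> // s t /andP[h1 h2]; have := lt_le_trans ab (le_trans h1 h2).
  by rewrite ltxx.
have aab : a <= a <= b by rewrite lexx.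
have K0 u w : a <= u <= b -> a <= w <= b -> K * (u - w) ^+ 2 <= `|K| * (b - a) * `|u - w|.
  move=> /andP[u1 u2] /andP[w1 w2]; apply: le_trans (ler_norm _) _.
  rewrite normrM -mulrA ler_wpM2l// normrX expr2 ler_wpM2r// ler_norml.
  by apply/andP; split; lra.
have d u w : a <= u <= b -> a <= w <= b ->
    `|U u - U w| <= `|u - w| * (`|quadF (U w)| + `|K| * (b - a)).
  move=> hu hw; rewrite -[U u - U w](subrK ((u - w) *: quadF (U w))).
  apply: le_trans (ler_normD _ _) _; rewrite normrZ mulrDr addrC lerD2l.
  by apply: le_trans (HK _ _ hu hw) _; rewrite [leRHS]mulrC K0.
pose m0 := `|U a| + (b - a) * (`|quadF (U a)| + `|K| * (b - a)).
have ba : 0 <= b - a by rewrite subr_ge0.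
have bd u : a <= u <= b -> `|U u| <= m0.
  move=> hu; rewrite -[U u](subrK (U a)) addrC; apply: le_trans (ler_normD _ _) _.
  rewrite lerD2l; apply: le_trans (d _ _ hu aab) _; rewrite ler_wpM2r//.
    by rewrite addr_ge0// mulr_ge0.
  by move/andP: hu => [u1 u2]; rewrite ger0_norm; lra.
have m00 : 0 <= m0 := le_trans (normr_ge0 _) (bd a aab).
pose m1 := l * m0 + c * m0 ^+ 2 + `|K| * (b - a).
have m10 : 0 <= m1.
  rewrite addr_ge0 ?mulr_ge0// addr_ge0//; first by rewrite mulr_ge0// ltW.
  by rewrite mulr_ge0// sqr_ge0.
exists (m0 + m1); split; first by rewrite addr_ge0.
move=> s t hs ht; split; first by apply: le_trans (bd _ hs) _; rewrite lerDl.
apply: le_trans (d _ _ hs ht) _; rewrite mulrC ler_wpM2r//.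
rewrite -[leLHS]add0r; apply: lerD => //; rewrite lerD2r.
exact: quadF_bound (bd _ ht).
Qed.

Lemma quadF_solves_lip a b U : solves a b U -> exists m, 0 <= m /\ forall s t,
  a <= s <= b -> a <= t <= b -> `|quadF (U s) - quadF (U t)| <= m * `|s - t|.
Proof.
move=> /solves_bounds[m [m0 H]].
have D0 : 0 <= l + 2 * c * m by rewrite addr_ge0 ?(ltW l0)// !mulr_ge0.
exists ((l + 2 * c * m) * m); split; first by rewrite mulr_ge0.
move=> s t hs ht; have [sm st] := H _ _ hs ht; have [tm _] := H _ _ ht ht.
by apply: le_trans (quadF_lip sm tm) _; rewrite -[leRHS]mulrA ler_wpM2l.
Qed.

Lemma solves_glue a b d U V : a <= b -> b <= d -> solves a b U -> solves b d V ->
  U b = V b -> solves a d (fun t => if t <= b then U t else V t).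
Proof.
move=> ab bd sU sV UV; have [m1 [m10 F1]] := quadF_solves_lip sU.
have [m2 [m20 F2]] := quadF_solves_lip sV.
move: sU sV => [K1 H1] [K2 H2].
have Kle K (x y : R) : x ^+ 2 <= y ^+ 2 -> K * x ^+ 2 <= `|K| * y ^+ 2.
  move=> xy; apply: (@le_trans _ _ (`|K| * x ^+ 2)).
    by rewrite ler_wpM2r ?sqr_ge0// ler_norm.
  by rewrite ler_wpM2l.
have zE (x y z p q w : E) : x - z - (p + q) = x - y - w + (y - z - q) + (w - p).
  have -> : (x - y - w) + (y - z - q) = (x - z) + (- w - q).
    by rewrite addrACA; congr (_ + _); rewrite addrA subrK.
  by rewrite -[RHS]addrA; congr (_ + _); rewrite addrACA addNr add0r opprD addrC.
(* Core of the gluing: the remainder from s to t is the remainder from s to b, plus that from b to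
   t, plus (s - b)(p - q) for the change of the vector field. As b lies between s and t, all three
   are dominated by (s - t)^2. *)
have mid (s t : R) (X Y Z p q : E) (k1 k2 m : R) : 0 <= (s - b) * (b - t) -> 0 <= m ->
    `|X - Y - (s - b) *: p| <= k1 * (s - b) ^+ 2 ->
    `|Y - Z - (b - t) *: q| <= k2 * (b - t) ^+ 2 ->
    `|p - q| <= m * `|b - t| ->
    `|X - Z - (s - t) *: q| <= (`|k1| + `|k2| + m) * (s - t) ^+ 2.
  move=> sbt m0 h1 h2 h3; have st : s - t = (s - b) + (b - t) by ring.
  have sE : (s - t) ^+ 2 = (s - b) ^+ 2 + 2 * ((s - b) * (b - t)) + (b - t) ^+ 2 by ring.
  have q1 := sqr_ge0 (s - b); have q2 := sqr_ge0 (b - t).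
  rewrite {1}st scalerDl (zE _ Y _ _ _ ((s - b) *: p)) -scalerBr !mulrDl.
  apply: le_trans (ler_normD _ _) _; apply: lerD.
    apply: le_trans (ler_normD _ _) _; apply: lerD.
      by apply: le_trans h1 _; apply: Kle; rewrite sE; lra.
    by apply: le_trans h2 _; apply: Kle; rewrite sE; lra.
  rewrite normrZ; apply: le_trans (ler_wpM2l (normr_ge0 _) h3) _.
  rewrite mulrCA -normrM (ger0_norm sbt) ler_wpM2l// sE; lra.
have bb1 : a <= b <= b by rewrite ab lexx.
have bb2 : b <= b <= d by rewrite bd lexx.
exists (`|K1| + `|K2| + (m1 + m2)) => s t /andP[as_ sd] /andP[at_ td].
have Kt (K x : R) : K <= `|K1| + `|K2| + (m1 + m2) -> K * x ^+ 2 <=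
    (`|K1| + `|K2| + (m1 + m2)) * x ^+ 2 by move=> KK; rewrite ler_wpM2r ?sqr_ge0.
have k10 := normr_ge0 K1; have k20 := normr_ge0 K2.
have [sb|sb] := leP s b; have [tb|tb] := leP t b.
- apply: le_trans (H1 _ _ _ _) _; rewrite ?as_ ?at_//.
  by apply: le_trans (Kle _ _ _ (lexx _)) _; apply: Kt; lra.
- have s1 : a <= s <= b by rewrite as_.
  have t2 : b <= t <= d by rewrite (ltW tb).
  apply: le_trans (mid _ _ _ (U b) _ (quadF (U b)) _ K1 K2 m2 _ m20 _ _ _) _.
  + have : s - b <= 0 by lra.
    have : b - t <= 0 by lra.
    nra.
  + exact: H1.
  + by rewrite UV; exact: H2.
  + by rewrite UV; exact: F2.
  + by apply: Kt; lra.
- have s2 : b <= s <= d by rewrite (ltW sb).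
  have t1 : a <= t <= b by rewrite at_.
  rewrite [`|K1| + _]addrC.
  apply: le_trans (mid _ _ _ (V b) _ (quadF (V b)) _ K2 K1 m1 _ m10 _ _ _) _.
  + have : 0 <= s - b by lra.
    have : 0 <= b - t by lra.
    nra.
  + exact: H2.
  + by rewrite -UV; exact: H1.
  + by rewrite -UV; exact: F1.
  + by rewrite [`|K2| + _]addrC; apply: Kt; lra.
- apply: le_trans (H2 _ _ _ _) _; rewrite ?(ltW sb) ?(ltW tb)//.
  by apply: le_trans (Kle _ _ _ (lexx _)) _; apply: Kt; lra.
Qed.

Theorem global_solution (x0 : E) (T M : R) : 0 <= T ->
  (forall tau U, 0 <= tau <= T -> U 0 = x0 -> solves 0 tau U ->
    forall t, 0 <= t <= tau -> `|U t| <= M) ->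
  exists U, U 0 = x0 /\ solves 0 T U.
Proof.
(* The a priori bound provides one step size for all restarts; the absolute value keeps it positive
   for any real [M]. *)
move=> T0 HM; pose h := (8 * (l + c * `|M|))^-1.
have h0 : 0 < h.
  by rewrite /h invr_gt0 mulr_gt0// ltr_wpDr// mulr_ge0.
have step (n : nat) : exists U, U 0 = x0 /\ solves 0 (Num.min (n%:R * h) T) U.
  elim: n => [|n [U [U0 sU]]].
    exists (fun=> x0); split => //; exists 0 => s t.
    rewrite mul0r min_l// -!eq_le => /eqP <- /eqP <-.
    by rewrite !subrr scale0r subr0 normr0 mul0r.
  set tau := Num.min _ T in sU.
  have t0 : 0 <= tau by rewrite le_min T0 mulr_ge0// ltW.
  have tT : tau <= T by rewrite ge_min lexx orbT.
  have UM : `|U tau| <= `|M|.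
    apply: le_trans (ler_norm M); by apply: (HM tau U) => //; rewrite t0 ?lexx.
  have [V [V0 [K HK]]] := local_solution UM; rewrite -/h in HK.
  set tau' := Num.min _ T.
  have tt' : tau <= tau'.
    by rewrite le_min tT andbT ge_min ler_wpM2r ?ler_nat ?(ltW h0).
  have t'h : tau' <= tau + h.
    rewrite /tau /tau' -natr1 mulrDl mul1r.
    by have [?|?] := leP (n%:R * h) T; have [?|?] := leP (n%:R * h + h) T; lra.
  exists (fun t => if t <= tau then U t else V (t - tau)); split; first by rewrite t0.
  apply: (solves_glue (V := fun t => V (t - tau)) t0 tt' sU); last by rewrite subrr.
  exists K => s t /andP[s1 s2] /andP[t1 t2].
  have -> : s - t = (s - tau) - (t - tau) by ring.
  by apply: HK; apply/andP; split; lra.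
have [n nT] : exists n : nat, T <= n%:R * h.
  exists (Num.truncn (T / h)).+1; rewrite -ler_pdivrMr// ltW//.
  by rewrite truncnS_gt.
by have := step n; rewrite min_r.
Qed.

End QuadraticODE.

(** * Fourier series *)

Section IntegralI.
Context {R : realType}.
Local Notation mu := (@lebesgue_measure R).
Local Notation I := (@I R).
Implicit Types (f g h : R -> R) (M : R).

Definition intI f : R := \int[mu]_(x in I) f x.
Definition L1I f := mu.-integrable I (EFin \o f).
Definition L2I f := measurable_fun [set: R] f /\ L1I (fun x => f x ^+ 2).
(** Bounded on the whole line: multiplication by such functions preserves L^1 and L^2, and
    continuous periodic functions qualify. *)
Definition bmeas f := measurable_fun [set: R] f /\ exists M, forall x, `|f x| <= M.

Lemma measurable_I : measurable (I : set (measurableTypeR R)). Proof. exact: measurable_itv. Qed.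
Hint Resolve measurable_I : core.

Lemma mu_I : mu I = (2 * pi)%:E.
Proof.
rewrite /Defs.I lebesgue_measure_itv /= lte_fin.
have p0 := pi_gt0 R; rewrite ifT; last by lra.
by rewrite -EFinB; congr EFin; lra.
Qed.

Lemma eq_intI f g : (forall x, I x -> f x = g x) -> intI f = intI g.
Proof. by move=> fg; apply: eq_Rintegral => x /set_mem; exact: fg. Qed.

Lemma L1ID f g : L1I f -> L1I g -> L1I (fun x => f x + g x).
Proof.
move=> lf lg; have := integrableD measurable_I lf lg.
by apply: eq_integrable => // x _.
Qed.

Lemma L1IZ M f : L1I f -> L1I (fun x => M * f x).
Proof.
move=> lf; have := integrableZl measurable_I M lf.
by apply: eq_integrable => // x _.
Qed.

Lemma intID f g : L1I f -> L1I g -> intI (fun x => f x + g x) = intI f + intI g.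
Proof. by move=> lf lg; exact: RintegralD. Qed.

Lemma intIZ M f : L1I f -> intI (fun x => M * f x) = M * intI f.
Proof. by move=> lf; exact: RintegralZl. Qed.

Lemma L1IN f : L1I f -> L1I (fun x => - f x).
Proof. by move=> /(L1IZ (-1)); rewrite /L1I; congr integrable; apply/funext => x /=; rewrite mulN1r. Qed.

Lemma L1IB f g : L1I f -> L1I g -> L1I (fun x => f x - g x).
Proof. by move=> lf /L1IN; exact: L1ID. Qed.

Lemma intIB f g : L1I f -> L1I g -> intI (fun x => f x - g x) = intI f - intI g.
Proof. by move=> lf lg; exact: RintegralB. Qed.

Lemma L1I_sum (J : Type) (s : seq J) (F : J -> R -> R) :
  (forall j, L1I (F j)) -> L1I (fun x => \sum_(j <- s) F j x).
Proof.
move=> HF; elim: s => [|j s IH].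
  have := integrable0 mu I; rewrite /L1I; congr integrable.
  by apply/funext => x /=; rewrite big_nil.
have := L1ID (HF j) IH; rewrite /L1I; congr integrable.
by apply/funext => x /=; rewrite big_cons.
Qed.

Lemma intI_sum (J : Type) (s : seq J) (F : J -> R -> R) :
  (forall j, L1I (F j)) ->
  intI (fun x => \sum_(j <- s) F j x) = \sum_(j <- s) intI (F j).
Proof.
move=> HF; elim: s => [|j s IH].
  rewrite big_nil -[RHS](mul0r (intI (cst 0))) -intIZ.
    by apply: eq_intI => x _; rewrite big_nil mul0r.
  exact: integrable0.
rewrite big_cons -IH -intID//; last exact: L1I_sum.
by apply: eq_intI => x _; rewrite big_cons.
Qed.

Lemma le_intI f g : L1I f -> L1I g -> (forall x, I x -> f x <= g x) ->
  intI f <= intI g.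
Proof. by move=> lf lg fg; exact: le_Rintegral. Qed.

Lemma intI_ge0 f : (forall x, I x -> 0 <= f x) -> 0 <= intI f.
Proof. by move=> f0; rewrite /intI; apply: Rintegral_ge0. Qed.

Lemma norm_intI f : L1I f -> `|intI f| <= intI (fun x => `|f x|).
Proof. by move=> lf; exact: le_normr_Rintegral. Qed.

Lemma L1I_norm f : L1I f -> L1I (fun x => `|f x|).
Proof. exact: integrable_norm. Qed.

Lemma bmeas_L1 f : bmeas f -> L1I f.
Proof.
move=> [mf [M fM]]; apply: measurable_bounded_integrable => //.
- have muI : (mu I < +oo)%E by rewrite mu_I ltry.
  exact: muI.
- exact: measurable_funTS.
- exists M; split; first exact: num_real.
  by move=> y My x _; apply: le_trans (fM x) (ltW My).
Qed.

Lemma intI_cst M : intI (fun=> M) = 2 * pi * M.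
Proof.
transitivity (M * fine (mu I)); first exact: (Rintegral_cst _ measurable_I).
by rewrite mu_I /= mulrC.
Qed.

Lemma bmeas_cst M : bmeas (fun=> M).
Proof. by split; [exact: measurable_cst|exists `|M|]. Qed.

Lemma bmeasD f g : bmeas f -> bmeas g -> bmeas (fun x => f x + g x).
Proof.
move=> [mf [M fM]] [mg [N gN]]; split; first exact: measurable_funD.
by exists (M + N) => x; apply: le_trans (ler_normD _ _) _; exact: lerD.
Qed.

Lemma bmeasM f g : bmeas f -> bmeas g -> bmeas (fun x => f x * g x).
Proof.
move=> [mf [M fM]] [mg [N gN]]; split; first exact: measurable_funM.
by exists (M * N) => x; rewrite normrM ler_pM.
Qed.

Lemma bmeasN f : bmeas f -> bmeas (fun x => - f x).
Proof.
move=> /(bmeasM (bmeas_cst (-1))); congr bmeas.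
by apply/funext => x; rewrite mulN1r.
Qed.

Lemma bmeasB f g : bmeas f -> bmeas g -> bmeas (fun x => f x - g x).
Proof. by move=> bf /bmeasN; exact: bmeasD. Qed.

Lemma le_L1I f g : measurable_fun [set: R] f -> L1I g ->
  (forall x, `|f x| <= g x) -> L1I f.
Proof.
move=> mf lg fg; apply: le_integrable lg => //.
  by apply/measurable_EFinP; exact: measurable_funTS.
by move=> x _ /=; rewrite lee_fin; apply: le_trans (fg x) (ler_norm _).
Qed.

Lemma bmeas_L1M f g : bmeas f -> measurable_fun [set: R] g -> L1I g ->
  L1I (fun x => f x * g x).
Proof.
move=> [mf [M fM]] mg lg; apply: (@le_L1I _ (fun x => M * `|g x|)).
- exact: measurable_funM.
- by apply: L1IZ; exact: L1I_norm.
- by move=> x; rewrite normrM ler_wpM2r.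
Qed.

Lemma L2I_mul f g : L2I f -> L2I g -> L1I (fun x => f x * g x).
Proof.
move=> [mf lf] [mg lg]; apply: le_L1I (L1ID lf lg) _; first exact: measurable_funM.
move=> x; rewrite ler_norml; have := sqr_ge0 (f x - g x); have := sqr_ge0 (f x + g x).
have := sqr_ge0 (f x); have := sqr_ge0 (g x).
by move=> ? ? ? ?; apply/andP; split; nra.
Qed.

Lemma bmeas_L2 f : bmeas f -> L2I f.
Proof.
move=> bf; split; first by have [] := bf.
exact: (bmeas_L1 (bmeasM bf bf)).
Qed.

Lemma L2I_L1 f : L2I f -> L1I f.
Proof.
move=> /L2I_mul /(_ (bmeas_L2 (bmeas_cst 1))); rewrite /L1I; congr integrable.
by apply/funext => x /=; rewrite mulr1.
Qed.

Lemma L2ID f g : L2I f -> L2I g -> L2I (fun x => f x + g x).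
Proof.
move=> lf lg; split; first by apply: measurable_funD; [case: lf|case: lg].
have [[_ sf] [_ sg]] := (lf, lg).
have := L1ID (L1ID sf sg) (L1IZ 2 (L2I_mul lf lg)); rewrite /L1I; congr integrable.
by apply/funext => x /=; congr EFin; ring.
Qed.

Lemma L2I_bmeasM f g : bmeas f -> L2I g -> L2I (fun x => f x * g x).
Proof.
move=> [mf [M fM]] [mg lg]; split; first exact: measurable_funM.
apply: le_L1I (L1IZ (M ^+ 2) lg) _.
  by apply: measurable_funX; exact: measurable_funM.
move=> x; rewrite normrX normrM exprMn.
have -> : `|g x| ^+ 2 = g x ^+ 2 by rewrite real_normK ?num_real.
have M0 := le_trans (normr_ge0 _) (fM x).
by rewrite ler_wpM2r ?sqr_ge0// lerXn2r ?nnegrE.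
Qed.

Lemma L2IZ M f : L2I f -> L2I (fun x => M * f x).
Proof. exact: L2I_bmeasM (bmeas_cst M). Qed.

Lemma L2IN f : L2I f -> L2I (fun x => - f x).
Proof.
move=> /(L2IZ (-1)); congr L2I; apply/funext => x; exact: mulN1r.
Qed.

Lemma L2IB f g : L2I f -> L2I g -> L2I (fun x => f x - g x).
Proof. by move=> lf /L2IN; exact: L2ID. Qed.

Lemma intI_CauchySchwarz f g : L2I f -> L2I g ->
  intI (fun x => f x * g x) ^+ 2 <=
  intI (fun x => f x ^+ 2) * intI (fun x => g x ^+ 2).
Proof.
move=> lf lg; have [[_ sf] [_ sg]] := (lf, lg).
apply: discriminant_le; [by apply: intI_ge0 => *; exact: sqr_ge0
  |by apply: intI_ge0 => *; exact: sqr_ge0|move=> t].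
have lm := L2I_mul lf lg.
rewrite -!intIZ// -!intID//; [|by apply: L1ID => //; exact: L1IZ|exact: L1IZ|exact: L1IZ].
by apply: intI_ge0 => x _; rewrite (_ : _ + _ = (f x + t * g x) ^+ 2) ?sqr_ge0//; ring.
Qed.

End IntegralI.
#[global] Hint Resolve measurable_I : core.

(** * Trigonometric monomials and polynomials *)

Section Trig.
Context {R : realType}.
Local Notation I := (@I R).
Implicit Types (f g h : R -> R) (z : R[i]) (k j : int) (x : R) (a c : int -> R[i]).

Definition C1p f := [/\ Defs.periodic f, (forall x, derivable f x 1) &
  continuous (derive1 f)].

Lemma is_derive_C1p f f' : Defs.periodic f -> (forall x, is_derive x 1 f (f' x)) ->
  continuous f' -> C1p f /\ derive1 f = f'.
Proof.
move=> pf df cf; have E : derive1 f = f'.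
  by apply/funext => x; rewrite derive1E; exact: derive_val.
by split => //; split; rewrite ?E.
Qed.

Lemma C1p_continuous f : C1p f -> continuous f.
Proof.
by move=> [_ df _] x; apply/differentiable_continuous/derivable1_diffP.
Qed.

Lemma C1p_LR f : C1p f -> derivable_oo_LRcontinuous f (- pi) pi.
Proof.
move=> cf; have [_ df _] := cf; have c := C1p_continuous cf.
by split => //; apply: cvg_within_filter; exact: c.
Qed.

Lemma intI_parts f g : C1p f -> C1p g ->
  intI (fun x => f x * derive1 g x) = - intI (fun x => derive1 f x * g x).
Proof.
move=> cf cg; have p0 := pi_gt0 R; have pp : - pi < pi :> R by lra.
have [pf _ f'c] := cf; have [pg _ g'c] := cg.
rewrite /intI /Defs.I (@Rintegration_by_parts R f g (derive1 f) (derive1 g) (- pi) pi) //.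
- have e h : Defs.periodic h -> h pi = h (- pi) 
    by move=> /(_ (- pi)); rewrite (_ : - pi + 2 * pi = pi)//; lra.
  by rewrite (e f)// (e g)// subrr sub0r.
- exact: continuous_subspaceT.
- exact: C1p_LR.
- exact: continuous_subspaceT.
- exact: C1p_LR.
Qed.

Lemma continuous_bmeas f : continuous f -> Defs.periodic f -> bmeas f.
Proof.
move=> cf pf; split; first exact: continuous_measurable_fun.
have p0 := pi_gt0 R; have pp : - pi <= pi :> R by lra.
have cfI : {within `[- pi, pi], continuous (fun x => `|f x|)}.
  apply: continuous_subspaceT => x; apply: continuous_comp; first exact: cf.
  exact: norm_continuous.
have [c _ fM] := EVT_max pp cfI; exists `|f c| => x.
have per n : forall y, f (y + n%:R * (2 * pi)) = f y.
  elim: n => [|n IH] y; first by rewrite mul0r addr0.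
  by rewrite -natr1 mulrDl mul1r addrA pf IH.
(* Reduction of x to I by natural multiples of the period: up by n periods until it is nonnegative,
   then down by m. *)
have [n nx] : exists n : nat, `|x| <= n%:R * (2 * pi).
  exists (Num.truncn (`|x| / (2 * pi))).+1; rewrite -ler_pdivrMr; last by lra.
  by rewrite ltW// truncnS_gt.
pose y := x + n%:R * (2 * pi).
have y0 : 0 <= y.
  by rewrite /y; move: nx; rewrite ler_norml => /andP[]; lra.
have [m /andP[m1 m2]] : exists m : nat, m%:R * (2 * pi) <= y + pi < m.+1%:R * (2 * pi).
  exists (Num.truncn ((y + pi) / (2 * pi))).
  rewrite -ler_pdivlMr ?mulr_gt0// -ltr_pdivrMr ?mulr_gt0//.
  by rewrite truncn_le ?truncnS_gt// divr_ge0; lra.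
have -> : f x = f (y - m%:R * (2 * pi)).
  by rewrite -(per n) -/y -[in LHS](subrK (m%:R * (2 * pi)) y) per.
apply: fM; rewrite in_itv/=; move: m2; rewrite -natr1 mulrDl mul1r => m2.
by apply/andP; split; lra.
Qed.

(* [trm z k] is the real part of [z e^(ikx)]; summed over [k] with hermitian
   coefficients it is the Fourier series itself. *)
Definition trm z k x : R :=
  complex.Re z * cos (k%:~R * x) - complex.Im z * sin (k%:~R * x).
(** Multiplication by ik, the Fourier symbol of d/dx. *)
Definition mulik k z : R[i] := Complex 0 (k%:~R : R) * z.
Definition tpoly a N x : R := \sum_(k <- zwin N) trm (a k) k x.

Lemma cos_periodic k : Defs.periodic (fun x => cos (k%:~R * x)) /\
  Defs.periodic (fun x => sin (k%:~R * x)).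
Proof.
have c2 (u : R) n : cos (u + (pi *+ 2) *+ n) = cos u /\ sin (u + (pi *+ 2) *+ n) = sin u.
  by split; apply: periodicn => v; rewrite ?cosD2pi ?sinD2pi.
have E x n : n%:R * (x + 2 * pi) = n%:R * x + (pi *+ 2) *+ n :> R.
  by rewrite mulrDr; congr (_ + _); rewrite -[_ *+ 2 *+ n]mulr_natl -[pi *+ 2]mulr_natl.
case: k => n; split => x; rewrite ?NegzE ?mulrNz ?mulNr ?cosN ?sinN.
all: by rewrite -pmulrn E; first [rewrite (c2 _ _).1|rewrite (c2 _ _).2].
Qed.

Lemma trm_periodic z k : Defs.periodic (trm z k).
Proof. by move=> x; have [c s] := cos_periodic k; rewrite /trm c s. Qed.

Lemma is_derive_trm z k x : is_derive x 1 (trm z k) (trm (mulik k z) k x).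
Proof.
have hk : is_derive x 1 (fun y => k%:~R * y) (k%:~R : R).
  by have := is_deriveZ (k%:~R : R) (is_derive_id x 1); rewrite /GRing.scale /= mulr1.
have hc := is_derive1_comp (is_derive_cos (k%:~R * x)) hk.
have hs := is_derive1_comp (is_derive_sin (k%:~R * x)) hk.
have H := is_deriveB (is_deriveZ (complex.Re z) hc) (is_deriveZ (complex.Im z) hs).
refine (@is_derive_eq _ _ _ (trm z k) x 1 _ _ H _); case: z {hc hs H} => p q; rewrite /trm /mulik /GRing.scale /=; ring.
Qed.

Lemma trm_continuous z k : continuous (trm z k).
Proof.
move=> x; apply/differentiable_continuous/derivable1_diffP.
by have [] := is_derive_trm z k x.
Qed.

Lemma tpoly_periodic a N : Defs.periodic (tpoly a N).
Proof. by move=> x; apply: eq_bigr => k _; exact: trm_periodic. Qed.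

Lemma tpoly_continuous a N : continuous (tpoly a N).
Proof.
move=> x; apply: cvg_big => [|k _]; [exact: add_continuous|exact: trm_continuous].
Qed.

Lemma tpoly_bmeas a N : bmeas (tpoly a N).
Proof.
by apply: continuous_bmeas; [exact: tpoly_continuous|exact: tpoly_periodic].
Qed.

Lemma trm_bmeas z k : bmeas (trm z k).
Proof. by apply: continuous_bmeas; [exact: trm_continuous|exact: trm_periodic]. Qed.

Lemma is_derive_tpoly a N x :
  is_derive x 1 (tpoly a N) (tpoly (fun k => mulik k (a k)) N x).
Proof.
rewrite /tpoly; elim: (zwin N) => [|k s IH].
  have -> : (fun x => \sum_(k <- [::]) trm (a k) k x) = cst 0.
    by apply/funext => y; rewrite big_nil.
  by rewrite big_nil; exact: is_derive_cst.
rewrite big_cons.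
have -> : (fun x => \sum_(j <- k :: s) trm (a j) j x) =
    trm (a k) k + (fun x => \sum_(j <- s) trm (a j) j x).
  by apply/funext => y; rewrite big_cons.
exact: is_deriveD (is_derive_trm _ _ _) IH.
Qed.

Lemma tpoly_C1p a N : C1p (tpoly a N) /\
  derive1 (tpoly a N) = tpoly (fun k => mulik k (a k)) N.
Proof.
apply: is_derive_C1p; [exact: tpoly_periodic|move=> x; exact: is_derive_tpoly|].
exact: tpoly_continuous.
Qed.

Lemma trm_C1p z k : C1p (trm z k) /\ derive1 (trm z k) = trm (mulik k z) k.
Proof.
apply: is_derive_C1p; [exact: trm_periodic|move=> x; exact: is_derive_trm|].
exact: trm_continuous.
Qed.

Lemma cos_trm k x : cos (k%:~R * x) = trm 1 k x.
Proof. by rewrite /trm /= mul1r mul0r subr0. Qed.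

Lemma sin_trm k x : - sin (k%:~R * x) = trm 'i%C k x.
Proof. by rewrite /trm /= mul1r mul0r sub0r. Qed.

Lemma Re_fourier h k :
  complex.Re (fourier h k) = (2 * pi)^-1 * intI (fun x => h x * trm 1 k x).
Proof.
rewrite /fourier /cintegral /= mul0r subr0; congr (_ * _); apply: eq_intI => x _ /=.
by rewrite mul0r subr0 cosN cos_trm.
Qed.

Lemma Im_fourier h k :
  complex.Im (fourier h k) = (2 * pi)^-1 * intI (fun x => h x * trm 'i%C k x).
Proof.
rewrite /fourier /cintegral /= mul0r addr0; congr (_ * _); apply: eq_intI => x _ /=.
by rewrite mul0r addr0 sinN sin_trm.
Qed.

End Trig.

(** * Fourier coefficients as pairings with trigonometric monomials *)

Section Coef.
Context {R : realType}.
Local Notation nc := (@ComplexField.Normc.normc R).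
Implicit Types (f g h : R -> R) (z w v : R[i]) (k j : int) (x M : R) (a b c : int -> R[i]).

Lemma nc_ge0 z : 0 <= nc z. Proof. by case: z => p q; exact: sqrtr_ge0. Qed.
Hint Resolve nc_ge0 : core.
Lemma ncM z w : nc (z * w) = nc z * nc w. Proof. exact: ComplexField.Normc.normcM. Qed.
Lemma ncD z w : nc (z + w) <= nc z + nc w. Proof. exact: le_normcD. Qed.
Lemma nc_sum (T : Type) (s : seq T) (F : T -> R[i]) :
  nc (\sum_(t <- s) F t) <= \sum_(t <- s) nc (F t).
Proof.
elim: s => [|t s IH]; last by rewrite !big_cons; apply: le_trans (ncD _ _) _; rewrite lerD2l.
by rewrite !big_nil /= expr0n /= addr0 sqrtr0.
Qed.

(** Coefficient identities are mostly proved by pairing with an arbitrary z, because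
    [dotc z (fourier h k)] is, up to 2 pi, the real integral of h times [trm z k]. *)
Lemma dotc_inj z w : (forall v, dotc v z = dotc v w) -> z = w.
Proof.
move=> H; have := H 1; have := H 'i%C; case: z w {H} => p q [p' q'].
by rewrite /dotc /= !mul0r !mul1r !add0r !addr0 => -> ->.
Qed.

Lemma dotc_mull z w v : dotc (conjc z * w) v = dotc w (z * v).
Proof. by case: z w v => p q [p' q'] [p2 q2]; rewrite /dotc /=; ring. Qed.

Lemma dotc_sumr (T : Type) (s : seq T) z (F : T -> R[i]) :
  dotc z (\sum_(t <- s) F t) = \sum_(t <- s) dotc z (F t).
Proof.
elim: s => [|t s IH]; last by rewrite !big_cons dotcDr IH.
by rewrite !big_nil /dotc /= !mulr0 addr0.
Qed.

Lemma trmD z w k x : trm (z + w) k x = trm z k x + trm w k x.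
Proof. by case: z w => p q [p' q']; rewrite /trm /=; ring. Qed.

(** Lagrange's identity: the defect |z|^2 - trm^2 is the square of the companion term p sin + q
    cos. *)
Lemma norm_trm z k x : `|trm z k x| <= nc z.
Proof.
rewrite -(@ger0_norm _ (nc z))// -ler_sqr ?normr_ge0// !real_normK ?num_real//.
have cs := cos2Dsin2 (k%:~R * x).
rewrite nsq_normc /nsq /trm -[leRHS]mulr1 -[X in _ <= _ * X]cs -subr_ge0; move: cs => _.
set c := cos _; set s := sin _; set p := complex.Re z; set q := complex.Im z.
suff -> : (p ^+ 2 + q ^+ 2) * (c ^+ 2 + s ^+ 2) - (p * c - q * s) ^+ 2 =
  (p * s + q * c) ^+ 2 by exact: sqr_ge0.
ring.
Qed.

(** Re A Re B = (Re (conj A B) + Re (A B)) / 2. *)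
Lemma trmM z w j k x : trm z j x * trm w k x =
  2^-1 * (trm (conjc z * w) (k - j) x + trm (z * w) (k + j) x).
Proof.
have e1 : (k - j)%:~R * x = k%:~R * x - j%:~R * x by rewrite rmorphB mulrBl.
have e2 : (k + j)%:~R * x = k%:~R * x + j%:~R * x by rewrite rmorphD mulrDl.
rewrite /trm e1 e2 cosB sinB cosD sinD.
by case: z w => p q [p' q'] /=; field.
Qed.

Definition mL1 h := measurable_fun [set: R] h /\ L1I h.

Lemma L2_mL1 h : L2I h -> mL1 h.
Proof. by move=> l2; split; [case: l2|exact: L2I_L1]. Qed.

Lemma bmeas_mL1 h : bmeas h -> mL1 h.
Proof. by move=> bh; split; [case: bh|exact: bmeas_L1]. Qed.

Lemma mL1_bmeasM h g : mL1 h -> bmeas g -> mL1 (fun x => h x * g x).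
Proof.
move=> [mh lh] bg; have [mg _] := bg; split; first exact: measurable_funM.
by have := bmeas_L1M bg mh lh; under eq_fun do rewrite mulrC.
Qed.

Lemma mL1D h g : mL1 h -> mL1 g -> mL1 (fun x => h x + g x).
Proof. by move=> [mh lh] [mg lg]; split; [exact: measurable_funD|exact: L1ID]. Qed.

Lemma mL1Z M h : mL1 h -> mL1 (fun x => M * h x).
Proof. by move=> [mh lh]; split; [exact: measurable_funM|exact: L1IZ]. Qed.

Lemma mL1_trm h z k : mL1 h -> L1I (fun x => h x * trm z k x).
Proof. by move=> lh; have [] := mL1_bmeasM lh (trm_bmeas z k). Qed.

Lemma twopi_gt0 : 0 < 2 * pi :> R.
Proof. by rewrite mulr_gt0// pi_gt0. Qed.
Lemma twopi_neq0 : 2 * pi != 0 :> R.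
Proof. exact/lt0r_neq0/twopi_gt0. Qed.

Lemma intI_trm h z k : mL1 h ->
  intI (fun x => h x * trm z k x) = 2 * pi * dotc z (fourier h k).
Proof.
move=> lh; rewrite /dotc Re_fourier Im_fourier.
have -> : forall A B : R, 2 * pi * (complex.Re z * ((2 * pi)^-1 * A) +
    complex.Im z * ((2 * pi)^-1 * B)) = complex.Re z * A + complex.Im z * B.
  by move=> A B; rewrite mulrDr (mulrCA (2 * pi)) [X in _ + X](mulrCA (2 * pi)) !mulVKf ?twopi_neq0.
rewrite -!intIZ ?mL1_trm// -intID; [|exact/L1IZ/mL1_trm|exact/L1IZ/mL1_trm].
by apply: eq_intI => x _; rewrite /trm /=; ring.
Qed.

Lemma dotc_fourier h z k : mL1 h ->
  dotc z (fourier h k) = (2 * pi)^-1 * intI (fun x => h x * trm z k x).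
Proof. by move=> lh; rewrite intI_trm// mulKf// twopi_neq0. Qed.

(** The coefficient paired with itself gives the square of its modulus as an integral, which is
    bounded by the modulus times the L^1 norm; one factor is then cancelled. *)
Lemma nc_fourier_le h k : mL1 h ->
  nc (fourier h k) <= (2 * pi)^-1 * intI (fun x => `|h x|).
Proof.
move=> lh; have [_ l1] := lh; set z := fourier h k.
have [z0|zn] := eqVneq (nc z) 0.
  by rewrite z0 mulr_ge0 ?invr_ge0 ?(ltW twopi_gt0)//; apply: intI_ge0.
have zp : 0 < nc z by rewrite lt_neqAle eq_sym zn nc_ge0.
rewrite -(ler_pM2r zp) -expr2 nsq_normc -dotcc {2}/z dotc_fourier// -mulrA.
rewrite ler_pM2l ?invr_gt0 ?twopi_gt0//.
apply: le_trans (ler_norm _) _; apply: le_trans (norm_intI (mL1_trm _ _ lh)) _.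
rewrite mulrC -intIZ; last exact: L1I_norm.
apply: le_intI => [||x _].
- by apply/L1I_norm/mL1_trm.
- exact/L1IZ/L1I_norm.
- by rewrite normrM mulrC ler_wpM2r// norm_trm.
Qed.

Lemma fourierD f g k : mL1 f -> mL1 g ->
  fourier (fun x => f x + g x) k = fourier f k + fourier g k.
Proof.
move=> lf lg; apply: dotc_inj => z; rewrite dotcDr !dotc_fourier//; last exact: mL1D.
rewrite -mulrDr -intID ?mL1_trm//; congr (_ * _).
by apply: eq_intI => x _; rewrite mulrDl.
Qed.

Lemma fourierZ M f k : mL1 f ->
  fourier (fun x => M * f x) k = real_complex R M * fourier f k.
Proof.
move=> lf; apply: dotc_inj => z; rewrite dotcZr !dotc_fourier//; last exact: mL1Z.
rewrite mulrCA -(intIZ M) ?mL1_trm//; congr (_ * _).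
by apply: eq_intI => x _; rewrite mulrA.
Qed.

Lemma fourierN f k : mL1 f -> fourier (fun x => - f x) k = - fourier f k.
Proof.
move=> lf; have -> : (fun x => - f x) = (fun x => -1 * f x).
  by apply/funext => x; rewrite mulN1r.
by rewrite fourierZ// rmorphN1 mulN1r.
Qed.

Lemma fourierB f g k : mL1 f -> mL1 g ->
  fourier (fun x => f x - g x) k = fourier f k - fourier g k.
Proof.
move=> lf lg; rewrite -fourierN// -fourierD//.
have := mL1Z (-1) lg; rewrite (_ : (fun x => -1 * g x) = (fun x => - g x))//.
by apply/funext => x; rewrite mulN1r.
Qed.

Lemma fourier_opp f k : mL1 f -> fourier f (- k) = conjc (fourier f k).
Proof.
move=> lf; apply: dotc_inj => z.
have -> : dotc z (conjc (fourier f k)) = dotc (conjc z) (fourier f k).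
  by case: z (fourier f k) => p q [p' q']; rewrite /dotc /=; ring.
rewrite !dotc_fourier//; congr (_ * _); apply: eq_intI => x _.
by case: z => p q; rewrite /trm rmorphN /= mulNr cosN sinN; ring.
Qed.

Lemma fourierM_trm h z j k : mL1 h -> fourier (fun x => h x * trm z j x) k =
  real_complex R 2^-1 * (z * fourier h (k - j) + conjc z * fourier h (k + j)).
Proof.
move=> lh; have lz := mL1_bmeasM lh (trm_bmeas z j).
apply: dotc_inj => w; rewrite dotc_fourier// dotcZr dotcDr -(dotc_mull z w) -(dotc_mull (conjc z) w) conjcK.
rewrite !dotc_fourier// -mulrDr -intID ?mL1_trm// mulrCA -(intIZ 2^-1); last first.
  by apply: L1ID; exact: mL1_trm.
congr (_ * _); apply: eq_intI => x _; rewrite -mulrA -mulrDr [RHS]mulrCA; congr (_ * _).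
exact: trmM.
Qed.

Lemma mL1_sum (T : Type) (s : seq T) (F : T -> R -> R) : (forall t, mL1 (F t)) ->
  mL1 (fun x => \sum_(t <- s) F t x).
Proof.
move=> HF; elim: s => [|t s IH].
  under eq_fun do rewrite big_nil.
  exact/bmeas_mL1/bmeas_cst.
under eq_fun do rewrite big_cons.
exact: mL1D.
Qed.

Lemma fourier_sum (T : Type) (s : seq T) (F : T -> R -> R) k : (forall t, mL1 (F t)) ->
  fourier (fun x => \sum_(t <- s) F t x) k = \sum_(t <- s) fourier (F t) k.
Proof.
move=> HF; apply: dotc_inj => z; rewrite dotc_sumr dotc_fourier; last exact: mL1_sum.
have -> : intI (fun x => (\sum_(t <- s) F t x) * trm z k x) =
    \sum_(t <- s) intI (fun x => F t x * trm z k x).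
  rewrite -intI_sum => [|t]; last exact: mL1_trm.
  by apply: eq_intI => x _; rewrite mulr_suml.
by rewrite mulr_sumr; apply: eq_bigr => t _; rewrite dotc_fourier.
Qed.

(** Each real monomial shifts the spectrum both ways with weight 1/2; the hermitian symmetry and the
    substitution j -> -j identify the two halves. *)
Lemma fourierM_tpoly h a N k : mL1 h -> (forall j, a (- j) = conjc (a j)) ->
  fourier (fun x => h x * tpoly a N x) k = \sum_(j <- zwin N) a j * fourier h (k - j).
Proof.
move=> lh aH; rewrite (_ : (fun x => _) = (fun x => \sum_(j <- zwin N) h x * trm (a j) j x)).
  2: by apply/funext => x; rewrite mulr_sumr.
rewrite fourier_sum => [|j]; last by apply: mL1_bmeasM => //; exact: trm_bmeas.
under eq_bigr do rewrite fourierM_trm// -aH.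
rewrite -mulr_sumr big_split/=.
have -> : \sum_(j <- zwin N) a (- j) * fourier h (k + j) =
    \sum_(j <- zwin N) a j * fourier h (k - j).
  rewrite -[RHS]zwin_opp; apply: eq_bigr => j _; by rewrite opprK.
by rewrite mulrDr -mulrDl -rmorphD (_ : 2^-1 + 2^-1 = 1) ?rmorph1 ?mul1r//; lra.
Qed.

Lemma fourier_cst1 k : fourier (fun=> 1 : R) k = (k == 0)%:R.
Proof.
have b1 := bmeas_mL1 (bmeas_cst (1 : R)).
apply: dotc_inj => z; rewrite dotc_fourier//.
have [->|k0] := eqVneq k 0.
  rewrite (_ : (fun x => _) = (fun=> complex.Re z)); last first.
    by apply/funext => x; rewrite mul1r /trm mul0r cos0 sin0 mulr1 mulr0 subr0.
  by rewrite intI_cst mulKf ?twopi_neq0// /dotc /= mulr1 mulr0 addr0.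
(* [w] is z / (ik), so [trm z k] is the derivative of the periodic [trm w k] and has integral
   zero. *)
pose w : R[i] := Complex 0 (- (k%:~R)^-1) * z.
have [cw dw] := trm_C1p w k.
have kn : (k%:~R : R) != 0 by rewrite intr_eq0.
have wz : mulik k w = z.
  by rewrite /w; case: (z) => p q; rewrite /mulik /=; congr Complex; field.
have c1 : C1p (fun=> 1 : R) /\ derive1 (fun=> 1 : R) = (fun=> 0).
  have d0 x : is_derive x 1 (fun=> 1 : R) (0 : R) by exact: is_derive_cst.
  by apply: is_derive_C1p => //; exact: cst_continuous.
have := intI_parts c1.1 cw; rewrite dw c1.2 wz => ->.
rewrite (_ : (fun x => 0 * _) = (fun=> 0)); last by apply/funext => x; rewrite mul0r.
by rewrite intI_cst mulr0 oppr0 mulr0 /dotc /= !mulr0 addr0.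
Qed.

Lemma fourier_tpoly a N k : (forall j, a (- j) = conjc (a j)) ->
  fourier (tpoly a N) k = if (`|k| <= N)%N then a k else 0.
Proof.
move=> aH; have b1 := bmeas_mL1 (bmeas_cst (1 : R)).
have -> : tpoly a N = (fun x => 1 * tpoly a N x) by apply/funext => x; rewrite mul1r.
rewrite fourierM_tpoly//; under eq_bigr do rewrite fourier_cst1 subr_eq0 mulr_natr mulrb.
case: ifPn => kN.
  rewrite (bigD1_seq k) ?mem_zwin ?zwin_uniq//= eqxx big1 ?addr0// => j jk.
  by rewrite eq_sym (negbTE jk).
rewrite big_seq big1// => j; rewrite mem_zwin => jN.
by case: eqP => // kj; rewrite kj jN in kN.
Qed.

Lemma intI_tpoly h a N : mL1 h -> intI (fun x => h x * tpoly a N x) =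
  2 * pi * \sum_(k <- zwin N) dotc (a k) (fourier h k).
Proof.
move=> lh; rewrite mulr_sumr; under eq_bigr do rewrite -intI_trm//.
rewrite -intI_sum => [|k]; last exact: mL1_trm.
by apply: eq_intI => x _; rewrite mulr_sumr.
Qed.

Lemma Parseval_tpoly a N : (forall j, a (- j) = conjc (a j)) ->
  intI (fun x => tpoly a N x ^+ 2) = 2 * pi * \sum_(k <- zwin N) nsq (a k).
Proof.
move=> aH; under eq_fun do rewrite expr2.
rewrite intI_tpoly; last exact/bmeas_mL1/tpoly_bmeas.
congr (_ * _); rewrite big_seq [RHS]big_seq; apply: eq_bigr => k.
by rewrite mem_zwin fourier_tpoly// => ->; rewrite dotcc.
Qed.

End Coef.

(** * Absolutely convergent Fourier series *)

Section Phi.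
Context {R : realType}.
Local Notation nc := (@ComplexField.Normc.normc R).
Implicit Types (f g h : R -> R) (z : R[i]) (k j : int) (x M : R) (a b c : int -> R[i]).

Definition asum a : Prop := zsummable (fun k => nc (a k)).
Definition anorm a : R := zsum (fun k => nc (a k)).
Definition atail a N : R := anorm a - \sum_(k <- zwin N) nc (a k).
Definition phi a x : R := zsum (fun k => trm (a k) k x).
Definition hermitian a := forall k, a (- k) = conjc (a k).

Lemma phi_tail a N x : asum a -> `|phi a x - tpoly a N x| <= atail a N.
Proof. by move=> sa; apply: zsum_tail => // k; exact: norm_trm. Qed.

Lemma atail_cvg a : asum a -> atail a @ \oo --> (0 : R).
Proof. exact: zsum_tail_cvg. Qed.

Lemma anorm_ge0 a : asum a -> 0 <= anorm a.
Proof. by move=> sa; apply: zsum_ge0 => // k; exact: nc_ge0. Qed.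

Lemma trm_summable a x : asum a -> zsummable (fun k => trm (a k) k x).
Proof. by apply: zsummable_le => k; exact: norm_trm. Qed.

Lemma norm_phi a x : asum a -> `|phi a x| <= anorm a.
Proof.
move=> sa; apply: le_trans (ler_norm_zsum (trm_summable x sa)) _.
apply: ler_zsum => // [|k]; last exact: norm_trm.
exact/zsummable_norm/trm_summable.
Qed.

Lemma norm_tpoly a N x : asum a -> `|tpoly a N x| <= anorm a.
Proof.
move=> sa; apply: le_trans (ler_norm_sum _ _ _) _.
apply: (@le_trans _ _ (\sum_(k <- zwin N) nc (a k))).
  by apply: ler_sum => k _; exact: norm_trm.
by apply: zwin_le_zsum => // k; exact: nc_ge0.
Qed.

Lemma phi_periodic a : Defs.periodic (phi a).
Proof. by move=> x; congr zsum; apply/funext => k; exact: trm_periodic. Qed.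

Lemma phi_bmeas a : asum a -> bmeas (phi a).
Proof.
move=> sa; split; last by exists (anorm a) => x; exact: norm_phi.
apply: (@measurable_fun_cvg _ _ _ _ (tpoly a)) => [N|x _]; first by have [] := tpoly_bmeas a N.
exact/cvg_zsum/trm_summable.
Qed.

Lemma phiD a b x : asum a -> asum b -> phi (fun k => a k + b k) x = phi a x + phi b x.
Proof.
move=> sa sb; rewrite /phi -zsumD; [|exact: trm_summable|exact: trm_summable].
by congr zsum; apply/funext => k; rewrite trmD.
Qed.

Lemma phiZ M a x : asum a -> phi (fun k => real_complex R M * a k) x = M * phi a x.
Proof.
move=> sa; rewrite /phi -zsumZ; last exact: trm_summable.
congr zsum; apply/funext => k; case: (a k) => p q; rewrite /trm /=; ring.
Qed.

Lemma bmeas_phiB a N : asum a -> bmeas (fun x => phi a x - tpoly a N x).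
Proof. by move=> sa; apply: bmeasB; [exact: phi_bmeas|exact: tpoly_bmeas]. Qed.

(** The convolution theorem in truncated form, with an error uniform in [k]. Taking h constant gives
    Fourier inversion, taking h = phi b the product estimates. *)
Lemma fourierM_phi h a N k : mL1 h -> hermitian a -> asum a ->
  nc (fourier (fun x => h x * phi a x) k - \sum_(j <- zwin N) a j * fourier h (k - j))
  <= atail a N * ((2 * pi)^-1 * intI (fun x => `|h x|)).
Proof.
move=> lh aH sa; have [mh l1] := lh; rewrite -fourierM_tpoly//.
rewrite -fourierB; [|apply: mL1_bmeasM => //; exact: phi_bmeas
  |apply: mL1_bmeasM => //; exact: tpoly_bmeas].
have -> : (fun x => h x * phi a x - h x * tpoly a N x) =
    (fun x => h x * (phi a x - tpoly a N x)) by apply/funext => x; rewrite mulrBr.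
have lp := mL1_bmeasM lh (bmeas_phiB N sa).
apply: le_trans (nc_fourier_le k lp) _; rewrite mulrCA ler_pM2l ?invr_gt0 ?twopi_gt0//.
rewrite -intIZ; last exact: L1I_norm.
apply: le_intI => [||x _].
- by apply: L1I_norm; case: lp.
- exact/L1IZ/L1I_norm.
- by rewrite normrM mulrC ler_wpM2r// phi_tail.
Qed.

Lemma fourier_phi a k : hermitian a -> asum a -> fourier (phi a) k = a k.
Proof.
move=> aH sa; have b1 := bmeas_mL1 (bmeas_cst (1 : R)).
apply/eqP; rewrite -subr_eq0; apply/eqP.
apply: ComplexField.Normc.eq0_normc; apply/eqP; rewrite eq_le nc_ge0 andbT.
have c0 : (fun N => atail a N * ((2 * pi)^-1 * intI (fun x => `|1 : R|))) @ \oo --> (0 : R).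
  by rewrite -[X in _ --> X](mul0r ((2 * pi)^-1 * intI (fun x => `|1 : R|)));
    apply: cvgMl; exact: atail_cvg.
rewrite -(cvg_lim _ c0)//; apply: limr_ge; first by apply/cvg_ex; eexists; exact: c0.
(* Once the window contains k, the truncated coefficient no longer depends on N, while the error
   bound tends to zero. *)
exists (absz k) => // N /= kN; have := fourierM_phi N k b1 aH sa.
rewrite -fourierM_tpoly// (_ : (fun x => 1 * phi a x) = phi a); last first.
  by apply/funext => x; rewrite mul1r.
rewrite (_ : (fun x => 1 * tpoly a N x) = tpoly a N); last first.
  by apply/funext => x; rewrite mul1r.
by rewrite fourier_tpoly// kN.
Qed.

End Phi.

(** * The Riesz-Fischer theorem *)

Section RieszFischer.
Context {R : realType}.
Local Notation mu := (@lebesgue_measure R).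
Local Notation I := (@I R).
Implicit Types (f g h : R -> R) (c : int -> R[i]).

Lemma EFin_intI f : L1I f -> (\int[mu]_(x in I) (f x)%:E)%E = (intI f)%:E.
Proof. by move=> lf; rewrite /intI /Rintegral fineK//; exact: integrable_fin_num. Qed.

(** Cauchy-Schwarz against the constant 1 turns the rate 4^-j for the squares into 2^-j for the L^1
    norms of the increments. The sum of their moduli is then integrable, hence finite almost
    everywhere, and there the telescoping series converges absolutely. *)
Lemma L2_fast_Cauchy (u : nat -> R -> R) (C : R) : (forall n, L2I (u n)) ->
  (forall j, intI (fun x => (u j.+1 x - u j x) ^+ 2) <= C * 4^-1 ^+ j) ->
  {ae mu, forall x, I x -> cvgn (u^~ x)}.
Proof.
move=> lu uC; pose D j x := `|u j.+1 x - u j x|.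
have l2 j : L2I (fun x => u j.+1 x - u j x) by exact: L2IB.
have l2D j : L2I (D j).
  have [m s] := l2 j; split; first exact: measurableT_comp.
  by move: s; under eq_fun do rewrite -real_normK ?num_real//.
have C0 : 0 <= C.
  have := uC 0%N; rewrite expr0 mulr1; apply: le_trans.
  by apply: intI_ge0 => x _; exact: sqr_ge0.
pose K := Num.sqrt (2 * pi * C).
have DK j : intI (D j) <= K * 2^-1 ^+ j.
  have b1 := bmeas_L2 (bmeas_cst (1 : R)).
  have := intI_CauchySchwarz (l2D j) b1.
  have -> : intI (fun x => D j x * 1) = intI (D j).
    by apply: eq_intI => x _; rewrite mulr1.
  have -> : intI (fun x => D j x ^+ 2) = intI (fun x => (u j.+1 x - u j x) ^+ 2).
    by apply: eq_intI => x _; rewrite /D real_normK ?num_real.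
  rewrite expr1n intI_cst mulr1 => H.
  rewrite -ler_sqr ?nnegrE; last 2 first.
  - by apply: intI_ge0 => x _; exact: normr_ge0.
  - by rewrite mulr_ge0 ?sqrtr_ge0// exprn_ge0// invr_ge0.
  apply: le_trans H _; rewrite exprMn /K sqr_sqrtr; last first.
    by rewrite mulr_ge0// ltW// twopi_gt0.
  rewrite -exprM mulnC exprM (_ : 2^-1 ^+ 2 = 4^-1); last by rewrite expr2; lra.
  by rewrite mulrC -(mulrA (2 * pi)) ler_pM2l ?twopi_gt0.
have mD j : measurable_fun I (fun x => (D j x)%:E).
  by apply/measurable_EFinP/measurable_funTS; have [] := l2D j.
have D0 j x : I x -> (0 <= (D j x)%:E)%E by move=> _; rewrite lee_fin normr_ge0.
have GI : mu.-integrable I (fun x => \sum_(0 <= j <oo) (D j x)%:E)%E.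
  apply/integrableP; split.
    have := @ge0_emeasurable_sum _ _ _ I (fun j x => (D j x)%:E) xpredT.
    by apply => // j x Ix _; exact: D0.
  have -> : (\int[mu]_(x in I) `|\sum_(0 <= j <oo) (D j x)%:E| =
      \int[mu]_(x in I) \sum_(0 <= j <oo) (D j x)%:E)%E.
    by apply: eq_integral => x _; rewrite gee0_abs//; apply: nneseries_ge0 => j _ _; rewrite lee_fin normr_ge0.
  rewrite integral_nneseries//; apply: (@le_lt_trans _ _ (2 * K)%:E); last exact: ltry.
  apply: lime_le.
    by apply: is_cvg_nneseries => j _ _; apply: integral_ge0 => x; exact: D0.
  apply: nearW => n; rewrite (eq_bigr (fun j => (intI (D j))%:E)) => [|j _]; last first.
    by apply: EFin_intI; exact: L2I_L1.
  rewrite sumEFin lee_fin; apply: (@le_trans _ _ (\sum_(0 <= j < n) K * 2^-1 ^+ j)).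
    by apply: ler_sum => j _; exact: DK.
  by rewrite -mulr_sumr mulrC ler_wpM2r ?sqrtr_ge0// big_mkord sum_half_le2.
have := integrable_ae measurable_I GI; apply: filterS => x H Ix; have {H}Gx := H Ix.
have cD : cvgn (series (fun j => D j x)).
  apply: nondecreasing_is_cvgn.
    by apply/nondecreasing_seqP => n; rewrite /series /= big_nat_recr//= lerDl normr_ge0.
  exists (fine (\sum_(0 <= j <oo) (D j x)%:E)%E) => _ [n _ <-].
  rewrite -lee_fin fineK// /series /= -sumEFin.
  by apply: nneseries_lim_ge => j _ _; rewrite lee_fin normr_ge0.
have cs : cvgn (series (fun j => u j.+1 x - u j x)) by exact: normed_cvg.
have -> : u^~ x = (fun n => u 0%N x + series (fun j => u j.+1 x - u j x) n).
  by apply/funext => n; rewrite /series /= telescope_sumr// addrC subrK.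
by apply: is_cvgD => //; exact: is_cvg_cst.
Qed.

Section Tail.
Variable c : int -> R[i].
Hypotheses (cH : hermitian c) (cs : zsummable (fun k => nsq (c k))).
Let S N := \sum_(k <- zwin N) nsq (c k).
Let T N := zsum (fun k => nsq (c k)) - S N.

Let T0 N : 0 <= T N.
Proof. by rewrite subr_ge0; apply: zwin_le_zsum => // k; exact: nsq_ge0. Qed.

Let l2t N : L2I (tpoly c N). Proof. exact/bmeas_L2/tpoly_bmeas. Qed.

Let tpoly_diff_le N M : (M <= N)%N ->
  intI (fun x => (tpoly c N x - tpoly c M x) ^+ 2) = 2 * pi * (S N - S M).
Proof.
move=> MN; have lNM := L2I_mul (l2t N) (l2t M).
have [_ sN] := l2t N; have [_ sM] := l2t M.
have -> : intI (fun x => (tpoly c N x - tpoly c M x) ^+ 2) =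
   intI (fun x => tpoly c N x ^+ 2 + (tpoly c M x ^+ 2 + (- 2) * (tpoly c N x * tpoly c M x))).
  by apply: eq_intI => x _; ring.
rewrite !intID ?intIZ//; [|exact: L1IZ|by apply: L1ID => //; exact: L1IZ].
rewrite !Parseval_tpoly// intI_tpoly; last exact/L2_mL1.
have -> : \sum_(k <- zwin M) dotc (c k) (fourier (tpoly c N) k) = S M.
  rewrite big_seq /S [RHS]big_seq; apply: eq_bigr => k; rewrite mem_zwin => kM.
  by rewrite fourier_tpoly// (leq_trans kM MN) dotcc.
rewrite -/(S N) -/(S M); ring.
Qed.

(** Weaker than the identity above but symmetric, so that the two indices need not be ordered
    afterwards. *)
Let tpoly_diff N M : intI (fun x => (tpoly c N x - tpoly c M x) ^+ 2) <= 2 * pi * (T N + T M).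
Proof.
have tp0 := ltW (@twopi_gt0 R); have tN := T0 N; have tM := T0 M.
have [NM|MN] := leqP N M; last first.
  by rewrite tpoly_diff_le ?(ltnW MN)// ler_wpM2l//; move: tN tM; rewrite /T; lra.
have -> : intI (fun x => (tpoly c N x - tpoly c M x) ^+ 2) =
    intI (fun x => (tpoly c M x - tpoly c N x) ^+ 2).
  by apply: eq_intI => x _; ring.
by rewrite tpoly_diff_le// ler_wpM2l//; move: tN tM; rewrite /T; lra.
Qed.

Let T_cvg : T @ \oo --> (0 : R). Proof. exact: zsum_tail_cvg. Qed.

Let subseq_ex : exists n : nat -> nat, forall j, T (n j) <= 4^-1 ^+ j.
Proof.
have H j : exists N, T N <= 4^-1 ^+ j.
  have e0 : (0 : R) < 4^-1 ^+ j by rewrite exprn_gt0// invr_gt0.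
  have /cvgrPdist_le /(_ _ e0) [N _ /(_ N (leqnn N))] := T_cvg.
  by rewrite sub0r normrN ger0_norm//; exists N.
by have [n nP] := choice H; exists n.
Qed.

(** [g] is the limit of a rapidly convergent subsequence of the partial sums; Fatou's lemma then
    bounds its distance to every partial sum by the tail. *)
Theorem Riesz_Fischer : exists g, L2per g /\ forall N,
  intI (fun x => (g x - tpoly c N x) ^+ 2) <=
  2 * pi * (zsum (fun k => nsq (c k)) - \sum_(k <- zwin N) nsq (c k)).
Proof.
have tp0 := ltW (@twopi_gt0 R).
have [n nP] := subseq_ex; pose u j := tpoly c (n j).
have fast : {ae mu, forall x, I x -> cvgn (u^~ x)}.
  apply: (@L2_fast_Cauchy _ (2 * pi * 2)) => [j|j]; first exact: l2t.
  apply: le_trans (tpoly_diff _ _) _; rewrite -[leRHS]mulrA ler_wpM2l//.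
  have := nP j; have := nP j.+1; rewrite exprS.
  have : 0 <= (4^-1 : R) ^+ j by rewrite exprn_ge0// invr_ge0.
  lra.
(* The upper limit exists at every point, so [g] is measurable and periodic with no exceptional set;
   [fine] replaces infinite values by 0. *)
pose g x := fine (limn_esup (fun j => (u j x)%:E)).
have mu_ j : measurable_fun [set: R] (fun x => (u j x)%:E).
  by apply/measurable_EFinP; have [] := tpoly_bmeas c (n j).
have mg : measurable_fun [set: R] g.
  apply: measurableT_comp; first exact: fine_measurable.
  exact: measurable_fun_limn_esup.
have gl x : cvgn (u^~ x) -> u^~ x @ \oo --> g x.
  move=> cu; have H : (fun j => (u j x)%:E) @ \oo --> (limn (u^~ x))%:E.
    by apply: cvg_EFin => //; exact: nearW.
  by rewrite /g (cvg_limn_einf_sup H).2 /=.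
have key N : (\int[mu]_(x in I) ((g x - tpoly c N x) ^+ 2)%:E <= (2 * pi * T N)%:E)%E.
  pose F j x := ((u j x - tpoly c N x) ^+ 2)%:E.
  have mF j : measurable_fun I (F j).
    apply/measurable_EFinP/measurable_funTS/measurable_funX/measurable_funB.
      by have [] := tpoly_bmeas c (n j).
    by have [] := tpoly_bmeas c N.
  have F0 j x : I x -> (0 <= F j x)%E by move=> _; rewrite lee_fin sqr_ge0.
  apply: (@le_trans _ _ (\int[mu]_(x in I) limn_einf (F^~ x))%E).
    apply: ae_ge0_le_integral => //.
    - by move=> x _; rewrite lee_fin sqr_ge0.
    - apply/measurable_EFinP/measurable_funTS/measurable_funX/measurable_funB => //.
      by have [] := tpoly_bmeas c N.
    - move=> x Ix; rewrite limn_einf_lim; apply: lime_ge; first exact: is_cvg_einfs.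
      by apply: nearW => m; apply: le_ereal_inf_tmp => _ [k _ <-]; exact: F0.
    - rewrite /limn_einf; apply: measurableT_comp; first exact: oppe_measurable.
      apply: measurable_fun_limn_esup => j; apply: measurableT_comp; first exact: oppe_measurable.
      exact: mF.
    - move: fast; apply: filterS; first exact: (ae_filter_ringOfSetsType mu).
      move=> x H Ix; have {}H := gl _ (H Ix).
      have HF : F^~ x @ \oo --> ((g x - tpoly c N x) ^+ 2)%:E.
        apply: cvg_EFin; first exact: nearW.
        apply: cvgM; apply: cvgB => //; exact: cvg_cst.
      by rewrite (cvg_limn_einf_sup HF).1.
  apply: le_trans (fatou mu measurable_I mF F0) _.
  (* The lower limit is at most 2 pi T_N plus an arbitrary e: beyond any m there is a j whose tail
     is at most 4^-j <= e / (2 pi). *)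
  rewrite limn_einf_lim; apply: lime_le; first exact: is_cvg_einfs.
  apply: nearW => m; apply/lee_addgt0Pr => e e0.
  have e1 : 0 < e / (2 * pi) by rewrite divr_gt0// twopi_gt0.
  have q1 : `|4^-1 : R| < 1 by rewrite ger0_norm// invf_lt1// ltr1n.
  have /cvgrPdist_le /(_ _ e1) [k _ kP] := cvg_expr q1.
  pose j := maxn m k; apply: (@le_trans _ _ (\int[mu]_(x in I) F j x)%E).
    by apply: ereal_inf_lbound; exists j => //=; exact: leq_maxl.
  rewrite EFin_intI; last by have [] := L2IB (l2t (n j)) (l2t N).
  rewrite -EFinD lee_fin; apply: le_trans (tpoly_diff _ _) _.
  rewrite mulrDr addrC lerD2l mulrC -ler_pdivlMr ?twopi_gt0//.
  apply: le_trans (nP j) _; have := kP j (leq_maxr m k).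
  by rewrite sub0r normrN; apply: le_trans; exact: ler_norm.
have l2d N : L2I (fun x => g x - tpoly c N x).
  split; first by apply: measurable_funB => //; have [] := tpoly_bmeas c N.
  apply/integrableP; split.
    apply/measurable_EFinP/measurable_funTS/measurable_funX/measurable_funB => //.
    by have [] := tpoly_bmeas c N.
  apply: (@le_lt_trans _ _ (2 * pi * T N)%:E); last exact: ltry.
  apply: le_trans (key N); apply: ge0_le_integral => //.
  - apply: measurableT_comp => //; apply/measurable_EFinP/measurable_funTS/measurable_funX/measurable_funB => //.
    by have [] := tpoly_bmeas c N.
  - apply/measurable_EFinP/measurable_funTS/measurable_funX/measurable_funB => //.
    by have [] := tpoly_bmeas c N.
  - by move=> x _ /=; rewrite ger0_norm// sqr_ge0.
have lg : L2I g.
  have := L2ID (l2d 0%N) (l2t 0%N); congr L2I; apply/funext => x; exact: subrK.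
exists g; split.
  split; [|by case: lg|by case: lg].
  move=> x; rewrite /g; congr (fine (limn_esup _)); apply/funext => j.
  by rewrite /u tpoly_periodic.
move=> N; rewrite -lee_fin -EFin_intI; first exact: key.
by have [] := l2d N.
Qed.

End Tail.
End RieszFischer.

(** * Vanishing of a function with zero Fourier coefficients *)

Section Uniqueness.
Context {R : realType}.
Local Notation mu := (@lebesgue_measure R).
Local Notation I := (@I R).
Implicit Types (f g h : R -> R) (z : R[i]).

Lemma intI_dominated (F : nat -> R -> R) f g :
  (forall n, measurable_fun [set: R] (F n)) -> measurable_fun [set: R] f -> L1I g ->
  (forall x, I x -> F^~ x @ \oo --> f x) -> (forall n x, `|F n x| <= g x) ->
  (fun n => intI (F n)) @ \oo --> intI f.
Proof.
move=> mF mf lg Ff Fg.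
have mF' n : measurable_fun I (fun x => (F n x)%:E).
  by apply/measurable_EFinP/measurable_funTS; exact: mF.
have mf' : measurable_fun I (EFin \o f).
  by apply/measurable_EFinP/measurable_funTS; exact: mf.
have cv : {ae mu, forall x, I x -> (fun n => (F n x)%:E) @ \oo --> (EFin \o f) x}.
  by apply: aeW => x Ix; apply: cvg_EFin; [exact: nearW|exact: Ff].
have dom : {ae mu, forall x n, I x -> (`|(F n x)%:E| <= (EFin \o g) x)%E}.
  by apply: aeW => x n _; rewrite lee_fin.
have [lf _ H] := dominated_convergence measurable_I mF' mf' cv lg dom.
by apply: fine_cvg; rewrite -/(intI f) -EFin_intI.
Qed.

(* Smoothstep iterates: the two outer fixed points 0 and 1 attract [0, 1/2[ and
   ]1/2, 1], so that they approximate the indicator of ]1/2, 1]. *)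
Definition smoothstep (y : R) : R := 3 * y ^+ 2 - 2 * y ^+ 3.

Lemma smoothstep01 y : 0 <= y <= 1 -> 0 <= smoothstep y <= 1.
Proof.
move=> /andP[y0 y1]; rewrite /smoothstep; apply/andP; split.
  rewrite (_ : _ - _ = y ^+ 2 * (3 - 2 * y)); last by ring.
  by rewrite mulr_ge0 ?sqr_ge0//; lra.
rewrite -subr_ge0 (_ : _ - _ = (1 - y) ^+ 2 * (1 + 2 * y)); last by ring.
by rewrite mulr_ge0 ?sqr_ge0//; lra.
Qed.

Lemma iter_smoothstep01 n y : 0 <= y <= 1 -> 0 <= iter n smoothstep y <= 1.
Proof. by move=> y01; elim: n => //= n IH; exact: smoothstep01. Qed.

(** One step multiplies u by u (3 - 2 u), which on [0, y] is at most its value q < 1 at y; the decay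
    is therefore geometric. *)
Lemma iter_smoothstep_lt y : 0 <= y < 2^-1 ->
  (fun n => iter n smoothstep y) @ \oo --> (0 : R).
Proof.
move=> /andP[y0 y1]; pose q := y * (3 - 2 * y).
have q0 : 0 <= q by rewrite /q mulr_ge0//; lra.
have q1 : q < 1 by rewrite /q; nra.
have H n : 0 <= iter n smoothstep y <= y * q ^+ n.
  elim: n => [|n /andP[h0 h1]] /=; first by rewrite expr0 mulr1 y0 lexx.
  set u := iter n smoothstep y in h0 h1 *.
  have qn : q ^+ n <= 1 by rewrite exprn_ile1// ltW.
  have qn0 : 0 <= q ^+ n by rewrite exprn_ge0.
  have uy : u <= y by apply: le_trans h1 _; rewrite ler_piMr.
  have -> : smoothstep u = u * (u * (3 - 2 * u)) by rewrite /smoothstep; ring.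
  have uq : u * (3 - 2 * u) <= q by rewrite /q; nra.
  have u30 : 0 <= u * (3 - 2 * u) by rewrite mulr_ge0//; lra.
  by rewrite mulr_ge0//= exprSr [leRHS]mulrA ler_pM.
apply: (@squeeze_cvgr _ _ _ _ (cst 0) (fun n => y * q ^+ n)).
- by apply: nearW => n; exact: H.
- exact: cvg_cst.
- by rewrite -[X in _ --> X](mulr0 y); apply: cvgMr; apply: cvg_expr; rewrite ger0_norm.
Qed.

Lemma smoothstep_sym y : smoothstep (1 - y) = 1 - smoothstep y.
Proof. by rewrite /smoothstep; ring. Qed.

Lemma iter_smoothstep_sym n y : iter n smoothstep (1 - y) = 1 - iter n smoothstep y.
Proof. by elim: n => //= n ->; rewrite smoothstep_sym. Qed.

(** The symmetry y -> 1 - y exchanges the two attracting fixed points. *)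
Lemma iter_smoothstep_gt y : 2^-1 < y <= 1 ->
  (fun n => iter n smoothstep y) @ \oo --> (1 : R).
Proof.
move=> /andP[y0 y1]; have h : 0 <= 1 - y < 2^-1 by apply/andP; split; lra.
have -> : (fun n => iter n smoothstep y) = (fun n => 1 - iter n smoothstep (1 - y)).
  by apply/funext => n; rewrite iter_smoothstep_sym subKr.
rewrite -[X in _ --> X](subr0 1); apply: cvgB; first exact: cvg_cst.
exact: iter_smoothstep_lt.
Qed.

Section ZeroCoef.
Variable f : R -> R.
Hypotheses (lf : mL1 f) (f0 : forall k, fourier f k = 0).

Let trm0 z k : intI (fun x => f x * trm z k x) = 0.
Proof. by rewrite intI_trm// f0 /dotc /= !mulr0 addr0 mulr0. Qed.

Let poly_cos_bmeas (p : {poly R}) c : bmeas (fun x => p.[cos (x - c)]).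
Proof.
elim/poly_ind: p => [|p d IH].
  have -> : (fun x => (0 : {poly R}).[cos (x - c)]) = (fun=> 0).
    by apply/funext => x; rewrite horner0.
  exact: bmeas_cst.
have -> : (fun x => (p * 'X + d%:P).[cos (x - c)]) =
    (fun x => p.[cos (x - c)] * cos (x - c) + d).
  by apply/funext => x; rewrite hornerMXaddC.
apply: bmeasD; last exact: bmeas_cst.
apply: bmeasM => //.
have -> : (fun x => cos (x - c)) = trm (Complex (cos c) (- sin c)) 1.
  by apply/funext => x; rewrite /trm /= mul1r cosB; ring.
exact: trm_bmeas.
Qed.

(** Multiplication by cos (x - c) moves the frequency by one in both directions, so the vanishing of
    all coefficients is preserved. *)
Let poly_cos0 (p : {poly R}) c z k :
  intI (fun x => f x * p.[cos (x - c)] * trm z k x) = 0.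
Proof.
elim/poly_ind: p z k => [|p d IH] z k.
  rewrite (_ : (fun x => _) = (fun=> 0)) ?intI_cst ?mulr0//.
  by apply/funext => x; rewrite horner0 mulr0 mul0r.
pose w : R[i] := Complex (cos c) (- sin c).
have lp z' k' : L1I (fun x => f x * p.[cos (x - c)] * trm z' k' x).
  exact/mL1_trm/mL1_bmeasM.
have -> : intI (fun x => f x * (p * 'X + d%:P).[cos (x - c)] * trm z k x) =
  intI (fun x => 2^-1 * (f x * p.[cos (x - c)] * trm (conjc w * z) (k - 1) x +
     f x * p.[cos (x - c)] * trm (w * z) (k + 1) x) + d * (f x * trm z k x)).
  apply: eq_intI => x _; rewrite hornerMXaddC.
  transitivity (f x * p.[cos (x - c)] * (trm w 1 x * trm z k x) + d * (f x * trm z k x)).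
    have -> : cos (x - c) = trm w 1 x by rewrite /w /trm /= mul1r cosB; ring.
    ring.
  rewrite trmM; set A := trm _ (k - 1) x; set B := trm _ (k + 1) x. ring.
have l1 := L1ID (lp (conjc w * z) (k - 1)) (lp (w * z) (k + 1)).
rewrite intID ?intIZ ?intID ?IH ?trm0//; first by rewrite addr0 !mulr0 addr0.
- exact: mL1_trm.
- exact: L1IZ.
- exact/L1IZ/mL1_trm.
Qed.

(** For e in [-1, 1] this sends [-1, 1] into [0, 1] and the threshold e to 1/2, the repelling fixed
    point of [smoothstep]. *)
Let affine (e : R) : {poly R} := (4^-1)%:P * 'X + (2^-1 - e / 4)%:P.
Let smooth_poly e n : {poly R} := iter n (fun p => 3%:P * p ^+ 2 - 2%:P * p ^+ 3) (affine e).

Let smooth_polyE e n y : (smooth_poly e n).[y] = iter n smoothstep (2^-1 + (y - e) / 4).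
Proof.
rewrite /smooth_poly; elim: n => [|n IH] /=; first by rewrite /affine hornerMXaddC hornerC; field.
by rewrite hornerD hornerN !hornerM !hornerC IH /smoothstep; ring.
Qed.

(** Limit of the iterates: at y = cos (x - c) it is the indicator of an arc centred at c, with the
    value 1/2 at the ends of the arc, where the iteration stays put. *)
Let arc (e y : R) : R := if e < y then 1 else if y < e then 0 else 2^-1.

Let smooth_arc e y : -1 <= e <= 1 -> -1 <= y <= 1 ->
  (fun n => (smooth_poly e n).[y]) @ \oo --> arc e y.
Proof.
move=> /andP[e0 e1] /andP[y0 y1]; under eq_fun do rewrite smooth_polyE.
rewrite /arc; case: ltgtP => [ey|ey|<-].
- by apply: iter_smoothstep_gt; apply/andP; split; lra.
- by apply: iter_smoothstep_lt; apply/andP; split; lra.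
- rewrite subrr mul0r addr0; under eq_fun => n.
    have -> : iter n smoothstep (2^-1 : R) = 2^-1.
      by elim: n => //= n ->; rewrite /smoothstep; field.
    over.
  exact: cvg_cst.
Qed.

Let arc_meas e c : -1 <= e <= 1 -> measurable_fun [set: R] (fun x => arc e (cos (x - c))).
Proof.
move=> ee; pose h n x := (smooth_poly e n).[cos (x - c)].
apply: (@measurable_fun_cvg _ _ _ _ h).
  by move=> n; have [] := poly_cos_bmeas (smooth_poly e n) c.
by move=> x _; apply: smooth_arc; rewrite ?cos_geN1 ?cos_le1.
Qed.

Let arc0 e c : -1 <= e <= 1 -> intI (fun x => f x * arc e (cos (x - c))) = 0.
Proof.
move=> ee; have [mf l1] := lf.
have cc x : -1 <= (cos (x - c) : R) <= 1 by rewrite cos_geN1 cos_le1.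
have mp n : measurable_fun [set: R] (fun x => f x * (smooth_poly e n).[cos (x - c)]).
  by apply: measurable_funM => //; have [] := poly_cos_bmeas (smooth_poly e n) c.
have cvp x : (fun n => f x * (smooth_poly e n).[cos (x - c)]) @ \oo -->
    f x * arc e (cos (x - c)) by apply: cvgMr; exact: smooth_arc.
have m' : measurable_fun [set: R] (fun x => f x * arc e (cos (x - c))).
  by apply: measurable_funM => //; exact: arc_meas.
have bd n x : `|f x * (smooth_poly e n).[cos (x - c)]| <= `|f x|.
  have /andP[c0 c1] := cc x; have /andP[e0 e1] := ee.
  have h : 0 <= 2^-1 + (cos (x - c) - e) / 4 <= 1 by apply/andP; split; lra.
  have /andP[h0 h1] := iter_smoothstep01 n h.
  by rewrite normrM ler_piMr// smooth_polyE ger0_norm.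
have := intI_dominated mp m' (L1I_norm l1) (fun x _ => cvp x) bd.
move/cvg_lim => <- //; apply/cvg_lim => //.
rewrite (_ : (fun n => _) = (fun=> 0)); first exact: cvg_cst.
apply/funext => n; rewrite -(poly_cos0 (smooth_poly e n) c 1 0).
by apply: eq_intI => x _; rewrite /trm /= mul0r cos0 sin0 mulr0 subr0 !mulr1.
Qed.

(** The interval from -pi to b is the arc with centre (b - pi) / 2 and half-width (b + pi) / 2. A
    point to the right of b may lie at a distance t > pi from the centre; its distance on the circle
    is then 2 pi - t. *)
Let cos_arc (b x : R) : - pi < b <= pi -> - pi < x < pi -> x != b ->
  arc (cos ((b + pi) / 2)) (cos (x - (b - pi) / 2)) = (x < b)%R%:R.
Proof.
move=> /andP[b1 b2] /andP[x1 x2] xb; have p0 := pi_gt0 R.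
set d := (b + pi) / 2; set t := x - (b - pi) / 2.
have d1 : 0 < d by rewrite /d; lra.
have d2 : d <= pi by rewrite /d; lra.
have dI : d \in `[0, pi] by rewrite in_itv/= (ltW d1).
have lt_cos u : 0 <= u -> u <= pi -> (cos d < cos u) = (u < d) /\ (cos u < cos d) = (d < u).
  move=> u0 u1; have uI : u \in `[0, pi] by rewrite in_itv/= u0.
  by rewrite !ltr_cos.
rewrite /arc; have [xlt|xge] := ltP x b.
  have -> : cos t = cos `|t| by rewrite cos_norm.
  have tn : `|t| < d by rewrite ltr_norml; apply/andP; split; rewrite /t /d; lra.
  have [-> _] := lt_cos `|t| (normr_ge0 _) (le_trans (ltW tn) d2).
  by rewrite tn.
have {xge xb}xgt : b < x by rewrite lt_neqAle eq_sym xb.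
have t0 : 0 <= t by rewrite /t; lra.
have [tpi|tpi] := leP t pi.
  have [-> ->] := lt_cos t t0 tpi; have dt : d < t by rewrite /t /d; lra.
  by rewrite dt ltNge (ltW dt).
have -> : cos t = cos (2 * pi - t).
  have -> : 2 * pi - t = - (t - pi *+ 2) by rewrite -mulr_natl; ring.
  by rewrite cosN -[in LHS](subrK (pi *+ 2) t) cosD2pi.
have [] := lt_cos (2 * pi - t); [rewrite /t; lra|lra|move=> -> ->].
have dt : d < 2 * pi - t by rewrite /t /d; lra.
by rewrite dt ltNge (ltW dt).
Qed.

(** By [arc0] the integrals of f from -pi to b vanish for all b, so its primitive is zero, and
    Lebesgue differentiation gives f = 0 almost everywhere. *)
Lemma fourier_eq0_ae : eqI f (fun=> 0).
Proof.
have [mf l1] := lf; have p0 := pi_gt0 R.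
have ne (a : R) : {ae mu, forall x : R, x != a}.
  exists [set a]; split; [exact: measurable_set1|exact: lebesgue_measure_set1|].
  by move=> x /= /negP; rewrite negbK => /eqP.
have FF := ae_filter_ringOfSetsType mu.
have mI : measurable_fun [set: R] (f \_ I).
  exact: (measurable_restrictT _ measurable_I).1 (measurable_funTS mf).
have L1T : mu.-integrable [set: R] (EFin \o (f \_ I)).
  rewrite -restrict_EFin; apply: (integrable_mkcond _ measurable_I).1.
  exact: l1.
have F0 b : - pi < b <= pi -> \int[mu]_(x in `]-oo, b]) ((f \_ I) x) = 0.
  move=> bb; have e0 : -1 <= (cos ((b + pi) / 2) : R) <= 1 by rewrite cos_geN1 cos_le1.
  rewrite -(arc0 ((b - pi) / 2) e0) /intI [RHS]Rintegral_mkcond [LHS]Rintegral_mkcond.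
  rewrite /Rintegral; congr fine; apply: ae_eq_integral => //.
  - apply/measurable_EFinP; apply: (measurable_restrictT _ _).1 => //.
    exact: measurable_funTS.
  - apply/measurable_EFinP; apply: (measurable_restrictT _ measurable_I).1.
    by apply: measurable_funTS; apply: measurable_funM => //; exact: arc_meas.
  (* The points -pi, pi and b, at which [cos_arc] says nothing, form a null set. *)
  - near=> x => _; congr EFin.
    have x1 : x != - pi by near: x; exact: ne.
    have x2 : x != pi by near: x; exact: ne.
    have x3 : x != b by near: x; exact: ne.
    rewrite !patchE; have [xI|xI] := boolP (x \in I); last first.
      by rewrite if_same.
    have /andP[xl xr] : - pi < x < pi.
      move: xI; rewrite inE /Defs.I /= in_itv/= !le_eqVlt eq_sym (negbTE x1) (negbTE x2).
      by [].
    rewrite cos_arc ?xl//; have [xb|xb] := ltP x b.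
      by rewrite mem_set ?mulr1//= in_itv/= ltW.
    rewrite memNset ?mulr0//= in_itv/= leNgt lt_neqAle xb andbT eq_sym.
    by rewrite x3.
have ly y : mu.-integrable `]-oo, y] (EFin \o (f \_ I)).
  exact: integrableS L1T.
have H := FTC1Ny ly (integrable_locally measurable_I l1).
near=> x => Ix.
have x1 : x != - pi by near: x; exact: ne.
have x2 : x != pi by near: x; exact: ne.
have [_ dF] : derivable (fun y : R => \int[mu]_(t in `]-oo, y]) ((f \_ I) t)) x 1 /\
    derive1 (fun y : R => \int[mu]_(t in `]-oo, y]) ((f \_ I) t)) x = (f \_ I) x.
  by near: x; exact: H.
have /andP[xl xr] : - pi < x < pi.
  move: (Ix); rewrite /Defs.I /= in_itv/= !le_eqVlt eq_sym (negbTE x1) (negbTE x2).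
  by [].
move: dF; rewrite patchE mem_set// => <-; rewrite derive1E.
have E : {near x, (fun=> 0) =1 (fun y : R => \int[mu]_(t in `]-oo, y]) ((f \_ I) t))}.
  near=> y; rewrite F0//; apply/andP; split; last apply: ltW.
    by near: y; exact: lt_nbhsr.
  by near: y; exact: lt_nbhsl.
rewrite -(@near_eq_derive R R R _ _ _ 1 E).
exact: derive_cst.
Unshelve. all: by end_near.
Qed.

End ZeroCoef.
End Uniqueness.

(** * The Wiener norm and the algebra property *)

Section Algebra.
Context {R : realType}.
Local Notation nc := (@ComplexField.Normc.normc R).
Implicit Types (k j : int) (r : R).

Lemma absz_norm k : `|k%:~R : R| = (absz k)%:R.
Proof. by rewrite -intr_norm -abszE. Qed.

Lemma wt_ge r k : 1 <= r -> 1 + `|k%:~R : R| ^+ 2 <= wt r k.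
Proof.
move=> r1; rewrite /wt -[leLHS]powRr1 ?addr_ge0 ?sqr_ge0//.
by apply: ler_powR => //; rewrite lerDl sqr_ge0.
Qed.

Lemma sum_zwin_nat (F : nat -> R) N :
  \sum_(k <- zwin N) F (absz k) = F 0%N + 2 * \sum_(n < N) F n.+1.
Proof.
elim: N => [|N IH]; first by rewrite zwin0 big_ord0 mulr0 addr0.
rewrite zwinS IH big_ord_recr /= mulrDr; ring.
Qed.

(** Discrete form of the fact that (1 - e) / ((1 + x)(1 + e x)) is the derivative of ln ((1 + x) /
    (1 + e x)). The quotient of consecutive arguments is 1 + z; the constant 4 combines 1 - e >= 1/2
    with ln (1 + z) >= z / 2. *)
Lemma log_step (e : R) (n : nat) : 0 < e <= 2^-1 ->
  ((1 + n.+1%:R) * (1 + e * n.+1%:R))^-1 <=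
  4 * (ln ((1 + n.+1%:R) / (1 + e * n.+1%:R)) - ln ((1 + n%:R) / (1 + e * n%:R))).
Proof.
move=> /andP[e0 e1]; have n0 : 0 <= n%:R :> R by exact: ler0n.
rewrite -natr1; set m : R := n%:R in n0 *.
have em0 : 0 <= e * m by rewrite mulr_ge0// ltW.
have em : 0 < 1 + e * m by lra.
have em' : 0 < 1 + e * (m + 1) by rewrite mulrDr mulr1; lra.
pose z := (1 - e) / ((m + 1) * (1 + e * (m + 1))).
have D0 : 0 < (m + 1) * (1 + e * (m + 1)) by rewrite mulr_gt0//; lra.
have z0 : 0 < z by rewrite divr_gt0//; lra.
have z1 : z <= 1.
  rewrite ler_pdivrMr// mul1r; have : 0 <= m * (e * (m + 1)).
    by rewrite mulr_ge0// mulr_ge0//; lra.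
  nra.
have -> : ln ((1 + (m + 1)) / (1 + e * (m + 1))) - ln ((1 + m) / (1 + e * m)) = ln (1 + z).
  rewrite -ln_div ?posrE ?divr_gt0//; try lra.
  congr ln; rewrite /z; field.
  by rewrite !lt0r_neq0//; lra.
(* exp (z / 2) <= 1 / (1 - z / 2) <= 1 + z, the second inequality because z <= 1. *)
have lz : z / 2 <= ln (1 + z).
  rewrite -ler_expR lnK ?posrE; last by lra.
  have := expR_ge1Dx (- (z / 2)); rewrite expRN => h.
  have p2 : 0 < 1 - z / 2 by lra.
  have : expR (z / 2) <= (1 - z / 2)^-1.
    by rewrite -[leLHS]invrK lef_pV2 ?posrE ?invr_gt0 ?expR_gt0.
  move=> /le_trans; apply; rewrite -[leLHS]mul1r ler_pdivrMr//; nra.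
have q0 : 0 <= ((m + 1) * (1 + e * (m + 1)))^-1 by rewrite invr_ge0 ltW.
apply: (@le_trans _ _ ((m + 1) * (1 + e * (m + 1)))^-1).
  have D1 : 0 < (1 + (m + 1)) * (1 + e * (m + 1)) by rewrite mulr_gt0//; lra.
  by rewrite lef_pV2 ?posrE// ler_pM2r//; lra.
apply: (@le_trans _ _ (2 * z)); last by lra.
rewrite /z mulrA ler_peMl//; lra.
Qed.

(** Equal to (1 + |k|) + e |k| (1 + |k|): the H^(1/2) weight plus e times at most twice the H^1
    weight. Its inverse has a sum of order ln (1 / e). *)
Definition bgw (e : R) k : R := (1 + (absz k)%:R) * (1 + e * (absz k)%:R).

Lemma bgw_gt0 e k : 0 <= e -> 0 < bgw e k.
Proof.
move=> e0; have n0 : 0 <= (absz k)%:R :> R by exact: ler0n.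
by rewrite mulr_gt0 ?ltr_wpDr// mulr_ge0.
Qed.

(** The factor 8 is the 4 of [log_step] once for each sign of k; the telescoped logarithm stays
    below ln (1 / e) because (1 + N) / (1 + e N) <= 1 / e. *)
Lemma sum_bgw (e : R) N : 0 < e <= 2^-1 ->
  \sum_(k <- zwin N) (bgw e k)^-1 <= 1 + 8 * ln e^-1.
Proof.
move=> ee; have /andP[e0 e1] := ee.
rewrite (sum_zwin_nat (fun n => ((1 + n%:R) * (1 + e * n%:R))^-1)).
rewrite mulr0 !addr0 mulr1 invr1 lerD2l.
pose l n := ln ((1 + n%:R) / (1 + e * n%:R)) : R.
have S : \sum_(n < N) ((1 + n.+1%:R) * (1 + e * n.+1%:R))^-1 <= 4 * (l N - l 0%N).
  apply: (@le_trans _ _ (\sum_(n < N) 4 * (l n.+1 - l n))).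
    by apply: ler_sum => n _; exact: log_step.
  rewrite -mulr_sumr -(big_mkord xpredT (fun n => l n.+1 - l n)) telescope_sumr//.
have l0 : l 0%N = 0 by rewrite /l mulr0 !addr0 divr1 ln1.
have lN : l N <= ln e^-1.
  have n0 : 0 <= N%:R :> R by exact: ler0n.
  have d0 : 0 < 1 + e * N%:R by rewrite ltr_wpDr// mulr_ge0// ltW.
  have a1 : 0 < (1 + N%:R) / (1 + e * N%:R) by rewrite divr_gt0//; lra.
  rewrite /l ler_ln ?posrE ?invr_gt0// ler_pdivrMr// -(ler_pM2l e0).
  rewrite (mulrA e e^-1) mulfV ?gt_eqF// mul1r mulrDr mulr1 lerD2r.
  by apply: le_trans e1 _; rewrite invf_le1// ler1n.
rewrite l0 subr0 in S; lra.
Qed.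

(* Brezis-Gallouet: one weighted Cauchy-Schwarz with the weight bgw, in which
   the parameter e balances the H^(1/2) and the H^r norms. *)
Lemma Brezis_Gallouet r (a : hseq r) (e M : R) N : 1 <= r -> 0 < e <= 2^-1 ->
  (forall N, \sum_(k <- zwin N) (1 + (absz k)%:R) * nsq (a k) <= M) ->
  (\sum_(k <- zwin N) nc (a k)) ^+ 2 <= (1 + 8 * ln e^-1) * (M + 2 * e * `|a| ^+ 2).
Proof.
move=> r1 ee aM; have /andP[e0 e1] := ee.
have w0 k : 0 < bgw e k by rewrite bgw_gt0// ltW.
have -> : \sum_(k <- zwin N) nc (a k) =
    \sum_(k <- zwin N) (bgw e k)^-1 * (bgw e k * nc (a k)).
  by apply: eq_bigr => k _; rewrite mulKf// gt_eqF.
apply: le_trans (CauchySchwarz_sum _ _ _) _; first by move=> k; rewrite invr_ge0 ltW.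
apply: ler_pM.
- by apply: sumr_ge0 => k _; rewrite invr_ge0 ltW.
- by apply: sumr_ge0 => k _; rewrite mulr_ge0 ?sqr_ge0// invr_ge0 ltW.
- exact: sum_bgw.
apply: (@le_trans _ _ (\sum_(k <- zwin N)
    ((1 + (absz k)%:R) * nsq (a k) + 2 * e * (wt r k * nsq (a k))))).
  apply: ler_sum => k _.
  have -> : (bgw e k)^-1 * (bgw e k * nc (a k)) ^+ 2 = bgw e k * nsq (a k).
    move: (bgw e k) (w0 k) => V V0.
    by rewrite exprMn nsq_normc (expr2 V) !mulrA mulVf ?mul1r// gt_eqF.
  rewrite !mulrA -mulrDl ler_wpM2r ?nsq_ge0//.
  have := wt_ge k r1; rewrite absz_norm /bgw; set n := (absz k)%:R => nw.
  have n0 : 0 <= n by exact: ler0n.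
  have : e * (n + n ^+ 2) <= e * (2 * wt r k).
    rewrite ler_wpM2l ?(ltW e0)//; have := sqr_ge0 (n - 1); nra.
  nra.
have e20 : 0 <= 2 * e by lra.
rewrite big_split /=; apply: lerD => //.
by rewrite -mulr_sumr ler_wpM2l// hseq_sum_le.
Qed.

Lemma half_weight_le r (a : hseq r) N : 1 <= r ->
  \sum_(k <- zwin N) (1 + (absz k)%:R) * nsq (a k) <= 2 * `|a| ^+ 2.
Proof.
move=> r1; apply: (@le_trans _ _ (2 * \sum_(k <- zwin N) wt r k * nsq (a k))).
  rewrite mulr_sumr; apply: ler_sum => k _; rewrite mulrA ler_wpM2r ?nsq_ge0//.
  have := wt_ge k r1; rewrite absz_norm; set n := (absz k)%:R => nw.
  have := sqr_ge0 (n - 1); nra.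
by rewrite ler_wpM2l// hseq_sum_le.
Qed.

(** Brezis-Gallouet at e = 1/2: [half_weight_le] allows M = 2 |a|^2, and 2 e |a|^2 adds one more
    |a|^2, whence the 3. *)
Definition wiener_cst : R := Num.sqrt (3 * (1 + 8 * ln 2)).

Lemma wiener_cst_ge0 : 0 <= wiener_cst. Proof. exact: sqrtr_ge0. Qed.

Lemma sum_nc_le r (a : hseq r) N : 1 <= r ->
  \sum_(k <- zwin N) nc (a k) <= wiener_cst * `|a|.
Proof.
move=> r1; have h : 0 < (2^-1 : R) <= 2^-1 by apply/andP; split; lra.
have l2 : 0 <= ln 2 :> R by rewrite ln_ge0// ler1n.
have := Brezis_Gallouet N r1 h (fun N => half_weight_le a N r1).
rewrite invrK => H; rewrite -ler_sqr ?nnegrE ?mulr_ge0 ?wiener_cst_ge0//; last first.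
  by apply: sumr_ge0 => k _; exact: nc_ge0.
have c0 : 0 <= 3 * (1 + 8 * ln 2) :> R by lra.
apply: le_trans H _; rewrite exprMn /wiener_cst (sqr_sqrtr c0).
by rewrite le_eqVlt; apply/orP; left; apply/eqP; field.
Qed.

Lemma hseq_asum r (a : hseq r) : 1 <= r -> asum a.
Proof.
move=> r1; apply: (@zsummable_ge0 _ _ (wiener_cst * `|a|)) => [k|N].
  exact: nc_ge0.
exact: sum_nc_le.
Qed.

Lemma anorm_le r (a : hseq r) : 1 <= r -> anorm a <= wiener_cst * `|a|.
Proof.
by move=> r1; apply: zsum_le => [|N]; [exact: hseq_asum|exact: sum_nc_le].
Qed.

Lemma hseq_hermitian r (a : hseq r) : hermitian a. Proof. exact: coefN. Qed.

End Algebra.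

(** * Young's inequality and the tame product estimate *)

Section Product.
Context {R : realType}.
Local Notation nc := (@ComplexField.Normc.normc R).
Implicit Types (k j : int) (r : R).

Lemma sqr_wt r k : wt (r / 2) k ^+ 2 = wt r k.
Proof.
rewrite /wt -powR_mulrn ?powR_ge0// -powRrM; congr (_ `^ _).
by rewrite divfK.
Qed.

(** As k = j + (k - j), the base 1 + k^2 is at most 2 x + 2 y, hence at most 4 max (x, y); the power
    r preserves this, and a maximum is below the sum. *)
Lemma wt_split r k j : 0 <= r ->
  wt r k <= 4 `^ r * (wt r j + wt r (k - j)).
Proof.
move=> r0; rewrite /wt; set x := 1 + `|j%:~R| ^+ 2; set y := 1 + `|(k - j)%:~R| ^+ 2.
have x0 : 0 <= x by rewrite addr_ge0// sqr_ge0.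
have y0 : 0 <= y by rewrite addr_ge0// sqr_ge0.
have z0 : 0 <= 1 + `|k%:~R : R| ^+ 2 by rewrite addr_ge0// sqr_ge0.
have H : 1 + `|k%:~R : R| ^+ 2 <= 2 * x + 2 * y.
  rewrite /x /y !real_normK ?num_real// rmorphB /=.
  have := sqr_ge0 ((k%:~R : R) - 2 * j%:~R); nra.
have M0 : 0 <= Num.max x y by rewrite le_max x0.
apply: (@le_trans _ _ ((4 * Num.max x y) `^ r)).
  apply: ge0_ler_powR => //; rewrite ?nnegrE ?mulr_ge0//.
  apply: le_trans H _; have : x <= Num.max x y by rewrite le_max lexx.
  have : y <= Num.max x y by rewrite le_max lexx orbT.
  lra.
rewrite powRM// ler_wpM2l ?powR_ge0//.
by have [_|_] := leP x y; rewrite ?lerDl ?lerDr powR_ge0.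
Qed.

(** Cauchy-Schwarz with the summable factor as weight, then exchange of the sums. The shifted inner
    sum lies in a larger window, which is why the bounds are assumed for all windows. *)
Lemma Young_sum (p q : int -> R) (P Q : R) N K : (forall k, 0 <= p k) ->
  (forall k, 0 <= q k) ->
  (forall n, \sum_(k <- zwin n) p k <= P) ->
  (forall n, \sum_(k <- zwin n) q k ^+ 2 <= Q) ->
  \sum_(k <- zwin K) (\sum_(j <- zwin N) p j * q (k - j)) ^+ 2 <= P ^+ 2 * Q.
Proof.
move=> p0 q0 pP qQ.
have P0 : 0 <= P by apply: le_trans (pP 0%N); apply: sumr_ge0.
have Q0 : 0 <= Q by apply: le_trans (qQ 0%N); apply: sumr_ge0 => k _; exact: sqr_ge0.
apply: (@le_trans _ _ (\sum_(k <- zwin K) P * \sum_(j <- zwin N) p j * q (k - j) ^+ 2)).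
  apply: ler_sum => k _; apply: le_trans (CauchySchwarz_sum _ _ p0) _.
  by rewrite ler_wpM2r// sumr_ge0// => j _; rewrite mulr_ge0// sqr_ge0.
rewrite -mulr_sumr expr2 -mulrA ler_wpM2l// exchange_big/=.
apply: (@le_trans _ _ (\sum_(j <- zwin N) p j * Q)); last by rewrite -mulr_suml ler_wpM2r.
apply: ler_sum => j _; rewrite -mulr_sumr ler_wpM2l//.
apply: le_trans (qQ (K + absz j)%N).
by apply: (@zwin_shift_le _ (fun k => q k ^+ 2)) => k; exact: sqr_ge0.
Qed.

Lemma Young_sum' (p q : int -> R) (P Q : R) N K : (forall k, 0 <= p k) ->
  (forall k, 0 <= q k) ->
  (forall n, \sum_(k <- zwin n) p k ^+ 2 <= P) ->
  (forall n, \sum_(k <- zwin n) q k <= Q) ->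
  \sum_(k <- zwin K) (\sum_(j <- zwin N) p j * q (k - j)) ^+ 2 <= P * Q ^+ 2.
Proof.
move=> p0 q0 pP qQ.
have P0 : 0 <= P by apply: le_trans (pP 0%N); apply: sumr_ge0 => k _; exact: sqr_ge0.
have Q0 : 0 <= Q by apply: le_trans (qQ 0%N); apply: sumr_ge0.
have qs k : \sum_(j <- zwin N) q (k - j) <= Q.
  apply: le_trans (qQ (N + absz k)%N); rewrite -zwin_opp.
  under eq_bigr do rewrite opprK.
  have -> : \sum_(j <- zwin N) q (k + j) = \sum_(j <- zwin N) q (j - - k).
    by apply: eq_bigr => j _; rewrite opprK addrC.
  by rewrite -abszN; exact: zwin_shift_le.
apply: (@le_trans _ _ (\sum_(k <- zwin K) Q * \sum_(j <- zwin N) q (k - j) * p j ^+ 2)).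
  apply: ler_sum => k _; under eq_bigr do rewrite mulrC.
  apply: le_trans (CauchySchwarz_sum _ _ _) _ => //.
  by rewrite ler_wpM2r// sumr_ge0// => j _; rewrite mulr_ge0// sqr_ge0.
rewrite -mulr_sumr expr2 mulrCA ler_wpM2l// exchange_big/=.
apply: (@le_trans _ _ (\sum_(j <- zwin N) p j ^+ 2 * Q)); last by rewrite -mulr_suml ler_wpM2r.
apply: ler_sum => j _; rewrite -mulr_suml mulrC ler_wpM2l ?sqr_ge0//.
apply: le_trans (qQ (K + absz j)%N).
exact: zwin_shift_le.
Qed.

(** The square of the constant of [wt_split] at r / 2, times 2 from (X + Y)^2 <= 2 X^2 + 2 Y^2. *)
Definition young_cst r : R := 2 * (4 `^ (r / 2)) ^+ 2.

Lemma young_cst_ge0 r : 0 <= young_cst r.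
Proof. by rewrite mulr_ge0// sqr_ge0. Qed.

Lemma nc_sum_zwin_le (a : int -> R[i]) N : asum a -> \sum_(k <- zwin N) nc (a k) <= anorm a.
Proof. by move=> sa; apply: zwin_le_zsum => // k; exact: nc_ge0. Qed.

(** Splitting the weight puts it on one factor at a time, so the other factor enters through its
    Wiener norm only. The resulting linearity in the H^r norm is what the logarithmic Gronwall
    argument requires. *)
Lemma convolution_le r (a b : hseq r) N K : 1 <= r ->
  \sum_(k <- zwin K) wt r k * nsq (\sum_(j <- zwin N) a j * b (k - j)) <=
  young_cst r * (anorm b ^+ 2 * `|a| ^+ 2 + anorm a ^+ 2 * `|b| ^+ 2).
Proof.
move=> r1; have sa := hseq_asum a r1; have sb := hseq_asum b r1.
pose w := @wt R (r / 2); pose C := (4 : R) `^ (r / 2).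
have w0 k : 0 <= w k by exact: wt_ge0.
have C0 : 0 <= C by exact: powR_ge0.
have r20 : 0 <= r / 2 by lra.
have E (c : hseq r) n : \sum_(k <- zwin n) (w k * nc (c k)) ^+ 2 <= `|c| ^+ 2.
  apply: le_trans (hseq_sum_le c n); apply: ler_sum => k _.
  by rewrite exprMn sqr_wt nsq_normc.
have wc0 (c : hseq r) k : 0 <= w k * nc (c k) by rewrite mulr_ge0// nc_ge0.
pose X k := \sum_(j <- zwin N) (w j * nc (a j)) * nc (b (k - j)).
pose Y k := \sum_(j <- zwin N) nc (a j) * (w (k - j) * nc (b (k - j))).
have HX : \sum_(k <- zwin K) X k ^+ 2 <= `|a| ^+ 2 * anorm b ^+ 2.
  apply: (@Young_sum' (fun k => w k * nc (a k)) (fun k => nc (b k)) (`|a| ^+ 2) (anorm b)).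
  - by move=> k; exact: wc0.
  - by move=> k; exact: nc_ge0.
  - by move=> n; exact: E.
  - by move=> n; exact: nc_sum_zwin_le.
have HY : \sum_(k <- zwin K) Y k ^+ 2 <= anorm a ^+ 2 * `|b| ^+ 2.
  apply: (@Young_sum (fun k => nc (a k)) (fun k => w k * nc (b k)) (anorm a) (`|b| ^+ 2)).
  - by move=> k; exact: nc_ge0.
  - by move=> k; exact: wc0.
  - by move=> n; exact: nc_sum_zwin_le.
  - by move=> n; exact: E.
have X0 k : 0 <= X k by apply: sumr_ge0 => j _; rewrite mulr_ge0// nc_ge0.
have Y0 k : 0 <= Y k by apply: sumr_ge0 => j _; rewrite mulr_ge0// nc_ge0.
have pt k : wt r k * nsq (\sum_(j <- zwin N) a j * b (k - j)) <=
    young_cst r * (X k ^+ 2 + Y k ^+ 2).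
  rewrite -sqr_wt -nsq_normc -exprMn.
  have h : wt (r / 2) k * nc (\sum_(j <- zwin N) a j * b (k - j)) <= C * (X k + Y k).
    apply: le_trans (ler_wpM2l (w0 k) (nc_sum _ _)) _.
    rewrite mulr_sumr -big_split mulr_sumr /=; apply: ler_sum => j _.
    rewrite ncM; have nn : 0 <= nc (a j) * nc (b (k - j)) by rewrite mulr_ge0// nc_ge0.
    apply: le_trans (ler_wpM2r nn (wt_split k j r20)) _; rewrite -/C -/(w _) -/(w _).
    by rewrite le_eqVlt; apply/orP; left; apply/eqP; ring.
  apply: (@le_trans _ _ ((C * (X k + Y k)) ^+ 2)).
    rewrite ler_sqr ?nnegrE// ?mulr_ge0 ?nc_ge0 ?addr_ge0//; exact: w0.
  rewrite exprMn /young_cst -/C -[leRHS]mulrA [leRHS]mulrCA ler_wpM2l ?sqr_ge0//.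
  have := sqr_ge0 (X k - Y k); nra.
apply: (@le_trans _ _ (\sum_(k <- zwin K) young_cst r * (X k ^+ 2 + Y k ^+ 2))).
  by apply: ler_sum => k _.
rewrite -mulr_sumr ler_wpM2l ?young_cst_ge0// big_split /= lerD//.
by rewrite mulrC.
Qed.

(** Defined by the pointwise product of functions and not as a convolution: symmetry and bilinearity
    are inherited, and only truncated convolutions have to be estimated. *)
Definition prodc (a b : int -> R[i]) k : R[i] := fourier (fun x => phi b x * phi a x) k.

Lemma phi_prod_bmeas a b : asum a -> asum b -> bmeas (fun x => phi b x * phi a x : R).
Proof. by move=> sa sb; apply: bmeasM; exact: phi_bmeas. Qed.

Lemma Re_cvg (u : nat -> R[i]) z (t : nat -> R) : (forall n, nc (z - u n) <= t n) ->
  t @ \oo --> (0 : R) -> (fun n => nsq (u n)) @ \oo --> nsq z.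
Proof.
move=> zu t0.
have H (pr : R[i] -> R) : (forall v w, pr (v - w) = pr v - pr w) ->
    (forall v, `|pr v| <= nc v) -> (fun n => pr (u n)) @ \oo --> pr z.
  move=> prB prn; apply/cvgrPdist_le => e e0.
  have /cvgrPdist_le /(_ e e0) := t0; apply: filterS => n; rewrite sub0r normrN => tn.
  rewrite -prB; apply: le_trans (prn _) _; apply: le_trans (zu n) _.
  exact: le_trans (ler_norm _) tn.
have hR := H (@complex.Re R) (raddfB _); have hI := H (@complex.Im R) (raddfB _).
have nR (v : R[i]) : `|complex.Re v| <= nc v.
  by case: v => p q; rewrite -sqrtr_sqr ler_wsqrtr// lerDl sqr_ge0.
have nI (v : R[i]) : `|complex.Im v| <= nc v.
  by case: v => p q; rewrite -sqrtr_sqr ler_wsqrtr// lerDr sqr_ge0.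
have := @cvg_nsqB _ _ \oo u z 0 (@eventually_filter) (hR nR) (hI nI).
by rewrite subr0; under eq_fun do rewrite subr0.
Qed.

Lemma prodc_le r (a b : hseq r) K : 1 <= r ->
  \sum_(k <- zwin K) wt r k * nsq (prodc a b k) <=
  young_cst r * (anorm b ^+ 2 * `|a| ^+ 2 + anorm a ^+ 2 * `|b| ^+ 2).
Proof.
move=> r1; have sa := hseq_asum a r1; have sb := hseq_asum b r1.
have lb := bmeas_mL1 (phi_bmeas sb).
pose t N := atail a N * ((2 * pi)^-1 * intI (fun x => `|phi b x|)).
have t0 : t @ \oo --> (0 : R).
  by rewrite -[X in _ --> X](mul0r ((2 * pi)^-1 * intI (fun x => `|phi b x|)));
    apply: cvgMl; exact: atail_cvg.
have cv : (fun N => \sum_(k <- zwin K) wt r k * nsq (\sum_(j <- zwin N) a j * b (k - j))) @ \oo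
    --> \sum_(k <- zwin K) wt r k * nsq (prodc a b k).
  apply: cvg_big => [|k _]; [exact: add_continuous|apply: cvgMr].
  apply: (@Re_cvg _ _ t) => // N.
  have -> : \sum_(j <- zwin N) a j * b (k - j) = \sum_(j <- zwin N) a j * fourier (phi b) (k - j).
    by apply: eq_bigr => j _; rewrite (fourier_phi _ (@hseq_hermitian _ _ b) sb).
  exact: (fourierM_phi N k lb (@hseq_hermitian _ _ a) sa).
rewrite -(cvg_lim _ cv)//; apply: limr_le; first by apply/cvg_ex; eexists; exact: cv.
by apply: nearW => N; exact: convolution_le.
Qed.

End Product.

(** * Weak derivatives of Fourier series *)

Section Derivative.
Context {R : realType}.
Implicit Types (k j : int) (f g h u w : R -> R).

Lemma cvg_sqr_bound (x : R) (y t : nat -> R) (C : R) :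
  (forall n, (x - y n) ^+ 2 <= C * t n) -> t @ \oo --> (0 : R) -> y @ \oo --> x.
Proof.
move=> H t0; apply/cvgrPdist_le => e e0.
have Ct : (fun n => C * t n) @ \oo --> (0 : R).
  by rewrite -[X in _ --> X](mulr0 C); apply: cvgMr.
have e2 : 0 < e ^+ 2 by rewrite exprn_gt0.
have /cvgrPdist_le /(_ _ e2) := Ct; apply: filterS => n; rewrite sub0r normrN => tn.
rewrite -ler_sqr ?nnegrE ?(ltW e0)// real_normK ?num_real//.
by apply: le_trans (H n) _; apply: le_trans tn; exact: ler_norm.
Qed.

Lemma cvg_lin_bound (x : R) (y t : nat -> R) (C : R) :
  (forall n, `|x - y n| <= C * t n) -> t @ \oo --> (0 : R) -> y @ \oo --> x.
Proof.
move=> H t0; apply/cvgrPdist_le => e e0.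
have Ct : (fun n => C * t n) @ \oo --> (0 : R).
  by rewrite -[X in _ --> X](mulr0 C); apply: cvgMr.
have /cvgrPdist_le /(_ _ e0) := Ct; apply: filterS => n; rewrite sub0r normrN => tn.
by apply: le_trans (H n) _; apply: le_trans tn; exact: ler_norm.
Qed.

Lemma C1pM f g : C1p f -> C1p g -> C1p (fun x => f x * g x) /\
  derive1 (fun x => f x * g x) = (fun x => derive1 f x * g x + f x * derive1 g x).
Proof.
move=> cf cg; have [pf df f'c] := cf; have [pg dg g'c] := cg.
apply: is_derive_C1p => [x|x|x]; first by rewrite pf pg.
- have hf := derivableP (df x); have hg := derivableP (dg x).
  refine (is_derive_eq (is_deriveM hf hg) _).
  by rewrite !derive1E /GRing.scale /= addrC mulrC; congr (_ + _); rewrite mulrC.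
- apply: cvgD; apply: cvgM; [exact: f'c|exact: C1p_continuous|exact: C1p_continuous|exact: g'c].
Qed.

Lemma C1p_bmeas f : C1p f -> bmeas f /\ bmeas (derive1 f).
Proof.
move=> cf; have [pf df f'c] := cf; split; apply: continuous_bmeas => //.
  exact: C1p_continuous.
move=> x; rewrite /derive1.
by under [in LHS]eq_fun do rewrite addrA !pf.
Qed.

(** The monomials [trm z k] are admissible test functions. *)
Lemma is_weak_dx_fourier u w k : L2per u -> is_weak_dx u w ->
  fourier w k = mulik k (fourier u k).
Proof.
move=> [pu mu_ su] [[pw mw sw] H].
have lu : mL1 u by apply: L2_mL1.
have lw : mL1 w by apply: L2_mL1.
apply: dotc_inj => z; rewrite dotc_fourier//.
have [cz dz] := trm_C1p z k; have [pz ddz cdz] := cz.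
have := H _ pz ddz cdz; rewrite dz -/(intI _) -/(intI _) => /esym/eqP.
rewrite eqr_oppLR => /eqP ->; rewrite intI_trm// -mulrN mulKf ?twopi_neq0//.
by case: z {cz dz pz ddz cdz} (fourier u k) => p q [p' q']; rewrite /dotc /mulik /=; ring.
Qed.

Lemma mulik_hermitian (a : int -> R[i]) : hermitian a ->
  hermitian (fun k => mulik k (a k)).
Proof.
move=> aH k; rewrite aH /mulik; case: (a k) => p q; rewrite rmorphN /=; congr Complex; ring.
Qed.

Section OfSequence.
Variable a : int -> R[i].
Hypotheses (aH : hermitian a) (sa : asum a)
  (da : zsummable (fun k => nsq (mulik k (a k)))).

Let u := phi a.
Let S := tpoly a.
Let S' := tpoly (fun k => mulik k (a k)).

Let bu : bmeas u. Proof. exact: phi_bmeas. Qed.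
Let bS N : bmeas (S N). Proof. exact: tpoly_bmeas. Qed.
Let bS' N : bmeas (S' N). Proof. exact: tpoly_bmeas. Qed.

Lemma cvg_intI_tpoly h : mL1 h ->
  (fun N => intI (fun x => h x * S N x)) @ \oo --> intI (fun x => h x * u x).
Proof.
move=> lh; apply: (@cvg_lin_bound _ _ _ (intI (fun x => `|h x|))) (atail_cvg sa) => N.
have [_ l1] := lh; have [_ lu] := mL1_bmeasM lh bu; have [_ lS] := mL1_bmeasM lh (bS N).
rewrite -intIB//; apply: le_trans (norm_intI (L1IB lu lS)) _.
rewrite mulrC -intIZ; last exact: L1I_norm.
apply: le_intI => [||x _].
- by apply: L1I_norm; exact: L1IB.
- by apply: L1IZ; exact: L1I_norm.
- by rewrite -mulrBr normrM mulrC ler_wpM2r// phi_tail.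
Qed.

Variable ux : R -> R.
Hypotheses (l2ux : L2per ux) (uxS : forall N, intI (fun x => (ux x - S' N x) ^+ 2) <=
  2 * pi * (zsum (fun k => nsq (mulik k (a k))) -
    \sum_(k <- zwin N) nsq (mulik k (a k)))).

Let lux : L2I ux. Proof. by case: l2ux. Qed.

Lemma cvg_intI_dtpoly g : L2I g ->
  (fun N => intI (fun x => S' N x * g x)) @ \oo --> intI (fun x => ux x * g x).
Proof.
move=> lg; apply: (@cvg_sqr_bound _ _ _ (2 * pi * intI (fun x => g x ^+ 2)))
  (zsum_tail_cvg da) => N.
have lS := bmeas_L2 (bS' N).
rewrite -intIB; [|exact: L2I_mul|exact: L2I_mul].
under eq_fun do rewrite -mulrBl.
apply: le_trans (intI_CauchySchwarz (L2IB lux lS) lg) _.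
rewrite [leRHS]mulrAC ler_wpM2r//; first by apply: intI_ge0 => x _; exact: sqr_ge0.
Qed.

Lemma weak_dx_phi : is_weak_dx u ux.
Proof.
split => // p pp dp cp; rewrite -/(intI _) -/(intI _).
have C : C1p p by []; have [bp bp'] := C1p_bmeas C.
have c1 := cvg_intI_tpoly (bmeas_mL1 bp').
have c2 := cvg_intI_dtpoly (bmeas_L2 bp).
have E : (fun N => intI (fun x => derive1 p x * S N x)) =
    (fun N => - intI (fun x => S' N x * p x)).
  apply/funext => N; have [CS dS] := tpoly_C1p a N.
  rewrite -/(S' N) in dS; rewrite -dS -intI_parts//.
  by apply: eq_intI => x _; rewrite mulrC.
rewrite E in c1; have := cvg_unique _ c1 (cvgN c2) => <- //.
by apply: eq_intI => x _; rewrite mulrC.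
Qed.

Let ulux : L2I (fun x => u x * ux x). Proof. exact: L2I_bmeasM. Qed.

(** Limit of the integration by parts for S_N^2. Since S_N converges uniformly and S'_N only in L^2,
    each product contains the latter at most once. *)
Lemma weak_dx_sqr : is_weak_dx (fun x => 2^-1 * u x ^+ 2) (fun x => u x * ux x).
Proof.
have [pux _ _] := l2ux; split.
  by split; [move=> x; rewrite /u phi_periodic pux|case: ulux|case: ulux].
move=> p pp dp cp; rewrite -/(intI _) -/(intI _).
have C : C1p p by []; have [bp bp'] := C1p_bmeas C.
have l2p := bmeas_L2 bp.
have bpS N : bmeas (fun x => derive1 p x * S N x) := bmeasM bp' (bS N).
have bpu : bmeas (fun x => derive1 p x * u x) := bmeasM bp' bu.
have c1 : (fun N => intI (fun x => (derive1 p x * S N x) * S N x)) @ \oo -->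
    intI (fun x => (derive1 p x * u x) * u x).
  apply: (@cvg_lin_bound _ _ _ (intI (fun x => `|derive1 p x|) * (2 * anorm a)))
    (atail_cvg sa) => N.
  have l1 := bmeas_L1 (bmeasM (bpS N) (bS N)); have l2 := bmeas_L1 (bmeasM bpu bu).
  have l0 := L1I_norm (bmeas_L1 bp').
  rewrite -intIB//; apply: le_trans (norm_intI (L1IB l2 l1)) _.
  rewrite -mulrA mulrC -intIZ//; apply: le_intI => [||x _].
  - by apply: L1I_norm; exact: L1IB.
  - exact: L1IZ.
  - have -> : derive1 p x * u x * u x - derive1 p x * S N x * S N x =
      derive1 p x * ((u x - S N x) * (u x + S N x)) by ring.
    rewrite normrM mulrC ler_wpM2r// normrM mulrC.
    apply: ler_pM => //; last exact: phi_tail.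
    rewrite mulr_natl mulr2n; apply: le_trans (ler_normD _ _) _.
    by apply: lerD; [exact: norm_phi|exact: norm_tpoly].
have c2 : (fun N => intI (fun x => S' N x * (S N x * p x))) @ \oo -->
    intI (fun x => ux x * (u x * p x)).
  have d1 := cvg_intI_dtpoly (bmeas_L2 (bmeasM bu bp)).
  pose Z := zsum (fun k => nsq (mulik k (a k))).
  have bD N : bmeas (fun x => (u x - S N x) * p x) := bmeasM (bmeas_phiB N sa) bp.
  (* S'_N stays bounded in L^2 by Parseval, and u - S_N tends to zero uniformly. *)
  have d2 : (fun N => intI (fun x => S' N x * ((u x - S N x) * p x))) @ \oo --> (0 : R).
    apply: (@cvg_sqr_bound _ _ (fun N => atail a N * atail a N)
      (2 * pi * Z * intI (fun x => p x ^+ 2))).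
      move=> N; rewrite sub0r sqrrN.
      apply: le_trans (intI_CauchySchwarz (bmeas_L2 (bS' N)) (bmeas_L2 (bD N))) _.
      have Z0 : 0 <= Z by apply: zsum_ge0 => // k; exact: nsq_ge0.
      rewrite -(mulrA (2 * pi * Z)); apply: ler_pM => //.
      + by apply: intI_ge0 => x _; exact: sqr_ge0.
      + by apply: intI_ge0 => x _; exact: sqr_ge0.
      + rewrite Parseval_tpoly; last exact: mulik_hermitian.
        rewrite ler_pM2l ?twopi_gt0//.
        by apply: zwin_le_zsum => // k; exact: nsq_ge0.
      + have lp2 := L2I_mul l2p l2p.
        have E2 : (fun x => p x * p x) = (fun x => p x ^+ 2) by apply/funext.
        rewrite E2 in lp2.
        rewrite mulrC -intIZ//; apply: le_intI => [||x _].
        * have := L2I_mul (bmeas_L2 (bD N)) (bmeas_L2 (bD N)).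
          by congr L1I; apply/funext.
        * exact: L1IZ.
        * rewrite exprMn ler_wpM2r ?sqr_ge0// -real_normK ?num_real// expr2.
          by apply: ler_pM => //; exact: phi_tail.
    have := cvgM (atail_cvg sa) (atail_cvg sa); rewrite mulr0; apply.
  have d3 := cvgB d1 d2 _; rewrite subr0 in d3.
  have -> : (fun N => intI (fun x => S' N x * (S N x * p x))) =
      (fun N => intI (fun x => S' N x * (u x * p x))) \-
      (fun N => intI (fun x => S' N x * ((u x - S N x) * p x))).
    apply/funext => N /=; rewrite -intIB.
    - by apply: eq_intI => x _; ring.
    - exact: bmeas_L1 (bmeasM (bS' N) (bmeasM bu bp)).
    - exact: bmeas_L1 (bmeasM (bS' N) (bD N)).
  exact: d3.
(* Integration by parts of S_N against (S_N p)' = S'_N p + S_N p', solved for the integral of S_N^2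
   p'. *)
have E : (fun N => intI (fun x => (derive1 p x * S N x) * S N x)) =
    (fun N => - 2 * intI (fun x => S' N x * (S N x * p x))).
  apply/funext => N; have [CS dS] := tpoly_C1p a N; rewrite -/(S' N) in dS.
  have [Cg dg] := C1pM CS C.
  have := intI_parts CS Cg; rewrite dg dS.
  have b1 := bmeas_L1 (bmeasM (bS' N) (bmeasM (bS N) bp)).
  have b2 := bmeas_L1 (bmeasM (bpS N) (bS N)).
  have -> : intI (fun x => tpoly a N x * (tpoly (fun k => mulik k (a k)) N x * p x +
      tpoly a N x * derive1 p x)) =
      intI (fun x => (derive1 p x * S N x) * S N x) + intI (fun x => S' N x * (S N x * p x)).
    by rewrite -intID//; apply: eq_intI => x _; rewrite /S /S'; ring.
  rewrite -/(S' N) -/(S N); lra.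
rewrite E in c1; have c3 := @cvgMr _ _ _ _ _ (- 2) _ c2.
have H := cvg_unique (@Rhausdorff R) c1 (c3 _).
have -> : intI (fun x => 2^-1 * u x ^+ 2 * derive1 p x) =
    2^-1 * intI (fun x => (derive1 p x * u x) * u x).
  rewrite -intIZ; last exact: bmeas_L1 (bmeasM bpu bu).
  by apply: eq_intI => x _; ring.
rewrite H; have -> : intI (fun x => u x * ux x * p x) = intI (fun x => ux x * (u x * p x)).
  by apply: eq_intI => x _; ring.
lra.
Qed.

(** The function u need not be C^1, so the weak derivative of u^2 / 2 is tested against S_N instead.
    In the limit the integral J satisfies J = -2 J. *)
Lemma int_sqr_dx : intI (fun x => ux x * u x ^+ 2) = 0.
Proof.
have lu2 : L2I (fun x => u x ^+ 2) by apply: bmeas_L2; exact: (bmeasM bu bu).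
have c1 := cvg_intI_dtpoly lu2.
have c2 := cvg_intI_tpoly (L2_mL1 ulux).
have [_ W] := weak_dx_sqr.
have E N : intI (fun x => S' N x * u x ^+ 2) = - 2 * intI (fun x => u x * ux x * S N x).
  have [CS dS] := tpoly_C1p a N; have [pS ddS cdS] := CS.
  have := W _ pS ddS cdS; rewrite dS -/(intI _) -/(intI _) -/(S N) -/(S' N) => HW.
  have -> : - 2 * intI (fun x => u x * ux x * S N x) =
    2 * (- intI (fun x => u x * ux x * S N x)) by ring.
  rewrite -HW -intIZ; last first.
    by apply: bmeas_L1; apply: bmeasM => //; apply: bmeasM; [exact: bmeas_cst|exact: (bmeasM bu bu)].
  by apply: eq_intI => x _; field.
have EF := funext E : (fun N => intI (fun x => S' N x * u x ^+ 2)) = _.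
rewrite EF in c1; have c3 := @cvgMr _ _ _ _ _ (- 2) _ c2.
have H := cvg_unique (@Rhausdorff R) c1 (c3 _).
have E3 : intI (fun x => ux x * u x ^+ 2) = intI (fun x => u x * ux x * u x).
  by apply: eq_intI => x _; ring.
have K (J : R) : J = - 2 * J -> J = 0 by lra.
by rewrite E3; apply: K; rewrite -{1}E3; exact: H.
Qed.

End OfSequence.
End Derivative.

(** * The Benjamin-Bona-Mahony vector field *)

Section Operators.
Context {R : realType}.
Local Notation nc := (@ComplexField.Normc.normc R).
Implicit Types (k : int) (r alpha : R).

Lemma sqr_le_wt r k : 1 <= r -> (k%:~R : R) ^+ 2 <= wt r k.
Proof.
move=> r1; apply: le_trans (wt_ge k r1).
by rewrite real_normK ?num_real// lerDr.
Qed.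

Lemma nsq_mulik k (z : R[i]) : nsq (mulik k z) = (k%:~R : R) ^+ 2 * nsq z.
Proof. by rewrite /mulik nsqM /nsq /= expr0n /= add0r. Qed.

Lemma dx_summable r (a : hseq r) : 1 <= r ->
  zsummable (fun k => nsq (mulik k (a k))).
Proof.
move=> r1; apply: zsummable_le (hseq_sum a) => k.
by rewrite ger0_norm ?nsq_ge0// nsq_mulik ler_wpM2r ?nsq_ge0// sqr_le_wt.
Qed.

(** As r >= 1, the sequence ik a_k is square summable and Riesz-Fischer supplies u_x. The
    convergence in the last item is kept for the energy identity. *)
Lemma dx_exists r (a : hseq r) : 1 <= r -> exists ux,
  [/\ is_weak_dx (phi a) ux,
      is_weak_dx (fun x => 2^-1 * phi a x ^+ 2) (fun x => phi a x * ux x),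
      intI (fun x => ux x * phi a x ^+ 2) = 0 &
      forall g, L2I g -> (fun N => intI (fun x => tpoly (fun k => mulik k (a k)) N x * g x))
        @ \oo --> intI (fun x => ux x * g x)].
Proof.
move=> r1; have aH : hermitian a by exact: coefN.
have sa := hseq_asum a r1; have da := dx_summable a r1.
have mH := mulik_hermitian aH.
have [ux [l2 uxS]] := Riesz_Fischer mH da.
exists ux; split.
- exact: weak_dx_phi.
- exact: weak_dx_sqr.
- exact: int_sqr_dx.
- by move=> g lg; exact: cvg_intI_dtpoly.
Qed.

(** Symbols of 1 + D^alpha and, next, of -(1 + D^alpha)^(-1) d/dx, the operator that appears when
    the equation is solved for u_t. *)
Definition disp alpha k : R := 1 + `|k%:~R| `^ alpha.
Definition mult alpha k : R[i] := Complex 0 (- (k%:~R / disp alpha k)).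

Section Fixed.
Variables (alpha r : R).
Hypotheses (alpha1 : 1 <= alpha) (r1 : 1 <= r) (ar : alpha <= r).

Lemma disp_gt0 k : 0 < disp alpha k.
Proof. by rewrite ltr_wpDr ?powR_ge0. Qed.

(** As k is an integer, |k| >= 1 unless k = 0, so |k| <= |k|^alpha. This gives both the boundedness
    of [mult] and the control of the H^(1/2) norm by the energy. *)
Lemma disp_ge k : 1 + `|k%:~R : R| <= disp alpha k.
Proof.
rewrite lerD2l; have [->|k0] := eqVneq k 0; first by rewrite normr0 powR_ge0.
rewrite -[leLHS]powRr1//; apply: ler_powR => //.
by rewrite absz_norm ler1n absz_gt0.
Qed.

Lemma disp_le k : disp alpha k <= 2 * wt r k.
Proof.
have x1 : 1 <= 1 + `|k%:~R : R| ^+ 2 by rewrite lerDl sqr_ge0.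
rewrite mulr_natl mulr2n; apply: lerD.
  rewrite /wt -[leLHS](powRr0 (1 + `|k%:~R : R| ^+ 2)); apply: ler_powR => //.
  exact: le_trans r1.
apply: (@le_trans _ _ ((1 + `|k%:~R : R| ^+ 2) `^ alpha)); last exact: ler_powR.
have a0 : 0 <= alpha by apply: le_trans alpha1.
have x0 : 0 <= 1 + `|k%:~R : R| ^+ 2 by apply: le_trans x1.
apply: ge0_ler_powR; rewrite ?nnegrE//.
have := sqr_ge0 (`|k%:~R : R| - 1); have := normr_ge0 (k%:~R : R).
by move: `|_| => x; nra.
Qed.

Lemma nsq_mult k : nsq (mult alpha k) <= 1.
Proof.
have d0 := disp_gt0 k; rewrite /nsq /= expr0n /= add0r sqrrN expr_div_n.
rewrite ler_pdivrMr ?exprn_gt0// mul1r -[leLHS]real_normK ?num_real//.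
rewrite ler_sqr ?nnegrE ?(ltW d0)//; apply: le_trans (disp_ge k).
by rewrite lerDr.
Qed.

Lemma disp_mult k (z : R[i]) :
  real_complex R (disp alpha k) * (mult alpha k * z) = - mulik k z.
Proof.
have d0 := disp_gt0 k; rewrite /mult /mulik; move: (disp _ _) d0 => d d0.
have ? : d != 0 by rewrite gt_eqF.
by case: z => p q; rewrite /=; congr Complex; field.
Qed.

Lemma hcoef_mult (c : hseq r) : hcoef r (fun k => mult alpha k * c k).
Proof.
split=> [k|].
  rewrite coefN rmorphM; congr (_ * _).
  by rewrite /mult /disp rmorphN normrN /= mulNr; congr Complex; rewrite opprK oppr0.
apply: zsummable_le (hseq_sum c) => k.
rewrite ger0_norm ?mulr_ge0 ?wt_ge0 ?nsq_ge0// ler_wpM2l ?wt_ge0// nsqM.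
by rewrite -[leRHS]mul1r ler_wpM2r ?nsq_ge0// nsq_mult.
Qed.

Definition hmult (c : hseq r) : hseq r := Hseq (hcoef_mult c).

Lemma hmult_le c : `|hmult c| <= `|c|.
Proof.
apply: hseq_norm_le => // N; apply: le_trans (hseq_sum_le c N).
apply: ler_sum => k _; rewrite ler_wpM2l ?wt_ge0// nsqM.
by rewrite -[leRHS]mul1r ler_wpM2r ?nsq_ge0// nsq_mult.
Qed.

Lemma hmultD c c' : hmult (c + c') = hmult c + hmult c'.
Proof. by apply: hseq_ext => k; rewrite !(coefDE, mulrDr)//= mulrDr. Qed.

Lemma hmultZ x c : hmult (x *: c) = x *: hmult c.
Proof. by apply: hseq_ext => k; rewrite !coefZE /= mulrCA. Qed.

Let mL1_prod (a b : hseq r) : mL1 (fun x => phi b x * phi a x).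
Proof. by apply: bmeas_mL1; apply: phi_prod_bmeas; exact: hseq_asum. Qed.

Lemma hcoef_prod (a b : hseq r) : hcoef r (prodc a b).
Proof.
split=> [k|]; first exact: fourier_opp.
by apply: zsummable_ge0 (fun N => prodc_le a b N r1) => k;
  rewrite mulr_ge0 ?wt_ge0 ?nsq_ge0.
Qed.

Definition hprod (a b : hseq r) : hseq r := Hseq (hcoef_prod a b).

Lemma hprodC a b : hprod a b = hprod b a.
Proof.
apply: hseq_ext => k /=; rewrite /prodc.
by have -> : (fun x => phi b x * phi a x) = (fun x => phi a x * phi b x)
  by apply/funext => x; rewrite mulrC.
Qed.

Lemma hprodDl a b c : hprod (a + b) c = hprod a c + hprod b c.
Proof.
apply: hseq_ext => k; rewrite coefDE /= /prodc -fourierD//.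
have -> // : (fun x => phi c x * phi (a + b) x) =
    (fun x => phi c x * phi a x + phi c x * phi b x).
by apply/funext => x; rewrite -mulrDr -phiD//; exact: hseq_asum.
Qed.

Lemma hprodDr a b c : hprod a (b + c) = hprod a b + hprod a c.
Proof. by rewrite !(hprodC a) hprodDl. Qed.

Lemma hprodZl x a b : hprod (x *: a) b = x *: hprod a b.
Proof.
apply: hseq_ext => k; rewrite coefZE /= /prodc -fourierZ//.
have -> // : (fun y => phi b y * phi (x *: a) y) = (fun y => x * (phi b y * phi a y)).
by apply/funext => y; rewrite mulrCA -(phiZ x y (hseq_asum a r1)).
Qed.

Lemma hprodZr x a b : hprod a (x *: b) = x *: hprod a b.
Proof. by rewrite !(hprodC a) hprodZl. Qed.

(** The 2 counts the two terms of [prodc_le], which coincide for a = b. *)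
Definition tame_cst : R := Num.sqrt (2 * young_cst r).

Lemma tame_cst_ge0 : 0 <= tame_cst. Proof. exact: sqrtr_ge0. Qed.

Let sqr_tame : tame_cst ^+ 2 = 2 * young_cst r.
Proof. by rewrite sqr_sqrtr// mulr_ge0// young_cst_ge0. Qed.

Lemma hprod_tame a : `|hprod a a| <= tame_cst * (anorm a * `|a|).
Proof.
have a0 := anorm_ge0 (hseq_asum a r1).
apply: hseq_norm_le => [|N]; first by rewrite mulr_ge0 ?tame_cst_ge0// mulr_ge0.
rewrite exprMn sqr_tame; apply: le_trans (prodc_le a a N r1) _.
by rewrite exprMn le_eqVlt; apply/orP; left; apply/eqP; ring.
Qed.

Lemma hprod_le a b : `|hprod a b| <= tame_cst * wiener_cst * `|a| * `|b|.
Proof.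
have w0 := @wiener_cst_ge0 R.
have a0 := anorm_ge0 (hseq_asum a r1); have b0 := anorm_ge0 (hseq_asum b r1).
have aw := anorm_le a r1; have bw := anorm_le b r1.
apply: hseq_norm_le => [|N].
  by rewrite mulr_ge0// mulr_ge0// mulr_ge0// tame_cst_ge0.
have -> : (tame_cst * wiener_cst * `|a| * `|b|) ^+ 2 = young_cst r *
    ((wiener_cst * `|b|) ^+ 2 * `|a| ^+ 2 + (wiener_cst * `|a|) ^+ 2 * `|b| ^+ 2).
  rewrite !exprMn sqr_tame; ring.
apply: le_trans (prodc_le a b N r1) _; rewrite ler_wpM2l ?young_cst_ge0//.
by apply: lerD; rewrite ler_wpM2r ?sqr_ge0// ler_sqr ?nnegrE// mulr_ge0.
Qed.

(** The nonlinearity u u_x in the divergence form (u^2 / 2)_x, the derivative being part of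
    [hmult]. *)
Definition hbil (a b : hseq r) : hseq r := hmult (2^-1 *: hprod a b).

Lemma hbilDl a b c : hbil (a + b) c = hbil a c + hbil b c.
Proof. by rewrite /hbil hprodDl scalerDr hmultD. Qed.
Lemma hbilDr a b c : hbil a (b + c) = hbil a b + hbil a c.
Proof. by rewrite /hbil hprodDr scalerDr hmultD. Qed.
Lemma hbilZl x a b : hbil (x *: a) b = x *: hbil a b.
Proof. by rewrite /hbil hprodZl scalerA mulrC -scalerA hmultZ. Qed.
Lemma hbilZr x a b : hbil a (x *: b) = x *: hbil a b.
Proof. by rewrite /hbil hprodZr scalerA mulrC -scalerA hmultZ. Qed.

Let hbil_prod a b : `|hbil a b| <= `|hprod a b|.
Proof.
apply: le_trans (hmult_le _) _; rewrite normrZ -[leRHS]mul1r ler_wpM2r//.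
by rewrite ger0_norm// invf_le1// ler1n.
Qed.

Lemma hbil_le a b : `|hbil a b| <= tame_cst * wiener_cst * `|a| * `|b|.
Proof. exact: le_trans (hbil_prod a b) (hprod_le a b). Qed.

Lemma hbil_tame a : `|hbil a a| <= tame_cst * (anorm a * `|a|).
Proof. exact: le_trans (hbil_prod a a) (hprod_tame a). Qed.

Definition bbm (a : hseq r) : hseq r := quadF hmult hbil a.

Lemma bbmE a k : bbm a k = mult alpha k * (a k + real_complex R 2^-1 * prodc a a k).
Proof. by rewrite /bbm /quadF coefDE /= mulrDr. Qed.

Lemma bbm_tame a : `|bbm a| <= `|a| * (1 + tame_cst * anorm a).
Proof.
apply: le_trans (ler_normD _ _) _; rewrite mulrDr mulr1; apply: lerD.
  exact: hmult_le.
by apply: le_trans (hbil_tame a) _; rewrite (mulrC `|a|) mulrA.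
Qed.

(* Conservation of [sum_k (1 + |k|^alpha) |a k|^2], the only place where the
   structure of the nonlinearity is used. *)
Lemma qform_bbm (a : hseq r) : qform (disp alpha) a (bbm a) = 0.
Proof.
have [ux [_ _ I0 C]] := dx_exists a r1.
apply: zsum_cvg.
have sa := hseq_asum a r1.
have lu : L2I (fun x => phi a x ^+ 2) by exact: bmeas_L2 (phi_prod_bmeas sa sa).
have H := C _ lu; rewrite I0 in H.
have c1 := @cvgMr _ _ _ _ _ (2^-1 * (2 * pi)^-1) _ H; rewrite mulr0 in c1.
have -> : (fun N => \sum_(k <- zwin N) disp alpha k * dotc (a k) (bbm a k)) =
  (fun N => 2^-1 * (2 * pi)^-1 *
    intI (fun x => tpoly (fun k => mulik k (a k)) N x * phi a x ^+ 2)).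
  apply/funext => N.
  have -> : (fun x => tpoly (fun k => mulik k (a k)) N x * phi a x ^+ 2) =
    (fun x => phi a x * phi a x * tpoly (fun k => mulik k (a k)) N x).
    by apply/funext => x; rewrite mulrC.
  rewrite intI_tpoly// -mulrA mulKf ?twopi_neq0// mulr_sumr.
  apply: eq_bigr => k _; rewrite -dotcZr bbmE disp_mult -/(prodc a a k).
  by case: (a k) (prodc a a k) => p q [p' q']; rewrite /dotc /mulik /=; field.
exact: c1.
Qed.

(** Used in both directions: to show that a curve in H^r solves the equation, and to read the vector
    field off a given solution. *)
Lemma fourier_nonlinear (a : hseq r) ux : is_weak_dx (phi a) ux ->
    is_weak_dx (fun x => 2^-1 * phi a x ^+ 2) (fun x => phi a x * ux x) ->
  forall k, fourier ux k + fourier (fun x => phi a x * ux x) k =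
    - (real_complex R (disp alpha k) * bbm a k).
Proof.
move=> d1 d2 k; have sa := hseq_asum a r1.
have l2 : L2per (phi a).
  by have [m l] := bmeas_L2 (phi_bmeas sa); split => //; exact: phi_periodic.
have l2' : L2per (fun x => 2^-1 * phi a x ^+ 2).
  have [m l] := bmeas_L2 (bmeasM (bmeas_cst (2^-1 : R)) (phi_prod_bmeas sa sa)).
  by split => // x; rewrite phi_periodic.
rewrite (is_weak_dx_fourier k l2 d1) (is_weak_dx_fourier k l2' d2).
rewrite fourier_phi//; last exact: coefN.
rewrite (fourierZ 2^-1 k (mL1_prod a a)) -/(prodc a a k).
by rewrite bbmE disp_mult opprK /mulik -mulrDr.
Qed.

End Fixed.
End Operators.

(** * A priori bound and global solutions *)

Section Calculus.
Context {R : realType}.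
Implicit Types (e d s t T K : R).

(** Differentiability by increments, without division and with values in any normed space;
    real-valued instances are handed over to [is_derive] by the next lemma. *)
Definition hderiv (V : normedModType R) (U : R -> V) t v := forall e, 0 < e ->
  exists d, 0 < d /\ forall s, `|s - t| < d -> `|U s - U t - (s - t) *: v| <= e * `|s - t|.

Lemma hderiv_is_derive (f : R -> R) t v : hderiv f t v -> is_derive t 1 f v.
Proof.
move=> H; have C : (fun h => h^-1 *: ((f \o shift t) (h *: 1) - f t)) @ 0^' --> v.
  apply/cvgrPdist_le => e e0; have [d [d0 Hd]] := H e e0.
  apply/nbhs_ballP; exists d => //= h; rewrite /ball /= sub0r normrN => hd /eqP h0.
  have := Hd (h + t); rewrite addrK => /(_ hd).
  rewrite /GRing.scale /= mulr1 distrC => Hh.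
  have hp : 0 < `|h| by rewrite normr_gt0; apply/eqP.
  rewrite -(ler_pM2r hp) -normrM mulrBl mulrAC mulVf ?mul1r; last exact/eqP.
  by rewrite (mulrC v).
by apply: DeriveDef; [apply/cvg_ex; exists v|apply: cvg_lim].
Qed.

Lemma hderivB (V : normedModType R) (U W : R -> V) t v w :
  hderiv U t v -> hderiv W t w -> hderiv (fun s => U s - W s) t (v - w).
Proof.
move=> HU HW e e0; have e2 : 0 < e / 2 by rewrite divr_gt0.
have [d1 [d10 H1]] := HU _ e2; have [d2 [d20 H2]] := HW _ e2.
exists (Num.min d1 d2); split; first by rewrite lt_min d10.
move=> s; rewrite lt_min => /andP[/H1 h1 /H2 h2].
have -> : U s - W s - (U t - W t) - (s - t) *: (v - w) =
    (U s - U t - (s - t) *: v) - (W s - W t - (s - t) *: w).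
  have ACA (x y z z' : V) : x - y - (z - z') = x - z - (y - z').
    by rewrite !opprD !opprK addrACA.
  by rewrite scalerBr (ACA (U s) (W s)) (ACA (U s - U t)).
apply: le_trans (ler_normB _ _) _.
by rewrite [e]splitr mulrDl lerD.
Qed.

Lemma decreasing_itv (f f' : R -> R) T :
  (forall t, 0 <= t <= T -> f @ within `[0, T] (nbhs t) --> f t) ->
  (forall t, 0 < t < T -> is_derive t 1 f (f' t)) ->
  (forall t, 0 < t < T -> f' t <= 0) ->
  forall t, 0 <= t <= T -> f t <= f 0.
Proof.
move=> fc df df0 t /andP[t0 tT].
have T0 : 0 <= T := le_trans t0 tT.
have D x : x \in `]0, T[ -> derivable f x 1 by rewrite in_itv /= => /df[].
have D0 x : x \in `]0, T[ -> derive1 f x <= 0.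
  rewrite in_itv /= => xT; have := df0 x xT; rewrite derive1E.
  by have [_ ->] := df x xT.
have C : {within `[0, T], continuous f}.
  by apply/subspace_continuousP => x /=; rewrite in_itv /=; exact: fc.
by apply: (ler0_derive1_le_cc D D0 C) => //; rewrite in_itv/= ?lexx ?t0.
Qed.

(** y exp (-K t) is nonincreasing. *)
Lemma Gronwall0 (y y' : R -> R) T K :
  (forall t, 0 <= t <= T -> y @ within `[0, T] (nbhs t) --> y t) ->
  (forall t, 0 < t < T -> is_derive t 1 y (y' t)) ->
  (forall t, 0 < t < T -> y' t <= K * y t) ->
  y 0 = 0 -> forall t, 0 <= t <= T -> y t <= 0.
Proof.
move=> yc dy yK y0 t tT.
pose f t := y t * expR (- K * t).
have : f t <= f 0.
  apply: (@decreasing_itv f (fun s => (y' s - K * y s) * expR (- K * s)) T) => //.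
  - move=> s sT; apply: cvgM; first exact: yc.
    apply: cvg_within_filter; apply: continuous_comp; last exact: continuous_expR.
    exact: mulrl_continuous.
  - move=> s sT; have hy := dy s sT.
    have hk : is_derive s 1 (fun x => - K * x) (- K).
      by have := is_deriveZ (- K) (is_derive_id s 1); rewrite /GRing.scale /= mulr1.
    have he := is_derive1_comp (is_derive_expR (- K * s)) hk.
    refine (is_derive_eq (is_deriveM hy he) _).
    rewrite /GRing.scale /=; ring.
  - by move=> s sT; rewrite mulr_le0_ge0 ?expR_ge0// subr_le0 yK.
by rewrite /f y0 mul0r pmulr_lle0 ?expR_gt0.
Qed.

(** ln (1 + ln (1 + y)) has the derivative y' / ((1 + y)(1 + ln (1 + y))) <= K; undoing the two
    logarithms produces the double exponential. *)
Lemma Gronwall_log (y y' : R -> R) T K : 0 <= K ->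
  (forall t, 0 <= t <= T -> y @ within `[0, T] (nbhs t) --> y t) ->
  (forall t, 0 < t < T -> is_derive t 1 y (y' t)) ->
  (forall t, 0 <= t <= T -> 0 <= y t) ->
  (forall t, 0 < t < T -> y' t <= K * (1 + y t) * (1 + ln (1 + y t))) ->
  forall t, 0 <= t <= T ->
  y t <= expR (expR (ln (1 + ln (1 + y 0)) + K * T)).
Proof.
move=> K0 yc dy y0 yK t tT.
pose f t := ln (1 + ln (1 + y t)) - K * t.
have l0 s : 0 <= s <= T -> 0 <= ln (1 + y s).
  by move=> sT; rewrite ln_ge0// lerDl y0.
have oo s : 0 < s < T -> 0 <= s <= T by move=> /andP[s0 sT]; rewrite !ltW.
have p1 s : 0 <= s <= T -> 0 < 1 + y s by move=> sT; rewrite ltr_wpDr// y0.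
have p2 s : 0 <= s <= T -> 0 < 1 + ln (1 + y s) by move=> sT; rewrite ltr_wpDr// l0.
have H : f t <= f 0.
  apply: (@decreasing_itv f
    (fun s => (1 + ln (1 + y s))^-1 * ((1 + y s)^-1 * y' s) - K) T) => //.
  - move=> s sT; apply: cvgB.
      apply: continuous_cvg; first by apply: continuous_ln; exact: p2.
      apply: cvgD; first exact: cvg_cst.
      apply: continuous_cvg; first by apply: continuous_ln; exact: p1.
      by apply: cvgD; [exact: cvg_cst|exact: yc].
    by apply: cvg_within_filter; exact: mulrl_continuous.
  - move=> s sT; have hy := dy s sT.
    have h1 : is_derive s 1 (fun x => 1 + y x) (y' s).
      by have := is_deriveD (is_derive_cst (1 : R) s 1) hy; rewrite add0r.
    have h2 := @is_derive1_comp R (@ln R) (fun x => 1 + y x) s _ _ (is_derive1_ln (p1 s (oo s sT))) h1.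
    have h3 : is_derive s 1 (fun x => 1 + ln (1 + y x)) ((1 + y s)^-1 * y' s).
      by have := is_deriveD (is_derive_cst (1 : R) s 1) h2; rewrite add0r.
    have h4 := @is_derive1_comp R (@ln R) (fun x => 1 + ln (1 + y x)) s _ _ (is_derive1_ln (p2 s (oo s sT))) h3.
    have hk : is_derive s 1 (fun x => K * x) K.
      by have := is_deriveZ K (is_derive_id s 1); rewrite /GRing.scale /= mulr1.
    exact: is_deriveB h4 hk.
  - move=> s sT; rewrite subr_le0 ler_pdivrMl ?p2 ?oo// ler_pdivrMl ?p1 ?oo//.
    by apply: le_trans (yK s sT) _; rewrite le_eqVlt; apply/orP; left; apply/eqP; ring.
have /andP[t0 tT'] := tT; have T0 := le_trans t0 tT'.
have H2 : ln (1 + ln (1 + y t)) <= ln (1 + ln (1 + y 0)) + K * T.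
  have : K * t <= K * T by rewrite ler_wpM2l.
  by move: H; rewrite /f mulr0; lra.
rewrite -ler_expR lnK ?posrE ?p2// in H2.
have H3 : ln (1 + y t) <= expR (ln (1 + ln (1 + y 0)) + K * T) by lra.
rewrite -ler_expR lnK ?posrE ?p1// in H3.
lra.
Qed.

End Calculus.

(** * Differentiation of quadratic forms along curves *)

Section QformDerivative.
Context {R : realType}.
Implicit Types (r s t : R) (p : int -> R).
Variables (r C : R) (p : int -> R).
Hypotheses (p0 : forall k, 0 <= p k) (pC : forall k, p k <= C * wt r k) (C0 : 0 <= C).
Local Notation E := (hseq r).
Implicit Types a b : E.

Lemma qsummable_hseq a : qsummable p a.
Proof.
apply: zsummable_le (zsummableZ C (hseq_sum a)) => k.
by rewrite ger0_norm ?mulr_ge0 ?nsq_ge0// mulrA ler_wpM2r ?nsq_ge0.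
Qed.
Let S := qsummable_hseq.

Lemma qform_hseq_le a b : `|qform p a b| <= C * `|a| * `|b|.
Proof.
have q a' : qform p a' a' <= C * `|a'| ^+ 2.
  rewrite sqr_hnorm /qform; rewrite -zsumZ; last first.
    by apply: qdot_summable; [exact: wt_ge0|exact: hseq_sum|exact: hseq_sum].
  apply: ler_zsum => [||k]; first exact: qdot_summable.
    by apply: zsummableZ; apply: qdot_summable; [exact: wt_ge0|exact: hseq_sum|exact: hseq_sum].
  by rewrite dotcc mulrA ler_wpM2r ?nsq_ge0.
rewrite -ler_sqr ?nnegrE ?mulr_ge0// real_normK ?num_real//.
apply: le_trans (qform_CauchySchwarz p0 (S a) (S b)) _.
have -> : (C * `|a| * `|b|) ^+ 2 = (C * `|a| ^+ 2) * (C * `|b| ^+ 2) by ring.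
by apply: ler_pM => //; exact: qform_ge0.
Qed.

Lemma qformB a b c : qform p a (b - c) = qform p a b - qform p a c.
Proof.
have -> : qform p a (b - c) = qform p a (fun k => b k + (- c) k) by [].
rewrite (qformDr p0 (S a) (S b) (S (- c))); congr (_ + _).
have -> : qform p a (- c) = qform p a (fun k => real_complex R (-1) * c k).
  by congr qform; apply/funext => k; rewrite rmorphN1 mulN1r.
by rewrite (qformZr p0 _ (S a) (S c)) mulN1r.
Qed.

Lemma qform_sub a b :
  qform p a a - qform p b b = 2 * qform p b (a - b) + qform p (a - b) (a - b).
Proof.
have E1 : (a : int -> R[i]) = (fun k => b k + real_complex R 1 * (a - b) k).
  by apply/funext => k; rewrite rmorph1 mul1r coefBE addrC subrK.
have := qform_line p0 1 (S b) (S (a - b)); rewrite -E1 => ->; ring.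
Qed.

Lemma hderiv_qform (U : R -> E) t v : hderiv U t v ->
  hderiv (fun s => qform p (U s) (U s)) t (2 * qform p (U t) v).
Proof.
move=> H e e0.
(* [A] bounds the linear part of the increment and [B] the quadratic one, as |D| <= (1 + |v|) |s -
   t| near t; the summand 1 in the denominators excludes division by zero. *)
pose A := 2 * C * `|U t|; pose B := C * (1 + `|v|) ^+ 2.
have A0 : 0 <= A by rewrite !mulr_ge0.
have B0 : 0 <= B by rewrite mulr_ge0// sqr_ge0.
have e1p : 0 < Num.min 1 (e / (2 * (A + 1))).
  by rewrite lt_min ltr01/= divr_gt0// mulr_gt0// ltr_wpDl.
have [d [d0 Hd]] := H _ e1p; set e1 := Num.min _ _ in e1p Hd.
have e1le1 : e1 <= 1 by rewrite ge_min lexx.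
have e1le2 : e1 <= e / (2 * (A + 1)) by rewrite ge_min lexx orbT.
exists (Num.min d (e / (2 * (B + 1)))); split.
  by rewrite lt_min d0 divr_gt0// mulr_gt0// ltr_wpDl.
move=> s; rewrite lt_min => /andP[sd sB].
have hs := Hd s sd; set D := U s - U t.
have DN : `|D| <= (1 + `|v|) * `|s - t|.
  rewrite -[D](subrK ((s - t) *: v)); apply: le_trans (ler_normD _ _) _.
  rewrite normrZ mulrDl (mulrC `|v|) lerD2r; apply: le_trans hs _.
  by rewrite ler_wpM2r.
have -> : qform p (U s) (U s) - qform p (U t) (U t) - (s - t) *: (2 * qform p (U t) v) =
    2 * qform p (U t) (D - (s - t) *: v) + qform p D D.
  have -> : qform p (U t) (D - (s - t) *: v) = qform p (U t) D - (s - t) * qform p (U t) v.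
    by rewrite qformB; congr (_ - _); rewrite (qformZr p0 _ (S _) (S v)).
  rewrite qform_sub -/D /GRing.scale /=; ring.
apply: le_trans (ler_normD _ _) _.
have h1 : `|2 * qform p (U t) (D - (s - t) *: v)| <= A * (e1 * `|s - t|).
  rewrite normrM ger0_norm// /A -!mulrA ler_pM2l//.
  apply: le_trans (qform_hseq_le _ _) _; rewrite -mulrA !ler_wpM2l//.
have h2 : `|qform p D D| <= B * `|s - t| * `|s - t|.
  apply: le_trans (qform_hseq_le _ _) _.
  have -> : B * `|s - t| * `|s - t| = C * ((1 + `|v|) * `|s - t| * ((1 + `|v|) * `|s - t|)).
    rewrite /B; ring.
  by rewrite -mulrA ler_wpM2l// ler_pM.
have b1 : A * e1 <= e / 2.
  apply: (@le_trans _ _ ((A + 1) * (e / (2 * (A + 1))))).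
    by apply: ler_pM => //; [exact: ltW|rewrite lerDl].
  by rewrite le_eqVlt; apply/orP; left; apply/eqP; field; rewrite gt_eqF// ltr_wpDl.
have b2 : B * `|s - t| <= e / 2.
  apply: (@le_trans _ _ ((B + 1) * (e / (2 * (B + 1))))).
    by apply: ler_pM => //; [rewrite lerDl|exact: ltW].
  by rewrite le_eqVlt; apply/orP; left; apply/eqP; field; rewrite gt_eqF// ltr_wpDl.
apply: le_trans (lerD h1 h2) _; rewrite mulrA -mulrDl ler_wpM2r//.
by rewrite [e]splitr lerD.
Qed.

End QformDerivative.

Section CvgQform.
Context {R : realType} (r C : R) (p : int -> R).
Hypotheses (p0 : forall k, 0 <= p k) (pC : forall k, p k <= C * wt r k) (C0 : 0 <= C).

Lemma cvg_qform (F : set_system R) (U : R -> hseq r) (a : hseq r) : Filter F ->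
  U @ F --> a -> (fun s => qform p (U s) (U s)) @ F --> qform p a a.
Proof.
move=> FF Ua.
have D0 : (fun s => `|U s - a|) @ F --> (0 : R).
  have : (fun s => U s - a) @ F --> (0 : hseq r).
    by rewrite -(subrr a); apply: cvgB => //; exact: cvg_cst.
  by move=> /cvg_norm; rewrite normr0.
have D1 : (fun s => 2 * (C * `|a| * `|U s - a|) + C * `|U s - a| * `|U s - a|) @ F --> (0 : R).
  rewrite -[X in _ --> X](_ : 2 * (C * `|a| * 0) + C * 0 * 0 = 0); last by ring.
  by apply: cvgD; [do 2 apply: cvgMr|apply: cvgM => //; apply: cvgMr].
apply/cvgrPdist_le => e e0.
have /cvgrPdist_le /(_ e e0) := D1; apply: filterS => s; rewrite sub0r normrN => H.
rewrite distrC (qform_sub p0 pC).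
apply: le_trans (le_trans (ler_norm _) H); apply: le_trans (ler_normD _ _) _.
apply: lerD; last exact: (qform_hseq_le p0 pC C0).
by rewrite normrM (ger0_norm (ler0n R 2)) ler_pM2l// (qform_hseq_le p0 pC C0).
Qed.

End CvgQform.

(** * Energy, logarithmic bound and global existence *)

Section Energy.
Context {R : realType} (alpha r : R).
Hypotheses (alpha1 : 1 <= alpha) (r1 : 1 <= r) (ar : alpha <= r).
Local Notation E := (hseq r).
Local Notation F := (bbm alpha1 r1).
Local Notation curve := (solves (hmult alpha1) (hbil alpha1 r1)).
Implicit Types (t s tau T : R) (U : R -> E) (a : E).

Lemma bbm_lip m (a b : E) : `|a| <= m -> `|b| <= m ->
  `|F a - F b| <= (1 + 2 * (tame_cst r * wiener_cst) * m) * `|a - b|.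
Proof.
apply: quadF_lip => //.
- exact: hmultD.
- exact: hmultZ.
- exact: hbilDl.
- exact: hbilDr.
- exact: hbilZl.
- exact: hbilZr.
- by rewrite mulr_ge0 ?tame_cst_ge0// wiener_cst_ge0.
- by move=> x; rewrite mul1r; exact: hmult_le.
- exact: hbil_le.
Qed.

Lemma curve_bounds (a b : R) U : curve a b U -> exists m, 0 <= m /\ forall s t,
  a <= s <= b -> a <= t <= b -> `|U s| <= m /\ `|U s - U t| <= m * `|s - t|.
Proof.
apply: (@solves_bounds _ _ _ _ 1 (tame_cst r * wiener_cst)) => //.
- by rewrite mulr_ge0 ?tame_cst_ge0// wiener_cst_ge0.
- by move=> x; rewrite mul1r; exact: hmult_le.
- exact: hbil_le.
Qed.

Lemma curve_hderiv tau U t : curve 0 tau U -> 0 < t < tau -> hderiv U t (F (U t)).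
Proof.
move=> [K HK] /andP[t0 ttau] e e0.
have K1 : 0 < `|K| + 1 by rewrite ltr_wpDl.
exists (Num.min (Num.min t (tau - t)) (e / (`|K| + 1))); split.
  by rewrite !lt_min t0 subr_gt0 ttau divr_gt0.
move=> s; rewrite !lt_min -andbA => /and3P[]; rewrite !ltr_norml.
move=> /andP[s1 s2] /andP[s3 s4] /andP[s5 s6].
have s0 : 0 <= s <= tau by apply/andP; split; lra.
have tt : 0 <= t <= tau by apply/andP; split; lra.
apply: le_trans (HK s t s0 tt) _.
rewrite -real_normK ?num_real// expr2 mulrA ler_wpM2r//.
have : `|s - t| <= e / (`|K| + 1) by rewrite ler_norml; apply/andP; split; lra.
rewrite ler_pdivlMr// => H; apply: le_trans H; rewrite mulrC ler_wpM2l//.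
by apply: le_trans (ler_norm _) _; rewrite lerDl.
Qed.

Lemma curve_cvg tau U t : curve 0 tau U -> 0 <= t <= tau ->
  U @ within `[0, tau] (nbhs t) --> U t.
Proof.
move=> /curve_bounds[m [m0 H]] tt; have m1 : 0 < m + 1 by rewrite ltr_wpDl.
apply/cvgrPdist_le => e e0; rewrite near_withinE.
have d0 : 0 < e / (m + 1) by rewrite divr_gt0.
apply/nbhs_ballP; exists (e / (m + 1)) => //= s.
rewrite /ball /= in_itv /= => sd s0; have [_ h] := H t s tt s0.
apply: le_trans h _; apply: (@le_trans _ _ ((m + 1) * `|t - s|)).
  by rewrite ler_wpM2r// lerDl.
by rewrite mulrC -ler_pdivlMr// ltW.
Qed.

Let disp0 k : 0 <= disp alpha k. Proof. exact/ltW/disp_gt0. Qed.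
Let dispC k : disp alpha k <= 2 * wt r k. Proof. exact: disp_le. Qed.

(** The derivative vanishes at interior times by [qform_bbm], and continuity extends the comparison
    to the endpoints. *)
Lemma energy_le tau U t : curve 0 tau U -> 0 <= t <= tau ->
  qform (disp alpha) (U t) (U t) <= qform (disp alpha) (U 0) (U 0).
Proof.
move=> sU; apply: (@decreasing_itv _ (fun t => qform (disp alpha) (U t) (U t)) (fun=> 0)) => //.
  by move=> s sT; apply: (cvg_qform disp0 dispC) => //; exact: curve_cvg.
move=> s sT; apply: hderiv_is_derive.
have -> : 0 = 2 * qform (disp alpha) (U s) (F (U s)) by rewrite qform_bbm// mulr0.
by apply: (hderiv_qform disp0 dispC) => //; exact: curve_hderiv sU sT.
Qed.

(** Collects the 2 from differentiating |U|^2, the product constant, and the coefficient of the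
    logarithm in [anorm_log_le] for an energy at most M. *)
Definition growth_cst (M : R) : R := 2 * (1 + tame_cst r * (1 + (9 + 8 * ln 2) * (M + 1))).

(** Brezis-Gallouet with e = 1 / (2 (1 + |a|^2)): the H^r contribution 2 e |a|^2 is then at most 1,
    and ln (1 / e) is ln 2 + ln (1 + |a|^2). The bound S <= 1 + S^2 avoids a square root; the full
    logarithm is still affordable. *)
Lemma anorm_log_le a M : 0 <= M -> qform (disp alpha) a a <= M ->
  anorm a <= 1 + (9 + 8 * ln 2) * (M + 1) * (1 + ln (1 + `|a| ^+ 2)).
Proof.
move=> M0 aM; set y := `|a| ^+ 2; have y0 : 0 <= y by exact: sqr_ge0.
have l2 : 0 <= ln 2 :> R by rewrite ln_ge0// ler1n.
have ly : 0 <= ln (1 + y) by rewrite ln_ge0// lerDl.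
have HM N : \sum_(k <- zwin N) (1 + (absz k)%:R) * nsq (a k) <= M.
  apply: le_trans aM; apply: (@le_trans _ _ (\sum_(k <- zwin N) disp alpha k * nsq (a k))).
    by apply: ler_sum => k _; rewrite ler_wpM2r ?nsq_ge0// -absz_norm disp_ge.
  rewrite /qform; under [in leRHS]eq_fun do rewrite dotcc.
  apply: zwin_le_zsum => [k|]; first by rewrite mulr_ge0 ?nsq_ge0.
  exact: (qsummable_hseq disp0 dispC).
have p : 0 < 2 * (1 + y) by lra.
have ee : 0 < (2 * (1 + y))^-1 <= 2^-1.
  by rewrite invr_gt0 p /= lef_pV2 ?posrE//; lra.
apply: zsum_le => [|N]; first exact: hseq_asum.
have := Brezis_Gallouet N r1 ee HM; rewrite invrK -/y lnM ?posrE//; last by lra.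
have -> : 2 * (2 * (1 + y))^-1 * y = y / (1 + y) by field; rewrite gt_eqF//; lra.
have q1 : y / (1 + y) <= 1 by rewrite ler_pdivrMr; lra.
set S := \sum_(k <- _) _; set q := y / (1 + y) in q1 * => HS.
have H1 : S <= 1 + S ^+ 2 by have := sqr_ge0 (S - 1); rewrite sqrrB; nra.
apply: le_trans H1 _; rewrite lerD2l; apply: le_trans HS _.
apply: (@le_trans _ _ ((1 + 8 * (ln 2 + ln (1 + y))) * (M + 1))).
  by rewrite ler_wpM2l ?lerD2l//; lra.
rewrite mulrAC ler_wpM2r//; first by lra.
have := mulr_ge0 l2 ly; move: (ln 2) (ln (1 + y)) l2 ly => l l'; lra.
Qed.

Lemma apriori tau U t : curve 0 tau U -> 0 <= t <= tau ->
  `|U t| ^+ 2 <= expR (expR (ln (1 + ln (1 + `|U 0| ^+ 2)) +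
    growth_cst (qform (disp alpha) (U 0) (U 0)) * tau)).
Proof.
move=> sU; set M := qform _ _ _.
have M0 : 0 <= M by apply: qform_ge0 => //; exact: (qsummable_hseq disp0 dispC).
have l2 : 0 <= ln 2 :> R by rewrite ln_ge0// ler1n.
have tc := @tame_cst_ge0 R r.
have w0 := @wt_ge0 R r; have w1 k : wt r k <= 1 * wt r k by rewrite mul1r.
have C1 : 0 <= (9 + 8 * ln 2) * (M + 1) by rewrite mulr_ge0//; lra.
apply: (@Gronwall_log _ (fun t => `|U t| ^+ 2)
  (fun s => 2 * qform (wt r) (U s) (F (U s)))) => //.
- by rewrite /growth_cst !(mulr_ge0, addr_ge0)//; lra.
- move=> s sT; under eq_fun do rewrite sqr_hnorm; rewrite sqr_hnorm.
  by apply: (cvg_qform w0 w1) => //; exact: curve_cvg.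
- move=> s sT; under eq_fun do rewrite sqr_hnorm.
  apply: hderiv_is_derive; apply: (hderiv_qform w0 w1) => //.
  exact: curve_hderiv sU sT.
- move=> s /andP[s0 sT].
  have eM : qform (disp alpha) (U s) (U s) <= M.
    by apply: (energy_le sU); rewrite !ltW.
  have aM := anorm_log_le M0 eM.
  set y := `|U s| ^+ 2 in aM *; have y0 : 0 <= y by exact: sqr_ge0.
  have ly : 0 <= ln (1 + y) by rewrite ln_ge0// lerDl.
  have H := qform_hseq_le w0 w1 ler01 (U s) (F (U s)).
  have H2 := bbm_tame alpha1 r1 (U s).
  have H3 : qform (wt r) (U s) (F (U s)) <= y * (1 + tame_cst r * anorm (U s)).
    apply: le_trans (ler_norm _) _; apply: le_trans H _; rewrite mul1r /y expr2 -mulrA.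
    by rewrite ler_wpM2l.
  rewrite /growth_cst -!mulrA ler_pM2l//; apply: le_trans H3 _.
  rewrite [leRHS]mulrCA; apply: ler_pM => //.
  + by rewrite addr_ge0// mulr_ge0// anorm_ge0//; exact: hseq_asum.
  + by rewrite lerDr.
  + apply: (@le_trans _ _ (1 + tame_cst r *
      (1 + (9 + 8 * ln 2) * (M + 1) * (1 + ln (1 + y))))).
      by rewrite lerD2l ler_wpM2l.
    move: (ln (1 + y)) ly ((9 + 8 * ln 2) * (M + 1)) C1 => l l0 C C0.
    have h1 := mulr_ge0 tc l0.
    have -> : (1 + tame_cst r * (1 + C)) * (1 + l) =
      1 + tame_cst r * (1 + C * (1 + l)) + (l + tame_cst r * l) by ring.
    by rewrite lerDl addr_ge0.
Qed.

Theorem bbm_global (x0 : E) T : 0 <= T -> exists U, U 0 = x0 /\ curve 0 T U.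
Proof.
(* The a priori bound increases with the time, so its value [G] at T serves for every tau <= T. It
   concerns the squared norm, and z <= 1 + z^2 turns it into the bound 1 + G. *)
move=> T0; set G := expR (expR (ln (1 + ln (1 + `|x0| ^+ 2)) +
    growth_cst (qform (disp alpha) x0 x0) * T)).
apply: (@global_solution _ _ _ _ 1 (tame_cst r * wiener_cst) _ _ _ _ _ _ _ _ _ _ x0 T (1 + G)).
- exact: hmultD.
- exact: hmultZ.
- exact: hbilDl.
- exact: hbilDr.
- exact: hbilZl.
- exact: hbilZr.
- exact: ltr01.
- by rewrite mulr_ge0 ?tame_cst_ge0// wiener_cst_ge0.
- by move=> x; rewrite mul1r; exact: hmult_le.
- exact: hbil_le.
- exact: T0.
- move=> tau U /andP[tau0 tauT] U0 sU t tt.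
  have := apriori sU tt; rewrite U0 => H.
  have H2 : `|U t| ^+ 2 <= G.
    apply: le_trans H _; rewrite !ler_expR lerD2l ler_wpM2l//.
    have M0 : 0 <= qform (disp alpha) x0 x0.
      by apply: qform_ge0 => //; exact: (qsummable_hseq disp0 dispC).
    have l2 : 0 <= ln 2 :> R by rewrite ln_ge0// ler1n.
    have tc := @tame_cst_ge0 R r.
    by rewrite /growth_cst !(mulr_ge0, addr_ge0)//; lra.
  have H1 : `|U t| <= 1 + `|U t| ^+ 2.
    by have := sqr_ge0 (`|U t| - 1); move: `|U t| => z; nra.
  by apply: le_trans H1 _; rewrite lerD2l.
Qed.

End Energy.

(** * From sequences back to functions *)

Section Bridge.
Context {R : realType}.
Local Notation I := (@I R).
Local Notation mu := (@lebesgue_measure R).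
Implicit Types (k : int) (r : R) (f g h u v : R -> R).

Lemma ereal_zwin_le_esum (f : int -> R) N : (forall k, 0 <= f k) ->
  ((\sum_(k <- zwin N) f k)%:E <= \esum_(k in [set: int]) (f k)%:E)%E.
Proof.
move=> f0; apply: esum_ge; exists [set` zwin N].
  by split => //; exact: finite_seq.
by rewrite -fsbig_seq ?zwin_uniq// sumEFin.
Qed.

(** Every finite set of integers lies in a symmetric window, and every window is finite, so the
    unordered sum of [Hnorm] is the limit over windows. *)
Lemma esum_zsum (f : int -> R) : (forall k, 0 <= f k) -> zsummable f ->
  \esum_(k in [set: int]) (f k)%:E = (zsum f)%:E.
Proof.
move=> f0 sf; apply/eqP; rewrite eq_le; apply/andP; split.
  apply: ge_ereal_sup => _ [X [/finite_seqP[s0 ->] _] <-].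
  have -> : [set` s0] = [set` undup s0] by apply/seteqP; split=> k /=; rewrite mem_undup.
  have [s us] : exists s, uniq s /\ s = undup s0 by exists (undup s0); rewrite undup_uniq.
  rewrite -(proj2 us) -fsbig_seq ?(proj1 us)//= sumEFin lee_fin.
  pose N := (\max_(k <- s) absz k)%N.
  apply: le_trans (zwin_le_zsum N f0 sf); apply: ler_sum_zwin => // [|k kX].
    exact: (proj1 us).
  by apply: (leq_bigmax_seq (F := absz) (P := xpredT) (r := s)) kX _.
have H N : \sum_(k <- zwin N) f k <= fine (\esum_(k in [set: int]) (f k)%:E) \/
    \esum_(k in [set: int]) (f k)%:E = +oo%E.
  have := ereal_zwin_le_esum N f0; case: (\esum_(k in _) _) => [x||]; last by [].
    by rewrite lee_fin => ?; left.
  by right.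
have [E|E] := eqVneq (\esum_(k in [set: int]) (f k)%:E) +oo%E; first by rewrite E leey.
have E' : \esum_(k in [set: int]) (f k)%:E \is a fin_num.
  rewrite ge0_fin_numE ?lt_neqAle ?E ?leey//.
  by apply: esum_ge0 => k _; rewrite lee_fin.
rewrite -(fineK E') lee_fin; apply: zsum_le => // N.
by have [//|e] := H N; rewrite e eqxx in E.
Qed.

Lemma Hnorm_hseq r (a : hseq r) u : (forall k, fourier u k = a k) ->
  Hnorm r u = `|a|%:E.
Proof.
move=> ua; rewrite /Hnorm.
have -> : (fun k => ((1 + `|k%:~R : R| ^+ 2) `^ r *
    ComplexField.Normc.normc (fourier u k) ^+ 2)%:E) =
  (fun k => (wt r k * nsq (a k))%:E).
  by apply/funext => k; rewrite ua nsq_normc.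
rewrite esum_zsum => [|k|]; last exact: hseq_sum.
  rewrite poweR_EFin powR12_sqrt; last first.
    apply: zsum_ge0 => [k|]; last exact: hseq_sum.
    by rewrite mulr_ge0 ?wt_ge0 ?nsq_ge0.
  by rewrite hnormE /qform; under [in RHS]eq_fun do rewrite dotcc.
by rewrite mulr_ge0 ?wt_ge0 ?nsq_ge0.
Qed.

Lemma L2per_mL1 u : L2per u -> mL1 u.
Proof. by move=> [_ m l]; exact: L2_mL1. Qed.

Lemma Hper_hseq r u : Hper r u -> exists a : hseq r, forall k, fourier u k = a k.
Proof.
move=> [l2 fin]; have lu := L2per_mL1 l2.
suff H : hcoef r (fourier u) by exists (Hseq H).
split=> [k|]; first exact: fourier_opp.
move: fin; rewrite /Hnorm.
have -> : (fun k => ((1 + `|k%:~R : R| ^+ 2) `^ r *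
    ComplexField.Normc.normc (fourier u k) ^+ 2)%:E) =
  (fun k => (wt r k * nsq (fourier u k))%:E).
  by apply/funext => k; rewrite nsq_normc.
have p0 k : 0 <= wt r k * nsq (fourier u k) by rewrite mulr_ge0 ?wt_ge0 ?nsq_ge0.
have H N := ereal_zwin_le_esum N p0.
(* An infinite sum would have an infinite power 1/2, against finiteness of the norm; a finite one
   bounds all windows. *)
case: (\esum_(k in _) _) H => [x H _|_|H _].
- by apply: (@zsummable_ge0 _ _ x) => // N; have := H N; rewrite lee_fin.
- by rewrite poweRyr ?ltxx// invr_eq0 pnatr_eq0.
- by have := H 0%N.
Qed.

Lemma L2per_phi (a : int -> R[i]) : asum a -> L2per (phi a).
Proof.
move=> sa; have [m l] := bmeas_L2 (phi_bmeas sa).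
by split => //; exact: phi_periodic.
Qed.

Lemma Hper_phi r (a : hseq r) : 1 <= r -> Hper r (phi a).
Proof.
move=> r1; have sa := hseq_asum a r1; split; first exact: L2per_phi.
rewrite (@Hnorm_hseq _ a) ?ltry// => k; apply: fourier_phi => //; exact: coefN.
Qed.

Lemma fourier_inj_ae f g : mL1 f -> mL1 g -> (forall k, fourier f k = fourier g k) ->
  eqI f g.
Proof.
move=> lf lg fg; have [mf l1f] := lf; have [mg l1g] := lg.
have lfg : mL1 (fun x => f x - g x).
  by split; [exact: measurable_funB|exact: L1IB].
have H : eqI (fun x => f x - g x) (fun=> 0).
  by apply: fourier_eq0_ae => // k; rewrite fourierB// fg subrr.
apply: filterS H => x H xI; apply/eqP; rewrite -subr_eq0; apply/eqP; exact: H.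
Qed.

Lemma intI_ae f g : measurable_fun [set: R] f -> measurable_fun [set: R] g ->
  eqI f g -> intI f = intI g.
Proof.
move=> mf mg fg; congr fine; apply: ae_eq_integral.
- exact: measurable_I.
- by apply/measurable_EFinP/measurable_funTS.
- by apply/measurable_EFinP/measurable_funTS.
- by apply: filterS fg => x H xI; rewrite (H xI).
Qed.

Lemma fourier_ae f g k : mL1 f -> mL1 g -> eqI f g -> fourier f k = fourier g k.
Proof.
move=> lf lg fg; apply: dotc_inj => z; rewrite !dotc_fourier//; congr (_ * _).
have [mt _] := @trm_bmeas R z k.
apply: intI_ae.
- by apply: measurable_funM => //; case: lf.
- by apply: measurable_funM => //; case: lg.
- by apply: filterS fg => x H xI; rewrite (H xI).
Qed.

End Bridge.

(** * From curves of sequences to solutions *)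

Section Existence.
Context {R : realType} (alpha r T : R).
Hypotheses (alpha1 : 1 <= alpha) (r1 : 1 <= r).
Local Notation E := (hseq r).
Local Notation F := (bbm alpha1 r1).
Local Notation curve := (solves (hmult alpha1) (hbil alpha1 r1)).
Implicit Types (t s : R) (a b : E).

Let sa a : asum a. Proof. exact: hseq_asum. Qed.

Lemma fourier_hseq a k : fourier (phi a) k = a k.
Proof. by apply: fourier_phi => //; exact: coefN. Qed.

Lemma Hnorm_phi a : Hnorm r (phi a) = `|a|%:E.
Proof. by apply: Hnorm_hseq => k; exact: fourier_hseq. Qed.

Lemma phi_sub a b x : phi (a - b) x = phi a x - phi b x.
Proof.
have -> : phi (a - b) x = phi (fun k => a k + (- b) k) x by [].
rewrite phiD//; congr (_ + _).
have -> : phi (- b) x = phi (fun k => real_complex R (-1) * b k) x.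
  by congr phi; apply/funext => k; rewrite rmorphN1 mulN1r.
by rewrite phiZ// mulN1r.
Qed.

Lemma phi_scale c a x : phi (c *: a) x = c * phi a x.
Proof. exact: phiZ. Qed.

Lemma fBBM_of_curve t a : fBBM_equation alpha (phi a) (phi (F a)).
Proof.
have [ux [d1 d2 _ _]] := dx_exists a r1.
have [l2ux _] := d1; have [l2uux _] := d2.
have lux := L2per_mL1 l2ux; have luux := L2per_mL1 l2uux.
have l2F := L2per_phi (sa (F a)); have lF := L2per_mL1 l2F.
(* The image of u_t under D^alpha is taken to be what the equation prescribes, so the equation
   itself is trivial and the work is to check the coefficients of this image. *)
exists ux, (fun x => - (phi (F a) x + ux x + phi a x * ux x)); split => //.
- split=> [|k].
    have [p1 m1 i1] := l2ux; have [p2 m2 i2] := l2uux; have [p3 m3 i3] := l2F.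
    have [m i] : L2I (fun x => - (phi (F a) x + ux x + phi a x * ux x)).
      by apply: L2IN; apply: L2ID; [apply: L2ID|].
    by split => // x; rewrite p1 p3 phi_periodic.
  have lFx := mL1D lF lux.
  rewrite (fourierN k (mL1D lFx luux)) (fourierD k lFx luux) (fourierD k lF lux).
  rewrite -addrA (fourier_nonlinear alpha1 r1 d1 d2 k) fourier_hseq.
  move: (F a k) => c; rewrite /disp; move: (_ `^ _) => p.
  case: c => x y; rewrite /=; congr Complex; ring.
- by apply: aeW => x _; rewrite addrN.
Qed.

(** [phi] is linear and isometric for [Hnorm], so difference quotients of functions have the norms
    of those of the curve; the quadratic remainder makes them converge at the rate |s - t|,
    endpoints included. *)
Lemma C1_of_curve U : curve 0 T U ->
  C1_Hper r T (fun t => phi (U t)) (fun t => phi (F (U t))).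
Proof.
move=> sU; have [m [m0 Hm]] := curve_bounds sU.
have [K HK] := sU => t; rewrite in_itv/= => tT.
split; [exact: (Hper_phi (U t) r1)|exact: (Hper_phi (F (U t)) r1)| |].
- have -> : (fun s => Hnorm r (fun x => (s - t)^-1 * (phi (U s) x - phi (U t) x)
      - phi (F (U t)) x)) =
    (fun s => `|(s - t)^-1 *: (U s - U t) - F (U t)|%:E).
    apply/funext => s; rewrite -Hnorm_phi; congr Hnorm; apply/funext => x.
    by rewrite phi_sub phi_scale phi_sub.
  apply: cvg_EFin; first exact: nearW.
  apply/cvgrPdist_le => e e0.
  rewrite near_withinE; apply/nbhs_ballP; exists (e / (`|K| + 1)).
    by rewrite /= divr_gt0// ltr_wpDl.
  move=> s; rewrite /ball /= => st nst; rewrite in_itv /= => sT.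
  have st0 : s - t != 0 by rewrite subr_eq0.
  have -> : (s - t)^-1 *: (U s - U t) - F (U t) =
      (s - t)^-1 *: (U s - U t - (s - t) *: F (U t)).
    by rewrite [in RHS]scalerBr scalerA mulVf// scale1r.
  rewrite sub0r normrN normr_id normrZ normfV ler_pdivrMl ?normr_gt0//.
  apply: le_trans (HK s t sT tT) _; rewrite -real_normK ?num_real// expr2 mulrA.
  rewrite mulrC ler_wpM2l//.
  move: st; rewrite distrC ltr_pdivlMr ?ltr_wpDl// => st.
  apply: le_trans (ltW st); rewrite mulrC ler_wpM2l//.
  by apply: le_trans (ler_norm _) _; rewrite lerDl.
- have -> : (fun s => Hnorm r (fun x => phi (F (U s)) x - phi (F (U t)) x)) =
    (fun s => `|F (U s) - F (U t)|%:E).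
    apply/funext => s; rewrite -Hnorm_phi; congr Hnorm; apply/funext => x.
    by rewrite phi_sub.
  apply: cvg_EFin; first exact: nearW.
  pose D := (1 + 2 * (tame_cst r * wiener_cst) * m) * m.
  have D0 : 0 <= D.
    by rewrite mulr_ge0// addr_ge0// !mulr_ge0// ?tame_cst_ge0// wiener_cst_ge0.
  apply/cvgrPdist_le => e e0.
  rewrite near_withinE; apply/nbhs_ballP; exists (e / (D + 1)).
    by rewrite /= divr_gt0// ltr_wpDl.
  move=> s; rewrite /ball /= => st; rewrite in_itv /= => sT.
  have [bs bst] := Hm s t sT tT; have [bt _] := Hm t s tT sT.
  rewrite sub0r normrN normr_id; apply: le_trans (bbm_lip alpha1 r1 bs bt) _.
  apply: (@le_trans _ _ (D * `|s - t|)).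
    rewrite /D -[leRHS]mulrA ler_wpM2l//.
    by rewrite addr_ge0// !mulr_ge0// ?tame_cst_ge0// wiener_cst_ge0.
  move: st; rewrite distrC ltr_pdivlMr ?ltr_wpDl// => st.
  apply: le_trans (ltW st); rewrite mulrC ler_wpM2l//.
  by rewrite lerDl.
Qed.

End Existence.

(** * Uniqueness of solutions *)

Section Uniqueness.
Context {R : realType} (alpha r T : R).
Hypotheses (alpha1 : 1 <= alpha) (r1 : 1 <= r) (ar : alpha <= r) (T0 : 0 < T).
Local Notation E := (hseq r).
Local Notation F := (bbm alpha1 r1).
Local Notation curve := (solves (hmult alpha1) (hbil alpha1 r1)).
Implicit Types (t s : R) (a b : E).

(** The image of a [C1_Hper] curve in the sequence space, with the difference quotient replaced by
    its remainder, which makes sense at s = t too. *)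
Definition coef_curve (v vt : R -> R -> R) (A B : R -> E) := forall t, 0 <= t <= T ->
  [/\ forall k, fourier (v t) k = A t k, forall k, fourier (vt t) k = B t k &
      forall e, 0 < e -> exists d, 0 < d /\ forall s, 0 <= s <= T -> `|s - t| < d ->
        `|A s - A t - (s - t) *: B t| <= e * `|s - t|].

Lemma coef_curve_exists v vt : C1_Hper r T v vt -> exists A B, coef_curve v vt A B.
Proof.
move=> C1.
have /choice[A HA] : forall t, exists a : E, 0 <= t <= T ->
    forall k, fourier (v t) k = a k.
  (* [choice] requires a value at every time; outside [0, T] it is 0. *)
  move=> t; have [tT|/negP tT] := boolP (0 <= t <= T); last by exists 0.
  have [|hv _ _ _] := C1 t; first by rewrite in_itv.
  by have [a Ha] := Hper_hseq hv; exists a.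
have /choice[B HB] : forall t, exists a : E, 0 <= t <= T ->
    forall k, fourier (vt t) k = a k.
  move=> t; have [tT|/negP tT] := boolP (0 <= t <= T); last by exists 0.
  have [|_ hv _ _] := C1 t; first by rewrite in_itv.
  by have [a Ha] := Hper_hseq hv; exists a.
exists A, B => t tT; split; [exact: HA|exact: HB|move=> e e0].
have tT' : t \in `[0, T] by rewrite in_itv.
have [[l2t _] [l2tt _] H _] := C1 t tT'.
have lt := L2per_mL1 l2t; have ltt := L2per_mL1 l2tt.
move/fine_cvg : H => /cvgrPdist_le /(_ e e0).
rewrite near_withinE => /nbhs_ballP[d /= d0 Hd]; exists d; split => // s sT sd.
have [->|st] := eqVneq s t; first by rewrite !subrr scale0r subr0 !normr0 mulr0.
have sT' : s \in `[0, T] by rewrite in_itv.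
have [[l2s _] _ _ _] := C1 s sT'; have ls := L2per_mL1 l2s.
have := Hd s; rewrite /ball /= distrC sT' => /(_ sd st isT).
rewrite (@Hnorm_hseq _ _ ((s - t)^-1 *: (A s - A t) - B t)); last first.
  have lst : mL1 (fun x => v s x - v t x).
    have [m1 i1] := ls; have [m2 i2] := lt.
    by split; [exact: measurable_funB|exact: L1IB].
  move=> k; rewrite (fourierB k (mL1Z _ lst) ltt) (fourierZ _ k lst) (fourierB k ls lt).
  by rewrite !HA// HB.
rewrite /= sub0r normrN normr_id.
have st0 : s - t != 0 by rewrite subr_eq0.
have -> : (s - t)^-1 *: (A s - A t) - B t =
    (s - t)^-1 *: (A s - A t - (s - t) *: B t).
  by rewrite [in RHS]scalerBr scalerA mulVf// scale1r.
by rewrite normrZ normfV ler_pdivrMl ?normr_gt0// mulrC.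
Qed.

Lemma coef_curve_hderiv v vt A B t : coef_curve v vt A B -> 0 < t < T ->
  hderiv A t (B t).
Proof.
move=> H /andP[t0 tT] e e0; have tt : 0 <= t <= T by rewrite !ltW.
have [_ _ /(_ e e0)[d [d0 Hd]]] := H t tt.
exists (Num.min d (Num.min t (T - t))); split.
  by rewrite !lt_min d0 t0 subr_gt0.
move=> s; rewrite !lt_min => /and3P[sd s1 s2]; apply: Hd => //.
move: s1 s2; rewrite !ltr_norml => /andP[? ?] /andP[? ?]; apply/andP; split; lra.
Qed.

Lemma coef_curve_cvg v vt A B t : coef_curve v vt A B -> 0 <= t <= T ->
  A @ within `[0, T] (nbhs t) --> A t.
Proof.
move=> H tT; have [_ _ /(_ 1 ltr01)[d [d0 Hd]]] := H t tT.
apply/cvgrPdist_le => e e0; rewrite near_withinE.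
have q0 : 0 < 1 + `|B t| by rewrite ltr_wpDr.
apply/nbhs_ballP; exists (Num.min d (e / (1 + `|B t|))).
  by rewrite /= lt_min d0 divr_gt0.
move=> s; rewrite /ball /= lt_min distrC => /andP[sd se]; rewrite in_itv /= => sT.
have h := Hd s sT sd; rewrite distrC.
rewrite -[A s - A t](subrK ((s - t) *: B t)); apply: le_trans (ler_normD _ _) _.
rewrite normrZ; apply: le_trans (lerD h (lexx _)) _.
by rewrite mul1r -{1}[`|s - t|]mulr1 -mulrDr -ler_pdivlMr// ltW.
Qed.

(** The functions of a given solution are determined up to null sets only, so v v_x is first
    identified almost everywhere with the product for [A t]. Coefficient k of the equation then
    reads (1 + |k|^alpha)(B - F(A))_k = 0. *)
Lemma coef_curve_equation v vt A B t : coef_curve v vt A B -> 0 <= t <= T ->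
  L2per (v t) -> L2per (vt t) -> fBBM_equation alpha (v t) (vt t) -> B t = F (A t).
Proof.
move=> H tT l2v l2vt [vx [dvt [wx [l2d fd] eq]]].
have [HA HB _] := H t tT; have [l2vx _] := wx.
have sA := hseq_asum (A t) r1; have l2p := L2per_phi sA.
have lv := L2per_mL1 l2v; have lvt := L2per_mL1 l2vt; have lvx := L2per_mL1 l2vx.
have ld := L2per_mL1 l2d.
have [ux [d1 d2 _ _]] := dx_exists (A t) r1; have [l2ux _] := d1; have [l2uux _] := d2.
have lux := L2per_mL1 l2ux; have luux := L2per_mL1 l2uux.
have e1 : eqI (v t) (phi (A t)).
  by apply: fourier_inj_ae => // [|k]; [exact: L2per_mL1|rewrite HA fourier_hseq].
have fx k : fourier vx k = fourier ux k.
  by rewrite (is_weak_dx_fourier k l2v wx) (is_weak_dx_fourier k l2p d1) HA fourier_hseq.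
have e2 : eqI vx ux by exact: fourier_inj_ae.
have lvvx : mL1 (fun x => v t x * vx x).
  have [_ mv iv] := l2v; have [_ mx ix] := l2vx.
  by split; [exact: measurable_funM|exact: L2I_mul].
have e3 : eqI (fun x => v t x * vx x) (fun x => phi (A t) x * ux x).
  by apply: filterS2 e1 e2 => x H1 H2 xI; rewrite H1// H2.
apply: hseq_ext => k.
have l0 : mL1 (fun _ : R => 0 : R) := bmeas_mL1 (bmeas_cst 0).
have := fourier_ae k (mL1D (mL1D (mL1D lvt lvx) lvvx) ld) l0 eq.
rewrite (fourierD k (mL1D (mL1D lvt lvx) lvvx) ld) (fourierD k (mL1D lvt lvx) lvvx).
rewrite (fourierD k lvt lvx) (fourier_ae k lvvx luux e3) fx fd HB -(addrA (B t k)).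
rewrite (fourier_nonlinear alpha1 r1 d1 d2 k).
have -> : fourier (fun _ : R => 0 : R) k = 0.
  have -> : (fun _ : R => 0 : R) = (fun _ : R => 0 * 0) by apply/funext => x; rewrite mul0r.
  by rewrite (fourierZ 0 k l0) rmorph0 mul0r.
have dp := disp_gt0 alpha k; rewrite /disp in dp *.
move: (_ `^ _) dp (F (A t) k) (B t k) => p p0 [x y] [x' y'] [] h1 h2.
have h3 : (1 + p) * (x' - x) = 0 by move: h1; lra.
have h4 : (1 + p) * (y' - y) = 0 by move: h2; lra.
have n0 : 1 + p != 0 by rewrite gt_eqF.
by congr Complex; apply/eqP; rewrite -subr_eq0; apply/eqP; apply: (mulfI n0); rewrite mulr0.
Qed.

(** Gronwall's inequality for |U - A|^2, with the Lipschitz constant of the vector field on a ball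
    containing both curves; [A] is bounded as a continuous curve on a compact interval. *)
Lemma curve_unique (U A B : R -> E) v vt : curve 0 T U -> coef_curve v vt A B ->
  (forall t, 0 < t <= T -> B t = F (A t)) -> A 0 = U 0 ->
  forall t, 0 <= t <= T -> U t = A t.
Proof.
move=> sU HA HB A0 t tT.
have [m [m0 Hm]] := curve_bounds sU.
have [M [M0 AM]] : exists M, 0 <= M /\ forall s, 0 <= s <= T -> `|A s| <= M.
  have C : {within `[0, T], continuous (fun s => `|A s|)}.
    apply/subspace_continuousP => s /=; rewrite in_itv /= => sT.
    by apply: cvg_norm; exact: coef_curve_cvg HA sT.
  have [c cT Hc] := EVT_max (ltW T0) C.
  by exists `|A c|; split => // s sT; exact: Hc.
pose K := 2 * (1 + 2 * (tame_cst r * wiener_cst) * Num.max m M).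
have w0 := @wt_ge0 R r; have w1 k : wt r k <= 1 * wt r k by rewrite mul1r.
have oo s : 0 < s < T -> 0 <= s <= T by move=> /andP[s0 sT]; rewrite !ltW.
have Hy : `|U t - A t| ^+ 2 <= 0.
  apply: (@Gronwall0 _ (fun t => `|U t - A t| ^+ 2)
    (fun s => 2 * qform (wt r) (U s - A s) (F (U s) - B s)) T K) => //.
  - move=> s sT; under eq_fun do rewrite sqr_hnorm; rewrite sqr_hnorm.
    have cU := curve_cvg sU sT; have cA := coef_curve_cvg HA sT.
    have cD := cvgB cU cA.
    by apply: (cvg_qform w0 w1) => //; apply: cD.
  - move=> s sT; under eq_fun do rewrite sqr_hnorm.
    apply: hderiv_is_derive.
    apply: (@hderiv_qform _ _ _ _ w0 w1 ler01 (fun s => U s - A s)).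
    exact: hderivB (curve_hderiv sU sT) (coef_curve_hderiv HA sT).
  - move=> s sT; have /andP[s0 sT'] := sT; have sT2 : 0 < s <= T by rewrite s0 ltW.
    rewrite (HB s sT2).
    rewrite /K -[leRHS]mulrA ler_pM2l//; apply: le_trans (ler_norm _) _.
    apply: le_trans (qform_hseq_le w0 w1 ler01 _ _) _.
    rewrite mul1r expr2 mulrCA ler_wpM2l//.
    have [hU _] := Hm s s (oo s sT) (oo s sT); have hA := AM s (oo s sT).
    by apply: bbm_lip; rewrite le_max ?hU ?hA ?orbT.
  - by rewrite A0 subrr normr0 expr0n.
apply/eqP; rewrite -subr_eq0 -normr_eq0 -sqrf_eq0 eq_le Hy sqr_ge0//.
Qed.

End Uniqueness.

(** * Global well-posedness *)

Theorem theorem3p2 (R : realType) (alpha r T : R) (u0 : R -> R)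
    (halpha : 1 <= alpha <= 2) (hr : alpha <= r) (hT : 0 < T)
    (hu0 : Hper r u0) :
  exists u : R -> R -> R,
    fBBM_solution alpha r T u0 u /\
    forall v : R -> R -> R, fBBM_solution alpha r T u0 v ->
      forall t : R, t \in `[0, T] -> eqI (u t) (v t).
Proof.
have /andP[alpha1 _] := halpha; have r1 := le_trans alpha1 hr.
have [a0 Ha0] := Hper_hseq hu0; have [l2u0 _] := hu0; have lu0 := L2per_mL1 l2u0.
have [U [U0 sU]] := bbm_global alpha1 r1 hr a0 (ltW hT).
have lphi (a : hseq r) : mL1 (phi a) := L2per_mL1 (L2per_phi (hseq_asum a r1)).
exists (fun t => phi (U t)); split.
  exists (fun t => phi (bbm alpha1 r1 (U t))); split.
  - exact: C1_of_curve.
  - by move=> t _; exact: fBBM_of_curve.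
  - by apply: fourier_inj_ae => // k; rewrite U0 Ha0 fourier_hseq.
move=> v [vt [C1 eqn v0]] t tT.
have [A [B HAB]] := coef_curve_exists C1.
have T00 : 0 <= (0 : R) <= T by rewrite lexx ltW.
have HB s : 0 < s <= T -> B s = bbm alpha1 r1 (A s).
  move=> /andP[s0 sT].
  have sT' : s \in `[0, T] by rewrite in_itv /= (ltW s0).
  have [[l2v _] [l2vt _] _ _] := C1 s sT'.
  apply: (coef_curve_equation alpha1 r1 HAB) => //.
  by apply: eqn; rewrite in_itv /= s0.
have [HA0 _ _] := HAB 0 T00.
have z0 : (0 : R) \in `[0, T] by rewrite in_itv.
(* The initial value is attained almost everywhere only, which suffices because coefficients ignore
   null sets. *)
have A0 : A 0 = U 0.
  have [[l2v _] _ _ _] := C1 0 z0.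
  apply: hseq_ext => k; rewrite U0 -Ha0 -HA0; apply: fourier_ae => //.
  exact: L2per_mL1.
have tT2 : 0 <= t <= T by move: tT; rewrite in_itv.
have [[l2v _] _ _ _] := C1 t tT; have [HA _ _] := HAB t tT2.
apply: fourier_inj_ae => // [|k]; first exact: L2per_mL1.
by rewrite HA (curve_unique hT sU HAB HB A0 tT2) fourier_hseq.
Qed.
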